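(* Let $N\ge2$, $\sigma_c>0$, $a\in\mathbb{N}$, and let $D_0\subset\mathbb{R}^N$ be a ball. Then there exists some bounded domain $\Omega\supset\supset D_0$, with analytic boundary, such that $(D_0,\Omega)$ are not concentric balls but satisfy some overdetermination of type $(a,0)$.
   Context: $\mathbb{N}$ is the set of positive integers. A domain is a connected open set; $A\subset\subset B$ means $\overline A\subset B$. ''$(D,\Omega)$ are not concentric balls'' means that it is not the case that $D$ and $\Omega$ are both balls with the same center. Two-phase problem: for bounded domains $D\subset\subset\Omega$ of $\mathbb{R}^N$ with $\Omega\setminus\overline D$ connected and a constant $\sigma_c>0$, set $\sigma:=\sigma_c\chi_D+\chi_{\Omega\setminus D}$ ($\chi$ = characteristic function), and let $u\in H_0^1(\Omega)$ be the unique weak solution of $\operatorname{div}(\sigma\nabla u)=N$ in $\Omega$, $u=0$ on $\partial\Omega$, that is $-\int_\Omega\langle\sigma\nabla u,\nabla\varphi\rangle\,dx=N\int_\Omega\varphi\,dx$ for all $\varphi\in H_0^1(\Omega)$. For a subdomain $\omega\subset\subset\Omega$ with $\partial\omega\cap\partial D=\varnothing$, $\partial\omega$ is an overdetermined level set for $u$ if both $u$ and $|\nabla u|$ are constant on $\partial\omega$. For nonnegative integers $a,b$, the pair $(D,\Omega)$ (or its solution $u$) satisfies an overdetermination of type $(a,b)$ if there exist domains $\omega_1,\dots,\omega_{a+b}$, each with connected boundary, such that $\omega_1\subset\subset\dots\subset\subset\omega_a\subset\subset D\subset\subset\omega_{a+1}\subset\subset\dots\subset\subset\omega_{a+b}\subset\subset\Omega$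 and each $\partial\omega_i$ is an overdetermined level set for $u$ (the constant values of $u$ and $|\nabla u|$ may depend on $i$). *)

(* Defs.v *)
From HB Require Import structures.
From mathcomp Require Import all_boot all_order all_algebra.
From mathcomp Require Import all_classical all_reals all_analysis.

Set Implicit Arguments.
Unset Strict Implicit.
Unset Printing Implicit Defensive.
Import Order.TTheory GRing.Theory Num.Theory.
Import numFieldNormedType.Exports.
Local Open Scope classical_set_scope.
Local Open Scope ring_scope.

(* 'rV[R]_n carries the product sigma-algebra, i.e. the one generated by the
   coordinate functions; it is the Borel sigma-algebra of R^n. *)
Definition measure_rV_display : measure_display -> measure_display.
Proof. exact. Qed.

Section measurable_rV.
Context {d} {T : measurableType d}.
Variable n : nat.

Let coors : 'I_n -> 'rV[T]_n -> T := fun i x => x ord0 i.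

Let rV_set0 : g_sigma_preimage coors set0.
Proof. exact: sigma_algebra0. Qed.

Let rV_setC A : g_sigma_preimage coors A -> g_sigma_preimage coors (~` A).
Proof. exact: sigma_algebraC. Qed.

Let rV_bigcup (F : _^nat) : (forall i, g_sigma_preimage coors (F i)) ->
  g_sigma_preimage coors (\bigcup_i (F i)).
Proof. exact: sigma_algebra_bigcup. Qed.

HB.instance Definition _ := @isMeasurable.Build (measure_rV_display d)
  'rV[T]_n (g_sigma_preimage coors) rV_set0 rV_setC rV_bigcup.

Lemma measurable_coord_rV (i : 'I_n) :
  measurable_fun [set: 'rV[T]_n] (fun x => x ord0 i).
Proof.
move=> _ Y mY; rewrite setTI; apply: sub_sigma_algebra => /=.
rewrite -bigcup_seq/=; exists i => /=; first by rewrite mem_index_enum.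
by exists Y => //; rewrite setTI.
Qed.

Lemma measurable_fun_rVP d' (T' : measurableType d') (f : T' -> 'rV[T]_n) :
  (forall i, measurable_fun [set: T'] (fun x => f x ord0 i)) ->
  measurable_fun [set: T'] f.
Proof.
move=> mf; suff H : measurable `<=` [set A : set 'rV[T]_n | measurable (f @^-1` A)].
  by move=> _ A mA; rewrite setTI; exact: H.
apply: smallest_sub.
  split => /=.
  - by rewrite preimage_set0.
  - by move=> A mA /=; rewrite setTD -preimage_setC; exact: measurableC.
  - by move=> F mF /=; rewrite preimage_bigcup; exact: bigcup_measurable.
move=> A; rewrite -bigcup_seq => -[i _ [B mB <-]] /=.
rewrite setTI; have := mf i measurableT B mB.
by rewrite setTI.
Qed.

End measurable_rV.

Section lebesgue_rV.
Context {R : realType}.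

Definition cons_rV n (p : measurableTypeR R * 'rV[measurableTypeR R]_n) :
    'rV[measurableTypeR R]_n.+1 :=
  row_mx (\row_(_ < 1) p.1) p.2 : 'rV_(1 + n).

Definition uncons_rV n (x : 'rV[measurableTypeR R]_n.+1) :
    measurableTypeR R * 'rV[measurableTypeR R]_n :=
  (x ord0 ord0, @rsubmx _ 1 1 n x).

Lemma cons_rVK n : cancel (@cons_rV n) (@uncons_rV n).
Proof.
move=> [a x]; rewrite /uncons_rV /cons_rV; congr (_, _); last by rewrite row_mxKr.
have -> : (ord0 : 'I_n.+1) = @lshift 1 n ord0 by exact: val_inj.
by rewrite (@row_mxEl _ 1 1 n) mxE.
Qed.

Lemma uncons_rVK n : cancel (@uncons_rV n) (@cons_rV n).
Proof.
move=> x; rewrite /uncons_rV /cons_rV /=.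
apply: etrans (@hsubmxK _ 1 1 n x); apply: (congr2 (@row_mx _ 1 1 n)) => //.
apply/rowP => i; rewrite !mxE; congr (x _ _); apply: val_inj => /=.
by rewrite (ord1 i).
Qed.

Lemma measurable_cons_rV n : measurable_fun [set: _] (@cons_rV n).
Proof.
apply: measurable_fun_rVP => i.
have -> : i = @unsplit 1 n (@fintype.split 1 n i) by rewrite splitK.
case: (@fintype.split 1 n i) => j /=.
  rewrite (_ : (fun x => _) = fst)//; apply/funext => x.
  by rewrite /cons_rV (@row_mxEl _ 1 1 n) mxE.
rewrite (_ : (fun x => _) = (fun y : 'rV_n => y ord0 j) \o snd); last first.
  by apply/funext => x; rewrite /cons_rV (@row_mxEr _ 1 1 n).
apply: measurableT_comp => //.
exact: measurable_coord_rV.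
Qed.

Lemma measurable_uncons_rV n : measurable_fun [set: _] (@uncons_rV n).
Proof.
apply/measurable_fun_pairP; split => /=; first exact: measurable_coord_rV.
apply: measurable_fun_rVP => i.
rewrite (_ : (fun x => _) =
  (fun x : 'rV[measurableTypeR R]_n.+1 => x ord0 (@rshift 1 n i))); last first.
  by apply/funext => x; rewrite mxE.
exact: measurable_coord_rV.
Qed.

Section step.
Context (n : nat).
Variable mu : {sigma_finite_measure set 'rV[measurableTypeR R]_n -> \bar R}.

Definition lebesgue_rV_step : set 'rV[measurableTypeR R]_n.+1 -> \bar R :=
  pushforward (lebesgue_measure \x mu)%E (@cons_rV n).

Let step0 : lebesgue_rV_step set0 = 0%E.
Proof. by rewrite /lebesgue_rV_step /pushforward preimage_set0 measure0. Qed.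

Let step_ge0 A : (0 <= lebesgue_rV_step A)%E.
Proof. by rewrite /lebesgue_rV_step /pushforward; exact: measure_ge0. Qed.

Let step_sigma_additive : semi_sigma_additive lebesgue_rV_step.
Proof.
move=> F mF tF mUF; rewrite /lebesgue_rV_step /pushforward preimage_bigcup.
apply: measure_semi_sigma_additive.
- by move=> k; rewrite -[X in measurable X]setTI; exact: measurable_cons_rV.
- apply/trivIsetP => /= i j _ _ ij; rewrite -preimage_setI.
  by move/trivIsetP : tF => /(_ _ _ _ _ ij) ->//; rewrite preimage_set0.
- by rewrite -preimage_bigcup -[X in measurable X]setTI; exact: measurable_cons_rV.
Qed.

HB.instance Definition _ := isMeasure.Build _ _ _
  lebesgue_rV_step step0 step_ge0 step_sigma_additive.

Let step_sigma_finite : sigma_finite setT lebesgue_rV_step.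
Proof.
pose l1 : {sigma_finite_measure set measurableTypeR R -> \bar R} :=
  lebesgue_measure.
have /sigma_finiteP[F [TF ndF Foo]] := sigma_finiteT l1.
have /sigma_finiteP[G [TG ndG Goo]] := sigma_finiteT mu.
exists (fun k => @uncons_rV n @^-1` (F k `*` G k)).
  rewrite -preimage_bigcup (_ : \bigcup_k _ = setT) ?preimage_setT//.
  rewrite -subTset => -[x y] _.
  have [k _ Fkx] : (\bigcup_k F k) x by rewrite -TF.
  have [m _ Gmy] : (\bigcup_k G k) y by rewrite -TG.
  exists (maxn k m) => //; split => /=.
    by move: x Fkx; exact/subsetPset/ndF/leq_maxl.
  by move: y Gmy; exact/subsetPset/ndG/leq_maxr.
move=> k; have [mF Fk] := Foo k; have [mG Gk] := Goo k; split.
  rewrite -[X in measurable X]setTI; apply: measurable_uncons_rV => //.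
  exact: measurableX.
rewrite /lebesgue_rV_step /pushforward -comp_preimage.
rewrite (_ : _ \o _ = id) ?preimage_id; last first.
  by apply/funext => p /=; rewrite cons_rVK.
by rewrite product_measure1E// lte_mul_pinfty// ge0_fin_numE.
Qed.

HB.instance Definition _ := Measure_isSigmaFinite.Build _ _ _
  lebesgue_rV_step step_sigma_finite.
End step.

(* n-dimensional Lebesgue measure: the unit mass on the one point space R^0,
   then iterated products with the one-dimensional Lebesgue measure. *)
Fixpoint lebesgue_rV n :
    {sigma_finite_measure set 'rV[measurableTypeR R]_n -> \bar R} :=
  match n with
  | 0 => @dirac _ 'rV[measurableTypeR R]_0 0 R
  | n'.+1 => lebesgue_rV_step (lebesgue_rV n')
  end.

End lebesgue_rV.

Section euclidean.
Context {R : realType} {n : nat}.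
Implicit Types (x y p : 'rV[R]_n) (A B : set 'rV[R]_n).

Definition dotv x y : R := \sum_i x 0 i * y 0 i.

(* The library norm `|x| on 'rV[R]_n is the sup norm: it induces the usual
   topology and bounded sets, but balls and |grad u| need the Euclidean norm. *)
Definition enorm x : R := Num.sqrt (dotv x x).

Definition eball (c : 'rV[R]_n) (r : R) : set 'rV[R]_n :=
  [set x | enorm (x - c) < r].

Definition is_eball A := exists c r, 0 < r /\ A = eball c r.

Definition concentric_balls A B :=
  exists c r s, [/\ 0 < r, 0 < s, A = eball c r & B = eball c s].

(* [connected set0] holds in the library, hence the nonemptiness condition. *)
Definition domain A := [/\ A !=set0, open A & connected A].

Definition bdry A := closure A `\` A°.

(* Only used between bounded sets, where closure A is compact. *)
Definition compactly_contained A B := closure A `<=` B.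

Definition partial (i : 'I_n) (f : 'rV[R]_n -> R) : 'rV[R]_n -> R :=
  'D_(delta_mx 0 i) f.

Definition grad (f : 'rV[R]_n -> R) x : 'rV[R]_n := \row_i partial i f x.

(* Class C^k on an open set A. *)
Fixpoint Ck (k : nat) A (f : 'rV[R]_n -> R) : Prop :=
  (forall x, A x -> {for x, continuous f}) /\
  match k with
  | 0 => True
  | k'.+1 => forall i : 'I_n,
      (forall x, A x -> derivable f x (delta_mx 0 i)) /\ Ck k' A (partial i f)
  end.

Definition monomial (a : {ffun 'I_n -> nat}) x : R := \prod_i x 0 i ^+ a i.

(* Near p, f is the sum of an absolutely convergent power series in n
   variables, summed along the boxes of multi-indices {0, ..., k-1}^n. *)
Definition real_analytic_at (f : 'rV[R]_n -> R) p :=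
  exists (c : {ffun 'I_n -> nat} -> R) (r : R), 0 < r /\
    forall x, (forall i, `|x 0 i - p 0 i| < r) ->
      summable [set: {ffun 'I_n -> nat}]
        (fun a => (c a * monomial a (x - p))%:E) /\
      (fun k : nat => \sum_(b : {ffun 'I_n -> 'I_k})
         (let a := [ffun i => val (b i)] in c a * monomial a (x - p)))
        @ \oo --> f x.

End euclidean.

(* Near each boundary point, in suitable orthonormal coordinates
   (x', t) = (x *m P, x *m e), A is the strict epigraph {t > g(x')} of a real
   analytic function g of n - 1 variables; for n >= 1 the equation on P and e
   says that the n x n matrix [P e] is orthogonal. *)
Definition analytic_boundary {R : realType} {n : nat} (A : set 'rV[R]_n) :=
  forall p : 'rV[R]_n, bdry A p ->
    exists (P : 'M[R]_(n, n.-1)) (e : 'cV[R]_n) (r : R) (g : 'rV[R]_n.-1 -> R),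
      [/\ P *m P^T + e *m e^T = 1%:M,
          0 < r,
          forall y : 'rV[R]_n.-1, enorm (y - p *m P) < r -> real_analytic_at g y &
          forall x : 'rV[R]_n, enorm (x - p) < r ->
            (A x <-> g (x *m P) < (x *m e) 0 0)].

Section sobolev.
Context {R : realType} {n : nat}.
Variable Om : set 'rV[R]_n.
Implicit Types (u f : 'rV[R]_n -> R) (G : 'rV[R]_n -> 'rV[R]_n).

Local Notation mu := (@lebesgue_rV R n).

Definition L2 f :=
  measurable_fun (Om : set 'rV[measurableTypeR R]_n) f /\
  (\int[mu]_(x in Om) ((f x) ^+ 2)%:E < +oo)%E.

Definition test_function (phi : 'rV[R]_n -> R) :=
  (forall k, Ck k setT phi) /\
  exists K : set 'rV[R]_n, [/\ compact K, K `<=` Om & forall x, ~ K x -> phi x = 0].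

Definition weak_gradient u G :=
  forall phi, test_function phi -> forall i,
    (\int[mu]_(x in Om) (u x * partial i phi x)) =
    - (\int[mu]_(x in Om) (G x 0 i * phi x)).

(* u is in H^1(Om), with (a.e. unique) weak gradient G. *)
Definition H1 u G :=
  [/\ L2 u, forall i, L2 (fun x => G x 0 i) & weak_gradient u G].

(* H^1_0(Om) is the closure of the test functions in H^1(Om). *)
Definition H10 u G :=
  H1 u G /\
  exists phi : nat -> 'rV[R]_n -> R,
    (forall k, test_function (phi k)) /\
    (fun k => \int[mu]_(x in Om)
       ((u x - phi k x) ^+ 2 + enorm (G x - grad (phi k) x) ^+ 2)%:E)%E
      @ \oo --> 0%E.

End sobolev.

Section two_phase.
Context {R : realType} {n : nat}.
Variables (sc : R) (D Om : set 'rV[R]_n).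
Implicit Types (u : 'rV[R]_n -> R) (om : set 'rV[R]_n).

Local Notation mu := (@lebesgue_rV R n).

Definition conductivity (x : 'rV[R]_n) : R :=
  sc * \1_D x + \1_(Om `\` D) x.

Definition weak_solution u :=
  exists G, H10 Om u G /\
    forall phi H, H10 Om phi H ->
      - (\int[mu]_(x in Om) (conductivity x * dotv (G x) (H x))) =
      n%:R * (\int[mu]_(x in Om) phi x).

(* The weak solution is only defined up to null sets; the last clause selects
   its classical representative away from the interface (where it is smooth by
   elliptic regularity), so that pointwise values of u and grad u make sense. *)
Definition two_phase_solution u :=
  weak_solution u /\ Ck 1 (Om `\` bdry D) u.

Definition overdetermined_level_set u om :=
  [/\ domain om, compactly_contained om Om, bdry om `&` bdry D = set0 &
      (exists c, forall x, bdry om x -> u x = c) /\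
      (exists c, forall x, bdry om x -> enorm (grad u x) = c)].

(* The whole chain of inclusions is stored in one sequence W: with om_1, om_2,
   ... the level sets, W 0, ..., W (a-1) are om_1, ..., om_a, then W a = D,
   W (a+1), ..., W (a+b) are om_(a+1), ..., om_(a+b), and W (a+b+1) = Om. *)
Definition overdetermination_type (a b : nat) :=
  exists u, two_phase_solution u /\
  exists W : nat -> set 'rV[R]_n,
    [/\ W a = D, W (a + b).+1 = Om,
        forall i, (i <= a + b)%N -> compactly_contained (W i) (W i.+1) &
        forall i, (i <= a + b)%N -> i <> a ->
          connected (bdry (W i)) /\ overdetermined_level_set u (W i)].

End two_phase.

(* Main.v *)
(* Inside D0 = B(c, r0) take u to be a quadratic polynomial that is radial about
   the point c + eps e_0 instead of c: each small sphere about that point is then an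
   overdetermined level set.  Outside D0 the continuation is explicit: a quadratic
   polynomial radial about c minus eps (alpha + beta |x - c|^-N) (x - c)_0, whose
   second term is harmonic; alpha and beta are fixed by the transmission conditions
   on the boundary of D0.  For eps small, Om := {u < 0} is a perturbation of
   B(c, 2 r0) that is not a ball centered at c.

   The boundary is analytic by the implicit function theorem for the polynomial
   system in (x, s) made of s^2 = |x - c|^2 and s^N u = 0.  The weak formulation is
   obtained by replacing max(|x - c|^2, r0^2) by smooth functions in u and in
   sigma grad u, keeping the divergence of the latter equal to N. *)
Require Import Defs.
From mathcomp Require Import all_boot all_order all_algebra.
From mathcomp Require Import all_classical all_reals all_analysis.
From mathcomp Require Import measurable_realfun ring lra.
From mathcomp.multinomials Require Import -(notations) mpoly.
Import Order.TTheory GRing.Theory Num.Theory.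
Import numFieldNormedType.Exports.
Set Implicit Arguments.
Unset Strict Implicit.
Unset Printing Implicit Defensive.
Local Open Scope classical_set_scope.
Local Open Scope ring_scope.

(** * Measurability and integrability on R^n *)

(** Moving the centre of a quadratic polynomial adds a linear term, a harmonic function of degree 1.
    Its continuation across the sphere is thus a radial profile times the same coordinate: the
    Cauchy problem on the interface is solved in closed form, for all [|x - c| >= r0]. As every
    small sphere about the shifted centre is overdetermined, [Om] does not depend on [a].

    Most of the geometry rests on one estimate. If [eps * Lip <= r0 / 8], the perturbation is
    r0/8-Lipschitz for [r0 <= |x - c| <= 4 r0], where the main part of [u] has radial derivative
    [|x - c| >= r0]. Star-shapedness, a nonzero Jacobian on the boundary and uniqueness of the zero
    of [u] on lines across it follow.

    Two obstacles shape the rest. As sigma jumps, every integration by parts is done on smooth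
    fields against compactly supported functions, and limits are taken along sequences that are
    eventually stationary at each point. And analyticity is required at all points of a
    neighbourhood, while the implicit function theorem yields one power series at a time: the series
    are glued by uniqueness of the zero. *)

Section measure_rV.
Context {R : realType}.
Local Notation RM := (measurableTypeR R).

Lemma mx_norm_lt n (x : 'rV[R]_n) (e : R) :
  0 < e -> (forall i, `|x 0 i| < e) -> `|x| < e.
Proof.
move=> e0 h; rewrite [ltLHS]/Num.norm/= mx_normrE; apply/bigmax_ltP; split => //.
by move=> [i j] _ /=; rewrite (ord1 i).
Qed.

Lemma coord_le_mx_norm n (x : 'rV[R]_n) i : `|x 0 i| <= `|x|.
Proof.
rewrite [leRHS]/Num.norm/= mx_normrE.
by apply/bigmax_geP; right; exists (0, i).
Qed.

Lemma measurable_box n (lo hi : 'I_n -> R) :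
  measurable ([set x | forall i, lo i < x 0 i < hi i] : set 'rV[RM]_n).
Proof.
rewrite [X in measurable X](_ : _ = \big[setI/setT]_(i <- index_enum 'I_n)
    ((fun x : 'rV[RM]_n => x 0 i) @^-1` `]lo i, hi i[%classic)).
  apply: bigsetI_measurable => i _; rewrite -[X in measurable X]setTI.
  by apply: measurable_coord_rV => //; exact: measurable_itv.
rewrite -bigcap_seq; apply/seteqP; split => x /=.
  by move=> h i /= _; rewrite in_itv/=.
by move=> h i; have := h i; rewrite /= mem_index_enum in_itv/= => /(_ isT).
Qed.

(** The sigma-algebra is generated by coordinates, so an open set has to be exhibited as a countable
    union of boxes: those with rational centre and radius 1/(k+1) that lie in [U]. *)
Lemma open_measurable_rV n (U : set 'rV[R]_n) :
  open U -> measurable (U : set 'rV[RM]_n).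
Proof.
move=> oU.
pose box (q : 'rV[rat]_n * nat) : set 'rV[RM]_n :=
  [set x | forall i, ratr (q.1 0 i) - q.2.+1%:R^-1 < x 0 i
                     < ratr (q.1 0 i) + q.2.+1%:R^-1].
(* The admissible boxes are enumerated by decoding k; codes of nothing and boxes that leave [U]
   contribute the empty set. *)
pose f (k : nat) : set 'rV[RM]_n :=
  match unpickle k with
  | Some q => if `[< box q `<=` U >] then box q else set0
  | None => set0
  end.
rewrite (_ : U = \bigcup_k f k).
  apply: bigcupT_measurable => k; rewrite /f.
  case: (unpickle k) => [q|]; last exact: measurable0.
  by case: asboolP => _; [exact: measurable_box|exact: measurable0].
apply/seteqP; split => x; last first.
  move=> [k _]; rewrite /f; case: (unpickle k) => // q.
  by case: asboolP => // + xq; apply.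
move=> Ux; have : nbhs x U by exact: open_nbhs_nbhs.
move=> /nbhs_ballP[e /= e0 xeU].
have [k ke] : exists k : nat, k.+1%:R^-1 < e / 2.
  have [k _ /(_ _ (leqnn k)) h] := near_infty_natSinv_lt (PosNum (divr_gt0 e0 (ltr0n R 2))).
  by exists k.
have k0 : 0 < k.+1%:R^-1 :> R by rewrite invr_gt0.
have q i : {q : rat | x 0 i - k.+1%:R^-1 < ratr q < x 0 i + k.+1%:R^-1}.
  apply: cid; have : x 0 i - k.+1%:R^-1 < x 0 i + k.+1%:R^-1 by rewrite ltrD2l gtrN.
  move=> /rat_in_itvoo[q]; rewrite in_itv/= => ?; by exists q.
pose Q := (\row_i sval (q i), k).
exists (pickle Q) => //; rewrite /f pickleK.
have -> : `[< box Q `<=` U >].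
  apply/asboolP => y By; apply: xeU; rewrite mx_norm_ball /ball_/=.
  apply: mx_norm_lt => // i; have := By i; rewrite /Q/= !mxE; case: (q i) => r /=.
  move: ke k0; set d := k.+1%:R^-1 => ke k0.
  by move=> /andP[? ?] /andP[? ?]; rewrite ltr_norml; apply/andP; split; lra.
move=> i; rewrite /= mxE; case: (q i) => r /=.
by move: ke k0; set d := k.+1%:R^-1 => ke k0 /andP[? ?]; apply/andP; split; lra.
Qed.

Lemma continuous_measurable_rV n (U : set 'rV[R]_n) (f : 'rV[R]_n -> R) :
  open U -> (forall x, U x -> {for x, continuous f}) ->
  measurable_fun (U : set 'rV[RM]_n) f.
Proof.
move=> oU cf; apply: (measurability _ (RGenOpens.measurableE R)).
move=> _ [_ [a [b ->] <-]]; apply: open_measurable_rV.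
rewrite openE => x /= [Ux fx]; apply: filterI; first exact: open_nbhs_nbhs.
by apply: (cf x Ux); apply: open_nbhs_nbhs; split => //; exact: interval_open.
Qed.

Definition cube n (M : R) : set 'rV[R]_n := [set x | forall i, - M < x 0 i < M].

Lemma bounded_box n (A : set 'rV[R]_n) : bounded_set A ->
  exists2 M, 0 < M & A `<=` cube M.
Proof.
move=> [M [_ AM]]; have := AM (`|M| + 1); rewrite (le_lt_trans (ler_norm M)) ?ltrDl//.
move=> /(_ isT) {}AM; exists (`|M| + 2); first by rewrite ltr_wpDl.
move=> x /AM xM i; rewrite -ltr_norml (le_lt_trans (coord_le_mx_norm x i))//.
by rewrite (le_lt_trans xM)// ltrD2l; lra.
Qed.

Lemma lebesgue_rV_box n (M : R) : 0 < M ->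
  (@lebesgue_rV R n (cube M) < +oo)%E.
Proof.
move=> M0; elim: n => [|n ih] /=; first by rewrite diracE ltry.
rewrite /lebesgue_rV_step /pushforward.
apply: (@le_lt_trans _ _ ((lebesgue_measure \x lebesgue_rV n)%E
   (`]-M, M[%classic `*` cube M))).
  apply: le_measure; rewrite ?inE.
  - rewrite -[X in measurable X]setTI; apply: measurable_cons_rV => //.
    exact: measurable_box.
  - by apply: measurableX; [exact: measurable_itv|exact: measurable_box].
  - move=> [a x] /= h; split => /=.
      by have := h (@lshift 1 n 0); rewrite /cons_rV (@row_mxEl _ 1 1 n) mxE in_itv.
    by move=> i; have := h (@rshift 1 n i); rewrite /cons_rV (@row_mxEr _ 1 1 n).
rewrite product_measure1E ?lte_mul_pinfty//.
- have : lebesgue_measure `]- M, M[%classic \is a fin_num.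
    by rewrite lebesgue_measure_itv/= lte_fin; case: ifP => // _; rewrite -EFinD.
  by [].
- exact: measurable_box.
Qed.

Lemma lebesgue_rV_bounded n (A : set 'rV[R]_n) :
  measurable (A : set 'rV[RM]_n) -> bounded_set A ->
  (@lebesgue_rV R n A < +oo)%E.
Proof.
move=> mA /bounded_box[M M0 AM]; apply: le_lt_trans (lebesgue_rV_box n M0).
by apply: le_measure => //; rewrite inE//; exact: measurable_box.
Qed.

Lemma bounded_integrable_rV n (A : set 'rV[R]_n) (f : 'rV[R]_n -> R) (C : R) :
  measurable (A : set 'rV[RM]_n) -> bounded_set A ->
  measurable_fun (A : set 'rV[RM]_n) f -> (forall x, A x -> `|f x| <= C) ->
  (@lebesgue_rV R n).-integrable A (EFin \o f).
Proof.
move=> mA bA mf fC; apply: measurable_bounded_integrable => //.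
  exact: lebesgue_rV_bounded.
exists C; split; first exact: num_real.
by move=> M CM x /= /fC /le_trans; apply; exact: ltW.
Qed.

(** Dominated convergence in the one form used below. All approximations are eventually equal to
    their limit at each point, under a uniform bound on a bounded set; measurability and the bound
    then pass to the limit, and the constant [C] dominates. *)
Lemma Rintegral_eventually_eq n (A : set 'rV[R]_n) (f_ : nat -> 'rV[R]_n -> R)
    (f : 'rV[R]_n -> R) (C : R) :
  measurable (A : set 'rV[RM]_n) -> bounded_set A ->
  (forall k, measurable_fun (A : set 'rV[RM]_n) (f_ k)) ->
  (forall k x, A x -> `|f_ k x| <= C) ->
  (forall x, A x -> \forall k \near \oo, f_ k x = f x) ->
  [/\ measurable_fun (A : set 'rV[RM]_n) f, (forall x, A x -> `|f x| <= C) &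
   \int[@lebesgue_rV R n]_(x in A) f_ k x @[k --> \oo] -->
   \int[@lebesgue_rV R n]_(x in A) f x].
Proof.
move=> mA bA mf_ f_C f_f.
have cvf x : A x -> f_ k x @[k --> \oo] --> f x.
  move=> Ax; apply: cvg_near_cst; exact: f_f.
have mf : measurable_fun (A : set 'rV[RM]_n) f.
  exact: (measurable_fun_cvg mf_).
have fC x : A x -> `|f x| <= C.
  by move=> Ax; have [k _ /(_ _ (leqnn k))/= <-] := f_f x Ax; exact: f_C.
split => //; apply: fine_cvg; rewrite fineK; last first.
  apply: integrable_fin_num => //; exact: (bounded_integrable_rV mA bA mf fC).
apply: (@dominated_cvg _ _ _ _ _ mA _ _ (cst C%:E)) => //.
- by move=> k; apply/measurable_EFinP.
- by move=> x Ax; apply: cvg_EFin; [exact: nearW|exact: cvf].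
- have : (@lebesgue_rV R n).-integrable A (EFin \o cst C).
    by apply: (@bounded_integrable_rV _ _ _ `|C|) => //.
  by [].
Qed.

End measure_rV.

(** * Integrals of partial derivatives over the whole space *)

Section divergence.
Context {R : realType}.
Local Notation RM := (measurableTypeR R).

Lemma continuous_bounded_rV n (A : set 'rV[R]_n) (f : 'rV[R]_n -> R) :
  bounded_set A -> continuous f -> exists C, forall x, A x -> `|f x| <= C.
Proof.
move=> [M [Mr AM]] cf.
pose K := [set x : 'rV[R]_n | `|x| <= M + 1].
have cK : compact K.
  apply: bounded_closed_compact.
    exists (M + 1); split; first exact: num_real.
    by move=> r /ltW Mr1 x /= /le_trans; apply.
  apply: (@preimage_closed _ _ (Num.norm : 'rV[R]_n -> R) [set y | y <= M + 1]).
    by move=> x _; exact: norm_continuous.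
  exact: closed_le.
have : compact (f @` K).
  by apply: continuous_compact => //; exact: continuous_subspaceT.
move=> /compact_bounded[C [Cr fC]]; exists (C + 1) => x Ax.
apply: (fC _ (ltr_pwDr ltr01 (lexx C))); exists x => //.
by apply: AM Ax; rewrite ltrDl.
Qed.

Lemma bounded_cube n (M : R) : bounded_set (cube M : set 'rV[R]_n).
Proof.
exists (`|M| + 1); split; first exact: num_real.
move=> r /ltW Mr x /= xM; apply: le_trans Mr; apply/ltW/mx_norm_lt.
  by rewrite ltr_wpDl.
by move=> i; rewrite (@lt_trans _ _ M)// ?ltr_norml ?(xM i)// ltr_pwDr// ler_norm.
Qed.

Lemma cont_cube_integrable n (f : 'rV[R]_n -> R) (M : R) :
  continuous f -> (forall x, ~ cube M x -> f x = 0) ->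
  (@lebesgue_rV R n).-integrable setT (EFin \o f).
Proof.
move=> cf f0.
have mK : measurable (cube M : set 'rV[RM]_n) by exact: measurable_box.
rewrite (_ : EFin \o f = (EFin \o f) \_ (cube M : set 'rV[RM]_n)); last first.
  apply/funext => x; rewrite patchE; case: ifPn => // /negP xM /=.
  by rewrite f0// => ?; apply: xM; rewrite inE.
apply/(integrable_mkcond _ mK).
have [C fC] := continuous_bounded_rV (@bounded_cube n M) cf.
apply: (@bounded_integrable_rV R n (cube M) f C) => //.
- exact: bounded_cube.
- apply: measurable_funTS; apply: continuous_measurable_rV => [|x _].
    exact: openT.
  exact: cf.
Qed.

Lemma cons_rVE n (a : R) (y : 'rV[R]_n) :
  cons_rV (a, y) = a *: delta_mx 0 0 + (row_mx (0 : 'rV_1) y : 'rV[R]_(1 + n)).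
Proof.
apply/rowP => i; rewrite !mxE; case: splitP => j ij.
  rewrite !mxE addr0 (_ : (i == 0) = true) ?mulr1//.
  by apply/eqP/val_inj; rewrite /= ij ord1.
rewrite (_ : (i == 0) = false) ?mulr0 ?add0r//.
by apply/negbTE/eqP => /(congr1 val)/=; rewrite ij.
Qed.

Lemma cons_rV_addl n (h a : R) (y : 'rV[R]_n) :
  cons_rV (h + a, y) = h *: delta_mx 0 ord0 + cons_rV (a, y).
Proof. by rewrite !cons_rVE scalerDl addrA. Qed.

Lemma cons_rV_addr n (h a : R) (y : 'rV[R]_n) (j : 'I_n) :
  cons_rV (a, h *: delta_mx 0 j + y) =
  h *: delta_mx 0 (lift ord0 j) + cons_rV (a, y).
Proof.
rewrite !cons_rVE addrCA; congr (_ + _).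
apply/rowP => i; rewrite !mxE; case: splitP => k ik.
  rewrite !mxE (_ : (i == lift ord0 j) = false) ?mulr0 ?addr0//.
  by apply/negbTE/eqP => /(congr1 val)/=; rewrite ik ord1.
by rewrite !mxE -!(inj_eq val_inj)/= ik.
Qed.

Lemma near_dist_rV n (y : 'rV[R]_n) (e : R) : 0 < e ->
  \forall z \near y, `|y - z| < e.
Proof. by move=> e0; have := nbhsx_ballx y e e0; rewrite mx_norm_ball. Qed.

Lemma continuous_cons_rVl n (y : 'rV[R]_n) :
  continuous (fun a : R => cons_rV (a, y) : 'rV[R]_n.+1).
Proof.
move=> a; under eq_fun do rewrite cons_rVE.
apply: cvgD; last exact: cvg_cst.
by apply: cvgZ; [exact: cvg_id|exact: cvg_cst].
Qed.

Lemma continuous_cons_rVr n (a : R) :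
  continuous (fun y : 'rV[R]_n => cons_rV (a, y) : 'rV[R]_n.+1).
Proof.
move=> y; apply/(@cvgrPdist_lt _ _ _ _ (nbhs_filter y)) => /= e e0.
have := near_dist_rV y e0; apply: (@filterS _ (nbhs y)) => z yz; apply: mx_norm_lt => // i; rewrite !cons_rVE !mxE.
case: splitP => [j _|j _]; first by rewrite !mxE addr0 subrr normr0.
rewrite opprD addrACA subrr add0r; apply: le_lt_trans yz.
by have := coord_le_mx_norm (y - z) j; rewrite !mxE.
Qed.

(** Fubini splits off the coordinate of index 0. If [i] is another direction, the inner integral
    over the remaining variables vanishes by induction on the dimension. If [i] is that coordinate,
    it is the inner variable and the fundamental theorem of calculus leaves two boundary values,
    both 0. *)
Lemma integral_partial0 n (i : 'I_n) (g : 'rV[R]_n -> R) (M : R) :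
  continuous g -> (forall x, derivable g x (delta_mx 0 i)) ->
  continuous (partial i g) -> (forall x, ~ cube M x -> g x = 0) ->
  (\int[@lebesgue_rV R n]_x (partial i g x)%:E = 0)%E.
Proof.
elim: n i g => [[]//|n ih] i g cg dg cdg g0.
(* The margin 1 provides a whole neighbourhood of [x] on which [g] vanishes, hence a zero
   derivative. *)
have dg0 x : ~ cube (M + 1) x -> partial i g x = 0.
  move=> xM; have [j xj] : exists j, M + 1 <= `|x 0 j|.
    apply: contra_notP xM => /forallNP h j.
    by have /negP := h j; rewrite -ltNge ltr_norml.
  rewrite /partial (_ : 0 = 'D_(delta_mx 0 i) (cst 0 : 'rV[R]_n.+1 -> R) x); last first.
    by rewrite derive_cst.
  apply: near_eq_derive.
  have := near_dist_rV x ltr01; apply: (@filterS _ (nbhs x)) => z zx; apply: g0 => /(_ j) zj.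
  move: zj; rewrite -ltr_norml => zj.
  have := coord_le_mx_norm (x - z) j; rewrite !mxE => /le_lt_trans-/(_ _ zx).
  have := ler_normD (x 0 j - z 0 j) (z 0 j); rewrite subrK; lra.
have ifT := cont_cube_integrable cdg dg0.
have mf : measurable_fun [set: 'rV[RM]_n.+1] (partial i g).
  by apply: continuous_measurable_rV => [|x _]; [exact: openT|exact: cdg].
have if12 : (lebesgue_measure \x lebesgue_rV n)%E.-integrable setT
    ((EFin \o partial i g) \o @cons_rV R n).
  apply/integrableP; split.
    apply: (measurableT_comp _ (@measurable_cons_rV R n)).
    exact/measurable_EFinP.
  have /integrableP[_] := ifT; rewrite /= /lebesgue_rV_step.
  rewrite ge0_integral_pushforward ?preimage_setT//; last 2 first.
  - exact: measurable_cons_rV.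
  - by apply/measurable_EFinP; exact: measurableT_comp.
rewrite /= /lebesgue_rV_step integral_pushforward ?preimage_setT//; last 2 first.
- exact: measurable_cons_rV.
- exact/measurable_EFinP.
have [j ij|i0] := unliftP ord0 i.
  rewrite -(integral12_prod_meas1 if12); apply: integral0_eq => a _.
  pose ga (y : 'rV[R]_n) := g (cons_rV (a, y)).
  have E y : (fun h => h^-1 *: ((ga \o shift y) (h *: delta_mx 0 j) - ga y)) =
      (fun h => h^-1 *: ((g \o shift (cons_rV (a, y))) (h *: delta_mx 0 i) -
                         g (cons_rV (a, y)))).
    by apply/funext => h; rewrite /ga /= cons_rV_addr -ij.
  have Ep y : partial j ga y = partial i g (cons_rV (a, y)).
    by rewrite /partial /derive E.
  rewrite /fubini_F /= -[RHS](ih j ga).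
  - by apply: eq_integral => y _; rewrite Ep.
  - by move=> y; apply: continuous_comp; [exact: continuous_cons_rVr|exact: cg].
  - by move=> y; rewrite /derivable E; exact: dg.
  - move=> y; rewrite (_ : partial j ga = partial i g \o (fun y => cons_rV (a, y))).
      by apply: continuous_comp; [exact: continuous_cons_rVr|exact: cdg].
    by apply/funext => z; exact: Ep.
  - move=> y yM; apply: g0 => h; apply: yM => k.
    have := h (lift ord0 k); rewrite cons_rVE !mxE mulr0 add0r.
    case: splitP => [[[|?]]//|k' /= [kk']].
    by rewrite (_ : k' = k)//; apply: val_inj.
rewrite -(integral21_prod_meas1 if12); apply: integral0_eq => y _.
pose h (a : R) := g (cons_rV (a, y)).
have E a : (fun t => t^-1 *: ((h \o shift a) (t *: 1) - h a)) =
    (fun t => t^-1 *: ((g \o shift (cons_rV (a, y))) (t *: delta_mx 0 i) -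
                         g (cons_rV (a, y)))).
  by apply/funext => t; rewrite /h /= i0 -cons_rV_addl [_%:A]mulr1.
have Ep a : 'D_1 h a = partial i g (cons_rV (a, y)).
  by rewrite /partial /derive E.
have ch : continuous h.
  by move=> a; apply: continuous_comp; [exact: continuous_cons_rVl|exact: cg].
have dh a : derivable h a 1 by rewrite /derivable E; exact: dg.
have cdh : continuous ('D_1 h).
  move=> a; rewrite (_ : 'D_1 h = partial i g \o (fun a => cons_rV (a, y))).
    by apply: continuous_comp; [exact: continuous_cons_rVl|exact: cdg].
  by apply/funext => z; exact: Ep.
have h0 a : `|M| + 1 <= `|a| -> h a = 0.
  move=> aM; apply: g0 => /(_ ord0); rewrite cons_rVE !mxE mulr1.
  case: splitP => // k _; rewrite mxE addr0 -ltr_norml.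
  by apply/negP; rewrite -leNgt; have := ler_norm M; lra.
have dh0 a : `|M| + 1 <= `|a| -> 'D_1 h a = 0.
  move=> aM; rewrite Ep; apply: dg0 => /(_ ord0); rewrite cons_rVE !mxE mulr1.
  case: splitP => // k _; rewrite mxE addr0 -ltr_norml.
  by apply/negP; rewrite -leNgt; have := ler_norm M; lra.
(* The sign of [M] is arbitrary; the absolute value makes [-N, N] a proper interval whose ends lie
   where [h] vanishes. *)
rewrite /fubini_G /=; pose N := `|M| + 1.
have N0 : 0 < N by rewrite ltr_wpDl.
transitivity (\int[lebesgue_measure]_(x in `[(- N)%R, N]) ('D_1 h x)%:E)%E.
  rewrite [RHS]integral_mkcond; apply: eq_integral => a _.
  rewrite patchE -Ep; case: ifPn => // /negP aN; rewrite dh0//.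
  rewrite -/N leNgt; apply/negP => aN'; apply: aN; rewrite inE /= in_itv/=.
  by rewrite -ler_norml ltW.
rewrite (@continuous_FTC2 _ _ h).
- have Nn : `|M| + 1 <= `|N| by rewrite (ger0_norm (ltW N0)).
  by rewrite !h0 ?normrN// subee.
- by rewrite gtrN.
- exact: continuous_subspaceT.
- split => [a _| |]; first exact: dh.
  + exact/cvg_at_right_filter/ch.
  + exact/cvg_at_left_filter/ch.
- by move=> a _; rewrite derive1E.
Qed.

End divergence.

(** * Functions of class C^k *)

Section Ck_theory.
Context {R : realType} {n : nat}.
Implicit Types (f g : 'rV[R]_n -> R) (A : set 'rV[R]_n).

Lemma near_eq_continuous f g x : (\near x, f x = g x) ->
  {for x, continuous f} -> {for x, continuous g}.
Proof.
move=> fg cf; have E : f x = g x by exact: (nbhs_singleton fg).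
rewrite /prop_for /continuous_at -E; apply: (cvg_trans _ cf).
exact: (@near_eq_cvg _ _ _ (nbhs_filter x) f g fg).
Qed.

Lemma Ck_eq k A f g : open A -> (forall x, A x -> f x = g x) ->
  Ck k A f -> Ck k A g.
Proof.
move=> oA; elim: k f g => [|k ih] f g fg /= [cf df]; split.
- move=> x Ax; apply: near_eq_continuous (cf x Ax).
  by have := open_nbhs_nbhs (conj oA Ax); apply: (@filterS _ (nbhs x)).
- by [].
- move=> x Ax; apply: near_eq_continuous (cf x Ax).
  by have := open_nbhs_nbhs (conj oA Ax); apply: (@filterS _ (nbhs x)).
- move=> i; have [dfi Cfi] := df i.
  have nfg x : A x -> \near x, f x = g x.
    by move=> Ax; have := open_nbhs_nbhs (conj oA Ax); apply: (@filterS _ (nbhs x)).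
  split => [x Ax|]; first exact: near_eq_derivable (nfg x Ax) (dfi x Ax).
  by apply: ih Cfi => x Ax; exact: near_eq_derive (nfg x Ax).
Qed.

Lemma CkW k A f : Ck k.+1 A f -> Ck k A f.
Proof.
elim: k f => [|k ih] f [cf df]; split => // i.
by have [dfi Cfi] := df i; split => //; exact: ih.
Qed.

Lemma Ck_continuous k A f : Ck k A f -> forall x, A x -> {for x, continuous f}.
Proof. by case: k => [|k] []. Qed.

Lemma Ck_setU k A (B : set 'rV[R]_n) f : Ck k A f -> Ck k B f -> Ck k (A `|` B) f.
Proof.
elim: k f => [|k ih] f [cf df] [cf' df']; split => //.
- by move=> x [/cf|/cf'].
- by move=> x [/cf|/cf'].
- move=> i; have [dfi Cfi] := df i; have [dfi' Cfi'] := df' i.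
  by split; [move=> x [/dfi|/dfi']|exact: ih].
Qed.

Lemma Ck_subset k A (B : set 'rV[R]_n) f : A `<=` B -> Ck k B f -> Ck k A f.
Proof.
move=> AB; elim: k f => [|k ih] f [cf df]; split => //.
- by move=> x /AB/cf.
- by move=> x /AB/cf.
- by move=> i; have [dfi Cfi] := df i; split; [move=> x /AB/dfi|exact: ih].
Qed.

Lemma Ck_cst k A (c : R) : Ck k A (cst c).
Proof.
elim: k c => [|k ih] c; split => //.
- by move=> x _; exact: cst_continuous.
- by move=> x _; exact: cst_continuous.
- move=> i; split => [x _|]; first exact: derivable_cst.
  rewrite (_ : partial i (cst c) = cst 0)//.
  by apply/funext => x; rewrite /partial derive_cst.
Qed.

Lemma is_derive_coord (j : 'I_n) (x v : 'rV[R]_n) :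
  is_derive x v (fun y : 'rV[R]_n => y 0 j) (v 0 j).
Proof.
have d := (derivable_mxP id x v).1 (@derivable_id R 'rV[R]_n x v).
apply: DeriveDef; first exact: d.
have := derive_mx (@derivable_id R 'rV[R]_n x v); rewrite derive_id => /matrixP/(_ 0 j).
by rewrite mxE.
Qed.

Lemma partial_coord (i j : 'I_n) :
  partial i (fun y : 'rV[R]_n => y 0 j) = cst (i == j)%:R.
Proof.
apply/funext => x; rewrite /partial.
by have [_ ->] := is_derive_coord j x (delta_mx 0 i); rewrite mxE eqxx eq_sym.
Qed.

Lemma Ck_coord k A (j : 'I_n) : Ck k A (fun y => y 0 j).
Proof.
case: k => [|k]; split => //.
- by move=> x _; exact: (@coord_continuous R 1 n 0 j x).
- by move=> x _; exact: (@coord_continuous R 1 n 0 j x).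
- move=> i; split => [x _|]; last by rewrite partial_coord; exact: Ck_cst.
  by have [] := is_derive_coord j x (delta_mx 0 i).
Qed.

Lemma Ck_add k A f g : open A -> Ck k A f -> Ck k A g ->
  Ck k A (fun x => f x + g x).
Proof.
move=> oA; elim: k f g => [|k ih] f g [cf df] [cg dg]; split => //.
- by move=> x Ax; apply: continuousD; [exact: cf|exact: cg].
- by move=> x Ax; apply: continuousD; [exact: cf|exact: cg].
- move=> i; have [dfi Cfi] := df i; have [dgi Cgi] := dg i; split => [x Ax|].
    by apply: derivableD; [exact: dfi|exact: dgi].
  apply: Ck_eq (ih _ _ Cfi Cgi) => // x Ax.
  by rewrite /partial -deriveD//; [exact: dfi|exact: dgi].
Qed.

Lemma Ck_mul k A f g : open A -> Ck k A f -> Ck k A g ->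
  Ck k A (fun x => f x * g x).
Proof.
move=> oA; elim: k f g => [|k ih] f g.
  by move=> [cf df] [cg dg]; split => // x Ax; apply: continuousM; [exact: cf|exact: cg].
move=> Cf Cg; have [Cf0 Cg0] := (CkW Cf, CkW Cg).
case: Cf Cg => [cf df] [cg dg]; split => //.
  by move=> x Ax; apply: continuousM; [exact: cf|exact: cg].
move=> i; have [dfi Cfi] := df i; have [dgi Cgi] := dg i; split => [x Ax|].
  by apply: derivableM; [exact: dfi|exact: dgi].
apply: Ck_eq (Ck_add oA (ih _ _ Cf0 Cgi) (ih _ _ Cg0 Cfi)) => // x Ax.
by rewrite /partial [in RHS]deriveM//; [exact: dfi|exact: dgi].
Qed.

Lemma Ck_sum k A (I : Type) (r : seq I) (F : I -> 'rV[R]_n -> R) :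
  open A -> (forall j, Ck k A (F j)) -> Ck k A (fun x => \sum_(j <- r) F j x).
Proof.
move=> oA CF; elim: r => [|j r ih].
  rewrite (_ : (fun x => _) = cst 0); first exact: Ck_cst.
  by apply/funext => x; rewrite big_nil.
rewrite (_ : (fun x => _) = (fun x => F j x + \sum_(j <- r) F j x)).
  exact: Ck_add.
by apply/funext => x; rewrite big_cons.
Qed.

End Ck_theory.

(** * Smooth functions of one variable *)

Section smooth1.
Context {R : realType}.
Implicit Types (h g : R -> R).

(** Regularity is asked on the whole line: the profiles composed below are smooth everywhere, the
    singular ones after smoothing. *)
Fixpoint Ck1 (k : nat) h : Prop :=
  continuous h /\
  match k with
  | 0 => True
  | k'.+1 => (forall s, derivable h s 1) /\ Ck1 k' (derive1 h)
  end.

Definition smooth1 h := forall k, Ck1 k h.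

Lemma Ck1_S k h h' : (forall s : R, is_derive s 1 h (h' s)) -> Ck1 k h' -> Ck1 k.+1 h.
Proof.
move=> dh Ch'; have dh1 s : derivable h s 1 by have [] := dh s.
split; first by move=> s; apply: differentiable_continuous; exact/derivable1_diffP.
split=> //; rewrite (_ : (derive1 h) = h')//.
by apply/funext => s; rewrite derive1E; have [_ ->] := dh s.
Qed.

Lemma Ck1W k h : Ck1 k.+1 h -> Ck1 k h.
Proof.
elim: k h => [|k ih] h [ch [dh Ch]]; split => //.
by split => //; exact: ih.
Qed.

Lemma Ck1_is_derive k h : Ck1 k.+1 h -> forall s : R, is_derive s 1 h (derive1 h s).
Proof. by move=> [_ [dh _]] s; rewrite derive1E; exact: derivableP. Qed.

Lemma Ck1_cst k c : Ck1 k (cst c).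
Proof.
elim: k c => [|k ih] c; first by split => // s; exact: cvg_cst.
by apply: (@Ck1_S _ _ (cst 0)).
Qed.

Lemma Ck1_id k : Ck1 k id.
Proof.
case: k => [|k]; first by split => // s; exact: cvg_id.
by apply: (@Ck1_S _ _ (cst 1)) => //; exact: Ck1_cst.
Qed.

Lemma Ck1_add k h g : Ck1 k h -> Ck1 k g -> Ck1 k (fun s => h s + g s).
Proof.
elim: k h g => [|k ih] h g Ch Cg.
  by split => // s; apply: cvgD; [exact: Ch.1|exact: Cg.1].
have [dh dg] := (Ck1_is_derive Ch, Ck1_is_derive Cg).
have D (s : R) : is_derive s 1 (fun s => h s + g s) (derive1 h s + derive1 g s).
  exact: is_deriveD.
apply: (Ck1_S D); apply: ih; [exact: Ch.2.2|exact: Cg.2.2].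
Qed.

Lemma Ck1_mul k h g : Ck1 k h -> Ck1 k g -> Ck1 k (fun s => h s * g s).
Proof.
elim: k h g => [|k ih] h g Ch Cg.
  by split => // s; apply: cvgM; [exact: Ch.1|exact: Cg.1].
have [dh dg] := (Ck1_is_derive Ch, Ck1_is_derive Cg).
have D (s : R) : is_derive s 1 (fun s => h s * g s)
    (h s * derive1 g s + g s * derive1 h s).
  exact: is_deriveM.
by apply: (Ck1_S D); apply: Ck1_add; apply: ih; [exact: Ck1W|exact: Cg.2.2|exact: Ck1W|exact: Ch.2.2].
Qed.

Lemma Ck1_comp k h g : Ck1 k h -> Ck1 k g -> Ck1 k (fun s => h (g s)).
Proof.
elim: k h g => [|k ih] h g Ch Cg.
  by split => // s; apply: continuous_comp; [exact: Cg.1|exact: Ch.1].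
have [dh dg] := (Ck1_is_derive Ch, Ck1_is_derive Cg).
have D (s : R) : is_derive s 1 (fun s => h (g s)) (derive1 h (g s) * derive1 g s).
  exact: (@is_derive1_comp _ h g).
by apply: (Ck1_S D); apply: Ck1_mul; [apply: ih; [exact: Ch.2.2|exact: Ck1W]|exact: Cg.2.2].
Qed.

Lemma Ck1_inv k g : (forall s, g s != 0) -> Ck1 k g -> Ck1 k (fun s => (g s)^-1).
Proof.
move=> g0; elim: k => [|k ih] Cg.
  by split => // s; apply: cvgV => //; exact: Cg.1.
have dg := Ck1_is_derive Cg.
have D (s : R) : is_derive s 1 (fun s => (g s)^-1)
    (- ((g s)^-1 * (g s)^-1 * derive1 g s)).
  have [dgs <-] := dg s.
  apply: DeriveDef; first exact: derivableV.
  by rewrite deriveV// /GRing.scale/= expr2 -mulNr invfM.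
have Ci := ih (Ck1W Cg); apply: (Ck1_S D).
rewrite (_ : (fun s => - _) = (fun s => - 1 * ((g s)^-1 * (g s)^-1 * derive1 g s))).
  apply: Ck1_mul; first exact: (Ck1_cst _ (-1)).
  by apply: Ck1_mul; [exact: Ck1_mul|exact: Cg.2.2].
by apply/funext => s; rewrite mulN1r.
Qed.

Lemma Ck1_sqrt k g : (forall s, 0 < g s) -> Ck1 k g ->
  Ck1 k (fun s => Num.sqrt (g s)).
Proof.
move=> g0; elim: k => [|k ih] Cg.
  by split => // s; apply: continuous_comp; [exact: Cg.1|exact: sqrt_continuous].
have dg := Ck1_is_derive Cg.
have D (s : R) : is_derive s 1 (fun s => Num.sqrt (g s))
    ((2 * Num.sqrt (g s))^-1 * derive1 g s).
  by apply: (@is_derive1_comp _ Num.sqrt g); exact: is_derive1_sqrt.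
apply: (Ck1_S D); apply: Ck1_mul; last exact: Cg.2.2.
apply: (@Ck1_inv _ (fun s => 2 * Num.sqrt (g s))) => [s|].
  by rewrite mulf_neq0// gt_eqF// sqrtr_gt0.
by apply: Ck1_mul; [exact: (Ck1_cst _ 2)|exact: ih (Ck1W Cg)].
Qed.

Lemma Ck1_exp k g m : Ck1 k g -> Ck1 k (fun s => g s ^+ m).
Proof.
move=> Cg; elim: m => [|m ih].
  by rewrite (_ : (fun s => _) = cst 1)//; exact: Ck1_cst.
rewrite (_ : (fun s => _) = (fun s => g s * g s ^+ m)); first exact: Ck1_mul.
by apply/funext => s; rewrite exprS.
Qed.

End smooth1.

Section Ck_comp.
Context {R : realType} {n : nat}.
Implicit Types (f : 'rV[R]_n -> R) (A : set 'rV[R]_n) (h : R -> R).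

(** Restricting [f] to the line through [x] in direction [v] reduces this to the one-variable chain
    rule, so existence of that single directional derivative suffices. *)
Lemma is_derive_comp1 h f (x v : 'rV[R]_n) (dh df : R) :
  is_derive (f x) 1 h dh -> is_derive x v f df ->
  is_derive x v (fun y => h (f y)) (dh * df).
Proof.
move=> hdh [/derivable1P fdf dfE].
pose l (t : R) := f (t *: v + x).
have l0 : l 0 = f x by rewrite /l scale0r add0r.
have dl : is_derive (0 : R) 1 l df.
  apply: DeriveDef => //; rewrite -dfE /derive.
  rewrite (_ : (fun t => _) =
      (fun t => t^-1 *: ((f \o shift x) (t *: v) - f x)))//.
  by apply/funext => t /=; rewrite /l addr0 scale0r add0r [_%:A]mulr1.
have hl : is_derive (l 0) 1 h dh by rewrite l0.
have [dhl hlE] := @is_derive1_comp _ h l 0 dh df hl dl.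
apply: DeriveDef; first exact/derivable1P.
rewrite -hlE /derive.
rewrite [in RHS](_ : (fun t => _) =
    (fun t => t^-1 *: (((fun y => h (f y)) \o shift x) (t *: v) - h (f x))))//.
by apply/funext => t /=; rewrite /l addr0 scale0r add0r [_%:A]mulr1.
Qed.

Lemma Ck_comp1 k A h f : open A -> smooth1 h -> Ck k A f ->
  Ck k A (fun x => h (f x)).
Proof.
move=> oA; elim: k h f => [|k ih] h f sh Cf.
  split => // x Ax; apply: continuous_comp; first exact: (Cf.1 x).
  exact: (sh 0%N).1.
have sh' : smooth1 (derive1 h) by move=> j; exact: (sh j.+1).2.2.
have dh := Ck1_is_derive (sh 1%N).
have Cf0 := CkW Cf; case: Cf => cf df; split.
  move=> x Ax; apply: continuous_comp; first exact: (cf x).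
  exact: (sh 0%N).1.
move=> i; have [dfi Cfi] := df i.
have D x : A x -> is_derive x (delta_mx 0 i) (fun y => h (f y)) (derive1 h (f x) * partial i f x).
  by move=> Ax; apply: is_derive_comp1 => //; apply: derivableP; exact: dfi.
split => [x Ax|]; first by have [] := D x Ax.
apply: Ck_eq (Ck_mul oA (ih _ _ sh' Cf0) Cfi) => // x Ax.
by have [_] := D x Ax.
Qed.

End Ck_comp.

(** * Smooth cutoffs *)

Section flat.
Context {R : realType}.

(* A class of functions closed under differentiation, hence smooth at 0. *)
Definition flat (p : {poly R}) (s : R) : R :=
  if 0 < s then p.[s^-1] * expR (- s^-1) else 0.

(** Differentiating p(1/s) exp(-1/s) gives (1/s^2) (p - p')(1/s) exp(-1/s), a function of the same
    class. *)
Definition dflat (p : {poly R}) : {poly R} := 'X^2 * (p - p^`()).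

(** Each monomial satisfies y^i <= i! exp(y) for y >= 0, by the exponential series. *)
Lemma poly_expR_bounded (p : {poly R}) :
  exists2 C, 0 <= C & forall y, 0 <= y -> `|p.[y]| * expR (- y) <= C.
Proof.
elim/poly_ind: p => [|p c _].
  by exists 0 => // y _; rewrite horner0 normr0 mul0r.
pose q := p * 'X + c%:P; exists (\sum_(i < size q) `|q`_i| * i`!%:R).
  by apply: sumr_ge0 => i _; rewrite mulr_ge0.
move=> y y0; rewrite horner_coef (le_trans (ler_wpM2r (expR_ge0 _) (ler_norm_sum _ _ _)))//.
rewrite mulr_suml; apply: ler_sum => i _.
rewrite normrM -mulrA ler_wpM2l// normrX (ger0_norm y0) expRN ler_pdivrMr ?expR_gt0//.
case: (nat_of_ord i) => [|m].
  by rewrite expr0 mul1r -expR0 ler_expR.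
rewrite -ler_pdivrMl ?ltr0n ?fact_gt0// mulrC.
by apply: le_trans (expR_ge1Dxn m y0); rewrite lerDr.
Qed.

Lemma is_derive_flat (p : {poly R}) (s : R) :
  is_derive s 1 (flat p) (flat (dflat p) s).
Proof.
have [s0|s0|s0] := ltgtP s 0.
- rewrite {2}/flat (lt_gtF s0); apply: (@near_eq_is_derive _ _ _ (cst 0)).
    near=> z; rewrite /flat ifF//; apply: lt_gtF; near: z.
    exact: lt_nbhsl.
- rewrite {2}/flat s0.
  pose f (s : R) := p.[s^-1] * expR (- s^-1).
  apply: (@near_eq_is_derive _ _ _ f).
    near=> z; rewrite /flat ifT//; near: z; exact: lt_nbhsr.
  have dV : is_derive s 1 (fun s : R => s^-1) (- s ^- 2).
    apply: DeriveDef; first by apply: (@derivableV _ _ id) => //; apply: lt0r_neq0.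
    rewrite (@deriveV _ _ id) => //; last exact: lt0r_neq0.
    by rewrite derive_id /GRing.scale/= mulr1.
  have d1 : is_derive s 1 (fun s => p.[s^-1]) (p^`().[s^-1] * - s ^- 2).
    exact: (@is_derive1_comp _ (horner p) (fun s => s^-1)).
  have d2 : is_derive s 1 (fun s => expR (- s^-1)) (expR (- s^-1) * - - s ^- 2).
    apply: (@is_derive1_comp _ expR (fun s => - s^-1)); exact: is_deriveN.
  apply: is_derive_eq.
  rewrite /dflat hornerM hornerD hornerN hornerXn /GRing.scale/= exprVn; ring.
- rewrite s0 {2}/flat ltxx.
  suff h : (fun h : R => h^-1 *: ((flat p \o shift 0) (h *: 1) - flat p 0)) @ 0^' --> (0 : R).
    by apply: DeriveDef; [apply/cvg_ex; exists 0|exact: cvg_lim h].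
  (* The two additional powers of 1/t turn boundedness into [|flat p t| <= C t^2], so the difference
     quotient at 0 tends to 0. *)
  have [C C0 hC] := poly_expR_bounded (p * 'X^2).
  have fC t : `|flat p t| <= C * t ^+ 2.
    rewrite /flat; case: ifPn => t0; last by rewrite normr0 mulr_ge0// sqr_ge0.
    have := hC t^-1; rewrite invr_ge0 (ltW t0) hornerM hornerXn => /(_ isT).
    rewrite !normrM (ger0_norm (expR_ge0 _)) -mulrA => h.
    rewrite -ler_pdivrMr ?exprn_gt0//; apply: le_trans h; rewrite -mulrA ler_wpM2l//.
    rewrite mulrC ler_wpM2r ?expR_ge0// -normrM -expr2 exprVn ler_norm//.
  apply/cvgrPdist_le => /= e e0; near=> t.
  have t0 : 0 < `|t| by rewrite normr_gt0; near: t; exact: nbhs_dnbhs_neq.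
  rewrite addr0 {2}/flat ltxx subr0 sub0r normrN [_%:A]mulr1 normrM.
  rewrite normfV mulrC ler_pdivrMr// (le_trans (fC t))//.
  rewrite -real_normK ?num_real// expr2 mulrA ler_pM2r//.
  have : `|t| < e / (C + 1).
    by near: t; apply: dnbhs0_lt; rewrite divr_gt0// ltr_wpDl.
  rewrite ltr_pdivlMr ?ltr_wpDl// => /ltW; apply: le_trans.
  by rewrite mulrC ler_pM2l// lerDl.
Unshelve. all: by end_near. Qed.

End flat.

Section step.
Context {R : realType}.

Lemma smooth1_flat (p : {poly R}) : smooth1 (flat p).
Proof.
move=> k; elim: k p => [|k ih] p; last exact: (Ck1_S (is_derive_flat p) (ih _)).
split => // s; apply: differentiable_continuous; apply/derivable1_diffP.
by have [] := is_derive_flat p s.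
Qed.

Lemma flat1_gt0 (s : R) : 0 < s -> 0 < flat 1 s.
Proof. by move=> s0; rewrite /flat s0 hornerC mul1r expR_gt0. Qed.

Lemma flat1_ge0 (s : R) : 0 <= flat 1 s.
Proof.
have [s0|s0] := ltP 0 s; first exact/ltW/flat1_gt0.
by rewrite /flat ltNge s0.
Qed.

Definition step (s : R) : R := flat 1 s / (flat 1 s + flat 1 (1 - s)).

Lemma step_den_gt0 (s : R) : 0 < flat 1 s + flat 1 (1 - s).
Proof.
have [s0|s0] := ltP 0 s; first by rewrite ltr_pwDl ?flat1_gt0 ?flat1_ge0.
by rewrite ltr_wpDl ?flat1_ge0// flat1_gt0// subr_gt0 (le_lt_trans s0).
Qed.

Lemma smooth1_step : smooth1 step.
Proof.
move=> k; apply: Ck1_mul; first exact: smooth1_flat.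
apply: (@Ck1_inv _ _ (fun s => flat 1 s + flat 1 (1 - s))) => [s|].
  by rewrite gt_eqF// step_den_gt0.
apply: Ck1_add; first exact: smooth1_flat.
apply: (@Ck1_comp _ _ (flat 1) (fun s => 1 - s)); first exact: smooth1_flat.
apply: (@Ck1_add _ _ (cst 1) (fun s => - s)); first exact: Ck1_cst.
rewrite (_ : -%R = (fun s => cst (-1) s * id s)).
  by apply: Ck1_mul; [exact: Ck1_cst|exact: Ck1_id].
by apply/funext => s; rewrite /= mulN1r.
Qed.

Lemma step_eq0 (s : R) : s <= 0 -> step s = 0.
Proof. by move=> s0; rewrite /step {1}/flat ltNge s0 mul0r. Qed.

Lemma step_eq1 (s : R) : 1 <= s -> step s = 1.
Proof.
move=> s1; rewrite /step [flat 1 (1 - s)]/flat ltNge subr_le0 s1 addr0 divff//.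
by rewrite gt_eqF// flat1_gt0// (lt_le_trans ltr01).
Qed.

Lemma step_ge0 (s : R) : 0 <= step s.
Proof. by rewrite divr_ge0 ?flat1_ge0// ltW// step_den_gt0. Qed.

Lemma step_le1 (s : R) : step s <= 1.
Proof. by rewrite ler_pdivrMr ?step_den_gt0// mul1r lerDl flat1_ge0. Qed.

Lemma is_derive_step (s : R) : is_derive s 1 step (derive1 step s).
Proof. exact: Ck1_is_derive (smooth1_step 1%N) s. Qed.

(** Each s <= 0 is a global minimum of [step], so the derivative vanishes there as at any interior
    extremum, the endpoint 0 included. *)
Lemma dstep_eq0l (s : R) : s <= 0 -> derive1 step s = 0.
Proof.
move=> s0; rewrite derive1E; have sI : s \in `]s - 1, s + 1[%R.
  by rewrite in_itv/= gtrBl ltrDl ltr01.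
have [] // := @derive1_at_min _ step (s - 1) (s + 1) s _ _ sI.
- by rewrite lerBlDr -addrA lerDl.
- by move=> t _; have [] := is_derive_step t.
- by move=> t _; rewrite (step_eq0 s0) step_ge0.
Qed.

Lemma dstep_eq0r (s : R) : 1 <= s -> derive1 step s = 0.
Proof.
move=> s0; rewrite derive1E; have sI : s \in `]s - 1, s + 1[%R.
  by rewrite in_itv/= gtrBl ltrDl ltr01.
have [] // := @derive1_at_max _ step (s - 1) (s + 1) s _ _ sI.
- by rewrite lerBlDr -addrA lerDl.
- by move=> t _; have [] := is_derive_step t.
- by move=> t _; rewrite (step_eq1 s0) step_le1.
Qed.

Lemma dstep_bounded : exists2 C, 0 <= C & forall s, `|derive1 step s| <= C.
Proof.
have cd : continuous (derive1 step) := (smooth1_step 1%N).2.2.1.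
have : compact ((fun s => `|derive1 step s|) @` `[0, 1]%classic).
  apply: continuous_compact; last exact: segment_compact.
  apply: continuous_subspaceT => s; apply: continuous_comp; first exact: cd.
  exact: norm_continuous.
move=> /compact_bounded[C [Cr hC]]; exists (`|C| + 1); first exact: addr_ge0.
move=> s; have [s0|s0] := leP s 0; first by rewrite dstep_eq0l// normr0 addr_ge0.
have [s1|s1] := leP 1 s; first by rewrite dstep_eq0r// normr0 addr_ge0.
have -> : `|derive1 step s| = `| `|derive1 step s| | by rewrite normr_id.
apply: hC; first by rewrite (le_lt_trans (ler_norm C))// ltrDl.
by exists s => //; rewrite /= in_itv/= !ltW.
Qed.

(** A smooth truncation of the identity: 0 where k w + c <= 0 and w where k w + c >= 1. With c = 1
    it smooths a maximum, with c = -1 it produces compact supports. *)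
Definition scut (c k w : R) : R := w * step (k * w + c).

Definition dscut (c k w : R) : R :=
  step (k * w + c) + k * w * derive1 step (k * w + c).

Lemma is_derive_scut (c k w : R) : is_derive w 1 (scut c k) (dscut c k w).
Proof.
have da : is_derive w 1 (fun w : R => k * w + c) k.
  by apply: is_derive_eq; rewrite /GRing.scale/=; ring.
have ds := @is_derive1_comp _ step _ w _ _ (is_derive_step _) da.
have := @is_deriveM _ _ id (fun w => step (k * w + c)) w 1 1 _ _ ds.
move=> h; apply: is_derive_eq.
by rewrite /dscut /GRing.scale/=; ring.
Qed.

Lemma smooth1_scut (c k : R) : smooth1 (scut c k).
Proof.
move=> m; apply: (@Ck1_mul _ _ id); first exact: Ck1_id.
apply: (@Ck1_comp _ _ step (fun w => k * w + c)); first exact: smooth1_step.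
apply: (@Ck1_add _ _ (fun w => k * w) (cst c)); last exact: Ck1_cst.
by apply: (@Ck1_mul _ _ (cst k) id); [exact: Ck1_cst|exact: Ck1_id].
Qed.

Lemma scut_eq0 (c k w : R) : k * w + c <= 0 -> scut c k w = 0.
Proof. by move=> h; rewrite /scut step_eq0// mulr0. Qed.

Lemma dscut_eq0 (c k w : R) : k * w + c <= 0 -> dscut c k w = 0.
Proof. by move=> h; rewrite /dscut step_eq0// dstep_eq0l// mulr0 addr0. Qed.

Lemma scut_eq (c k w : R) : 1 <= k * w + c -> scut c k w = w.
Proof. by move=> h; rewrite /scut step_eq1// mulr1. Qed.

Lemma dscut_eq1 (c k w : R) : 1 <= k * w + c -> dscut c k w = 1.
Proof. by move=> h; rewrite /dscut step_eq1// dstep_eq0r// mulr0 addr0. Qed.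

Lemma scut_le (c k w : R) : `|scut c k w| <= `|w|.
Proof.
by rewrite /scut normrM ler_piMr// ger0_norm ?step_ge0// step_le1.
Qed.

(* The bound does not depend on k because k w is bounded wherever step' is nonzero. *)
Lemma dscut_bounded (c : R) : exists2 C, 0 <= C & forall k w, `|dscut c k w| <= C.
Proof.
have [C C0 hC] := dstep_bounded.
exists (1 + (1 + `|c|) * C); first by rewrite addr_ge0// mulr_ge0// addr_ge0.
move=> k w; rewrite (le_trans (ler_normD _ _))// lerD//.
  by rewrite ger0_norm ?step_ge0// step_le1.
set t := k * w + c; have -> : k * w = t - c by rewrite addrK.
have C1 : 0 <= (1 + `|c|) * C by rewrite mulr_ge0// addr_ge0.
have [t0|t0] := leP t 0; first by rewrite dstep_eq0l// mulr0 normr0.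
have [t1|t1] := leP 1 t; first by rewrite dstep_eq0r// mulr0 normr0.
rewrite normrM ler_pM// (le_trans (ler_normB _ _))// lerD2r.
by rewrite gtr0_norm// ltW.
Qed.

End step.

(** * Integration by parts against test functions *)

Section IBP.
Context {R : realType}.
Local Notation RM := (measurableTypeR R).

Lemma partialM n (i : 'I_n) (f g : 'rV[R]_n -> R) x :
  derivable f x (delta_mx 0 i) -> derivable g x (delta_mx 0 i) ->
  partial i (fun y => f y * g y) x = f x * partial i g x + g x * partial i f x.
Proof. by move=> df dg; rewrite /partial deriveM. Qed.

Lemma partial_near0 n (i : 'I_n) (g : 'rV[R]_n -> R) x :
  (\forall y \near x, g y = 0) -> partial i g x = 0.
Proof.
move=> g0; rewrite /partial.
rewrite (@near_eq_derive _ _ _ g (cst 0))//; exact: derive_cst.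
Qed.

(** The support of [psi] is compact in [Om], so the derivative of the product vanishes outside [Om]
    and its integral may be taken over the whole space, where it is 0: no boundary term appears. *)
Lemma Rintegral_IBP n (i : 'I_n) (Om : set 'rV[R]_n) (f psi : 'rV[R]_n -> R) :
  open Om -> bounded_set Om -> Ck 1 setT f -> test_function Om psi ->
  \int[@lebesgue_rV R n]_(x in Om) (f x * partial i psi x) =
  - \int[@lebesgue_rV R n]_(x in Om) (partial i f x * psi x).
Proof.
move=> oOm bOm Cf [Cpsi [K [cK KOm psi0]]].
have mOm : measurable (Om : set 'rV[RM]_n) by exact: open_measurable_rV.
have Cp : Ck 1 setT psi := Cpsi 1%N.
have CM := Ck_mul (@openT _) Cf Cp.
have [_ /(_ i)[dM [cM _]]] := CM.
have [cf /(_ i)[df [cdf _]]] := Cf; have [cp /(_ i)[dp [cdp _]]] := Cp.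
have bK : bounded_set K := compact_bounded cK.
have [M M0 KM] := bounded_box bK.
have I0 : \int[@lebesgue_rV R n]_(x in Om) (partial i (fun y => f y * psi y) x) = 0.
  have h := @integral_partial0 R n i (fun y => f y * psi y) M.
  rewrite Rintegral_mkcond /Rintegral -[RHS]/(fine 0%E); congr fine.
  rewrite -[RHS]h.
  - apply: eq_integral => x _; rewrite patchE; case: ifPn => // /negP xOm.
    congr EFin; apply/esym/partial_near0.
    have oK : open (~` K).
      by apply: closed_openC; apply: compact_closed => //; exact: norm_hausdorff.
    have : nbhs x (~` K).
      by apply: open_nbhs_nbhs; split => // /KOm; rewrite -inE.
    by apply: (@filterS _ (nbhs x)) => y /psi0 ->; rewrite mulr0.
  - by move=> x; apply: (Ck_continuous CM).
  - by move=> x; apply: dM.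
  - by move=> x; apply: cM.
  - by move=> x xM; rewrite psi0 ?mulr0// => /KM.
have intC (g : 'rV[R]_n -> R) : continuous g ->
    (@lebesgue_rV R n).-integrable Om (EFin \o g).
  move=> cg; have [C gC] := continuous_bounded_rV bOm cg.
  apply: (bounded_integrable_rV mOm bOm _ gC); apply: measurable_funTS.
  by apply: continuous_measurable_rV => [|x _]; [exact: openT|exact: cg].
apply/eqP; rewrite -addr_eq0 -RintegralD//; last 2 first.
- by apply: intC => x; apply: continuousM; [exact: cf|exact: cdp].
- by apply: intC => x; apply: continuousM; [exact: cdf|exact: cp].
rewrite -[X in _ == X]I0; apply/eqP; apply: eq_Rintegral => x _.
by rewrite partialM ?[psi x * _]mulrC//; [exact: df|exact: dp].
Qed.

End IBP.

(** * Weak solutions as limits of smooth fields *)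

Section weak.
Context {R : realType} {n : nat}.
Local Notation RM := (measurableTypeR R).
Local Notation mu := (@lebesgue_rV R n).
Variable Om : set 'rV[R]_n.
Hypotheses (oOm : open Om) (bOm : bounded_set Om).

Let mOm : measurable (Om : set 'rV[RM]_n).
Proof. exact: open_measurable_rV. Qed.

Lemma enorm_sqr (x : 'rV[R]_n) : enorm x ^+ 2 = \sum_i x 0 i ^+ 2.
Proof.
rewrite /enorm sqr_sqrtr; first by apply: eq_bigr => i _; rewrite expr2.
by apply: sumr_ge0 => i _; rewrite -expr2 sqr_ge0.
Qed.

Lemma continuous_measurable_Om (f : 'rV[R]_n -> R) :
  continuous f -> measurable_fun (Om : set 'rV[RM]_n) f.
Proof.
move=> cf; apply: measurable_funTS.
by apply: continuous_measurable_rV => [|x _]; [exact: openT|exact: cf].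
Qed.

Lemma continuous_integrable_Om (f : 'rV[R]_n -> R) :
  continuous f -> mu.-integrable Om (EFin \o f).
Proof.
move=> cf; have [C fC] := continuous_bounded_rV bOm cf.
exact: (bounded_integrable_rV mOm bOm (continuous_measurable_Om cf) fC).
Qed.

Lemma bounded_L2 (f : 'rV[R]_n -> R) (C : R) :
  measurable_fun (Om : set 'rV[RM]_n) f -> (forall x, Om x -> `|f x| <= C) ->
  L2 Om f.
Proof.
move=> mf fC; split => //.
have : mu.-integrable Om (EFin \o (fun x => f x ^+ 2)).
  apply: (bounded_integrable_rV mOm bOm _ (C := C ^+ 2)).
    exact: measurable_funX.
  by move=> x Ox; rewrite normrX lerXn2r ?nnegrE ?fC// (le_trans _ (fC x Ox)).
move=> /integrableP[_]; apply: le_lt_trans; apply: ge0_le_integral => //.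
- by move=> x _; rewrite lee_fin sqr_ge0.
- by apply/measurable_EFinP; exact: measurable_funX.
- by apply: measurableT_comp => //; apply/measurable_EFinP; exact: measurable_funX.
- by move=> x _ /=; rewrite lee_fin ler_norm.
Qed.

Lemma test_function_continuous psi : test_function Om psi -> continuous psi.
Proof. by move=> [/(_ 0%N)[c _] _] x; exact: c. Qed.

Lemma test_function_partial_continuous psi i :
  test_function Om psi -> continuous (partial i psi).
Proof. by move=> [/(_ 1%N)[_ /(_ i)[_ [c _]]] _] x; exact: c. Qed.

(** A practical criterion for membership in H^1_0: uniform bounds and pointwise eventual equality.
    Dominated convergence carries the integration by parts from [phi k] to [u], and sends the H^1
    distance to 0. *)
Lemma H10_approx (u : 'rV[R]_n -> R) (G : 'rV[R]_n -> 'rV[R]_n)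
    (phi : nat -> 'rV[R]_n -> R) (C : R) :
  (forall k, test_function Om (phi k)) ->
  (forall k x, Om x -> `|phi k x| <= C) ->
  (forall k i x, Om x -> `|partial i (phi k) x| <= C) ->
  (forall x, Om x -> \forall k \near \oo, phi k x = u x) ->
  (forall i x, Om x -> \forall k \near \oo, partial i (phi k) x = G x 0 i) ->
  H10 Om u G.
Proof.
move=> tphi phiC dphiC phiu dphiG.
have mphi k := continuous_measurable_Om (test_function_continuous (tphi k)).
have mdphi k i := continuous_measurable_Om
  (@test_function_partial_continuous _ i (tphi k)).
have [mu_ uC _] := Rintegral_eventually_eq mOm bOm mphi phiC phiu.
have GE i := Rintegral_eventually_eq mOm bOm (mdphi ^~ i)
  (fun k => dphiC k i) (dphiG i).
split; first split.
- exact: bounded_L2 uC.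
- by move=> i; have [mG GC _] := GE i; exact: bounded_L2 GC.
- move=> psi tpsi i.
  have cpsi := test_function_continuous tpsi.
  have cdpsi := @test_function_partial_continuous _ i tpsi.
  have [B psiB] := continuous_bounded_rV bOm cpsi.
  have [B' dpsiB] := continuous_bounded_rV bOm cdpsi.
  have [] := @Rintegral_eventually_eq R n Om (fun k x => phi k x * partial i psi x)
    (fun x => u x * partial i psi x) (C * B') mOm bOm.
  + by move=> k; apply: measurable_funM => //; exact: continuous_measurable_Om.
  + by move=> k x Ox; rewrite normrM ler_pM ?phiC ?dpsiB.
  + by move=> x /phiu; apply: filterS => k ->.
  move=> _ _ l1.
  have [] := @Rintegral_eventually_eq R n Om (fun k x => partial i (phi k) x * psi x)
    (fun x => G x 0 i * psi x) (C * B) mOm bOm.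
  + by move=> k; apply: measurable_funM => //; exact: continuous_measurable_Om.
  + by move=> k x Ox; rewrite normrM ler_pM ?dphiC ?psiB.
  + by move=> x /(dphiG i); apply: filterS => k ->.
  move=> _ _ /cvgN l2; apply: (@cvg_unique _ (@Rhausdorff R) _ _ _ _ l1 _).
  apply: cvg_trans l2; apply: near_eq_cvg; apply: nearW => k /=.
  by rewrite (Rintegral_IBP i oOm bOm _ tpsi)//; exact: (tphi k).1.
- exists phi; split => //.
  pose q k x := (u x - phi k x) ^+ 2 + enorm (G x - grad (phi k) x) ^+ 2.
  have qE k x : q k x = (u x - phi k x) ^+ 2 + \sum_i (G x 0 i - partial i (phi k) x) ^+ 2.
    by rewrite /q enorm_sqr; congr (_ + _); apply: eq_bigr => i _; rewrite !mxE.
  have mq k : measurable_fun (Om : set 'rV[RM]_n) (q k).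
    rewrite (funext (qE k)); apply: measurable_funD.
      by apply: measurable_funX; exact: measurable_funB.
    apply: measurable_sum => i; apply: measurable_funX; apply: measurable_funB => //.
    by have [] := GE i.
  have qC k x : Om x -> `|q k x| <= (C + C) ^+ 2 + \sum_(i < n) (C + C) ^+ 2.
    move=> Ox; have sq (a b : R) : `|a| <= C -> `|b| <= C -> (a - b) ^+ 2 <= (C + C) ^+ 2.
      move=> aC bC; rewrite -real_normK ?num_real// lerXn2r ?nnegrE//.
        by rewrite addr_ge0// (le_trans _ aC).
      by rewrite (le_trans (ler_normB _ _))// lerD.
    rewrite ger0_norm; last by rewrite addr_ge0 ?sqr_ge0.
    rewrite qE lerD ?sq ?uC ?phiC//; apply: ler_sum => i _.
    by have [_ GC _] := GE i; rewrite sq ?GC ?dphiC.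
  have q0 x : Om x -> \forall k \near \oo, q k x = 0.
    move=> Ox; have : \forall k \near \oo, forall i, partial i (phi k) x = G x 0 i.
      by apply: filter_forall => i; exact: dphiG.
    have := phiu x Ox; apply: filterS2 => k pu h.
    by rewrite qE pu subrr expr0n/= add0r big1// => i _; rewrite h subrr expr0n.
  have [_ _] := Rintegral_eventually_eq mOm bOm mq qC q0.
  rewrite Rintegral_cst// mul0r => h.
  rewrite (_ : (fun k => _) = EFin \o (fun k => \int[mu]_(x in Om) q k x)).
    by apply: cvg_EFin => //; exact: nearW.
  apply/funext => k; rewrite /= fineK//; apply: integrable_fin_num => //.
  exact: (bounded_integrable_rV mOm bOm (mq k) (qC k)).
Qed.

Lemma L2_integrable (f : 'rV[R]_n -> R) : L2 Om f -> mu.-integrable Om (EFin \o f).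
Proof.
move=> [mf f2]; apply/integrableP; split; first exact/measurable_EFinP.
apply: (@le_lt_trans _ _ (\int[mu]_(x in Om) (1%:E + (f x ^+ 2)%:E))%E).
  apply: ge0_le_integral => //.
  - by apply: measurableT_comp => //; exact/measurable_EFinP.
  - by apply: emeasurable_funD => //; apply/measurable_EFinP; exact: measurable_funX.
  - move=> x _ /=; rewrite -EFinD lee_fin -real_normK ?num_real//.
    set t := `|f x|; nra.
rewrite ge0_integralD//; last 2 first.
- by move=> x _; rewrite lee_fin sqr_ge0.
- by apply/measurable_EFinP; exact: measurable_funX.
rewrite integral_cst// mul1e lte_add_pinfty//.
exact: lebesgue_rV_bounded.
Qed.

Lemma integrable_bounded_mul (f g : 'rV[R]_n -> R) (C : R) :
  measurable_fun (Om : set 'rV[RM]_n) f -> (forall x, Om x -> `|f x| <= C) ->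
  mu.-integrable Om (EFin \o g) ->
  mu.-integrable Om (EFin \o (fun x => f x * g x)).
Proof.
move=> mf fC ig; have mg : measurable_fun (Om : set 'rV[RM]_n) g.
  by apply/measurable_EFinP; exact: measurable_int ig.
apply: (@le_integrable _ _ _ _ _ mOm _ (fun x => (C * g x)%:E)).
- by apply/measurable_EFinP; exact: measurable_funM.
- move=> x Ox /=; rewrite lee_fin !normrM ler_wpM2r//.
  by rewrite (le_trans (fC x Ox))// ler_norm.
- have := integrableZl mOm C ig; apply: eq_integrable => // x _.
Qed.

Lemma Rintegral_sum (F : 'I_n -> 'rV[R]_n -> R) :
  (forall i, mu.-integrable Om (EFin \o F i)) ->
  mu.-integrable Om (EFin \o (fun x => \sum_i F i x)) /\
  \int[mu]_(x in Om) (\sum_i F i x) = \sum_i \int[mu]_(x in Om) F i x.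
Proof.
move=> iF; elim: (index_enum 'I_n) => [|i r [ihi ih]].
  have -> : (fun x => \sum_(i <- [::]) F i x) = cst 0.
    by apply/funext => x; rewrite big_nil.
  split; first by apply: continuous_integrable_Om; exact: cst_continuous.
  by rewrite big_nil Rintegral_cst// mul0r.
have E : (fun x => \sum_(j <- i :: r) F j x) = (fun x => F i x + \sum_(j <- r) F j x).
  by apply/funext => x; rewrite big_cons.
split; first by rewrite E; exact: (integrableD mOm (iF i) ihi).
by rewrite E big_cons -ih RintegralD.
Qed.

(** Young's inequality with a free weight. It replaces the Cauchy-Schwarz inequality for integrals,
    the weight being chosen at the end. *)
Lemma AMGM_le (e a b : R) : 0 < e -> a * b <= e * a ^+ 2 + e^-1 * b ^+ 2.
Proof.
move=> e0; rewrite -subr_ge0.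
have -> : e * a ^+ 2 + e^-1 * b ^+ 2 - a * b =
    e^-1 * ((e * a) ^+ 2 + b ^+ 2 - (e * a) * b) by field; rewrite gt_eqF.
rewrite mulr_ge0 ?invr_ge0 ?(ltW e0)//.
have := sqr_ge0 (e * a - b); have := sqr_ge0 (e * a + b); nra.
Qed.

(* The flux sigma grad u jumps across the interface, but it is a bounded pointwise
   limit of smooth fields of divergence n: this avoids any surface integral. *)
Lemma weak_solution_approx (sc : R) (D : set 'rV[R]_n) (u : 'rV[R]_n -> R)
    (G : 'rV[R]_n -> 'rV[R]_n) (F : nat -> 'I_n -> 'rV[R]_n -> R) (C : R) :
  H10 Om u G ->
  (forall k i, Ck 1 setT (F k i)) ->
  (forall k x, \sum_i partial i (F k i) x = n%:R) ->
  (forall k i x, Om x -> `|F k i x| <= C) ->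
  (forall i x, Om x -> \forall k \near \oo,
     F k i x = conductivity sc D Om x * G x 0 i) ->
  weak_solution sc D Om u.
Proof.
move=> HuG CF divF FC Flim; exists G; split => //.
pose S i x := conductivity sc D Om x * G x 0 i.
have mF k i : measurable_fun (Om : set 'rV[RM]_n) (F k i).
  by apply: continuous_measurable_Om => x; apply: (CF k i).1.
have SE i := Rintegral_eventually_eq mOm bOm (mF ^~ i) (fun k => FC k i) (Flim i).
have mS i : measurable_fun (Om : set 'rV[RM]_n) (S i) by have [] := SE i.
have SC i x : Om x -> `|S i x| <= C by have [_ + _] := SE i; exact.
have dotS x (v : 'rV[R]_n) :
    conductivity sc D Om x * dotv (G x) v = \sum_i S i x * v 0 i.
  by rewrite /dotv mulr_sumr; apply: eq_bigr => i _; rewrite /S mulrA.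
(* The equation against test functions: integrate by parts with each smooth field, whose divergence
   is n, and let k tend to infinity. *)
have test_eq psi : test_function Om psi ->
    \int[mu]_(x in Om) (\sum_i S i x * partial i psi x) =
    - (n%:R * \int[mu]_(x in Om) psi x).
  move=> tpsi.
  have cpsi := test_function_continuous tpsi.
  have cdpsi i := @test_function_partial_continuous _ i tpsi.
  have FE k : \int[mu]_(x in Om) (\sum_i F k i x * partial i psi x) =
      - (n%:R * \int[mu]_(x in Om) psi x).
    have cF i : continuous (F k i) by move=> x; apply: (CF k i).1.
    have cdF i : continuous (partial i (F k i)).
      by move=> x; have [_ /(_ i)[_ [c _]]] := CF k i; exact: c.
    rewrite (Rintegral_sum _).2; last first.
      by move=> i; apply: continuous_integrable_Om => x;
         apply: continuousM; [exact: cF|exact: cdpsi].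
    under eq_bigr => i _ do rewrite (Rintegral_IBP i oOm bOm (CF k i) tpsi).
    rewrite sumrN -(Rintegral_sum _).2; last first.
      by move=> i; apply: continuous_integrable_Om => x;
         apply: continuousM; [exact: cdF|exact: cpsi].
    rewrite -RintegralZl//; last exact: continuous_integrable_Om.
    by congr (- _); apply: eq_Rintegral => x _; rewrite -mulr_suml divF.
  have dB i : {B | forall x, Om x -> `|partial i psi x| <= B}.
    exact/cid/continuous_bounded_rV.
  have [] := @Rintegral_eventually_eq R n Om
    (fun k x => \sum_i F k i x * partial i psi x)
    (fun x => \sum_i S i x * partial i psi x) (\sum_i C * sval (dB i)) mOm bOm.
  - move=> k; apply: measurable_sum => i; apply: measurable_funM => //.
    exact: continuous_measurable_Om.
  - move=> k x Ox; rewrite (le_trans (ler_norm_sum _ _ _))//; apply: ler_sum => i _.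
    by rewrite normrM ler_pM ?FC//; case: (dB i) => B /= ->.
  - move=> x Ox; have : \forall k \near \oo, forall i, F k i x = S i x.
      by apply: filter_forall => i; exact: Flim.
    by apply: filterS => k h; apply: eq_bigr => i _; rewrite h.
  move=> _ _; under eq_fun do rewrite FE.
  by move=> /(cvg_unique (@Rhausdorff R)); apply; exact: cvg_cst.
move=> phi H [[L2phi L2H _] [p [tp p0]]].
have iphi := L2_integrable L2phi.
have iH i := L2_integrable (L2H i).
have iSH : mu.-integrable Om (EFin \o (fun x => \sum_i S i x * H x 0 i)).
  apply: (Rintegral_sum _).1 => i.
  exact: (integrable_bounded_mul (mS i) (SC i) (iH i)).
have iSp k : mu.-integrable Om (EFin \o (fun x => \sum_i S i x * partial i (p k) x)).
  apply: (Rintegral_sum _).1 => i.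
  apply: (integrable_bounded_mul (mS i) (SC i)); apply: continuous_integrable_Om.
  exact: test_function_partial_continuous.
have ip k : mu.-integrable Om (EFin \o p k).
  exact/continuous_integrable_Om/test_function_continuous.
under eq_Rintegral do rewrite dotS.
(* [I] is the defect of the weak equation at [phi]. Test functions have defect 0, so [I] is also the
   defect at [phi - p k], for every k. *)
pose I := \int[mu]_(x in Om) (\sum_i S i x * H x 0 i) + n%:R * \int[mu]_(x in Om) phi x.
suff : I = 0 by move=> /eqP; rewrite addr_eq0 => /eqP ->; rewrite opprK.
pose w k x := (\sum_i S i x * H x 0 i - \sum_i S i x * partial i (p k) x) +
  n%:R * (phi x - p k x).
have iZ k : mu.-integrable Om (EFin \o (fun x => n%:R * (phi x - p k x))).
  exact: (integrableZl mOm n%:R (integrableB mOm iphi (ip k))).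
have iw k : mu.-integrable Om (EFin \o w k).
  exact: (integrableD mOm (integrableB mOm iSH (iSp k)) (iZ k)).
have IE k : I = \int[mu]_(x in Om) w k x.
  rewrite (RintegralD mOm (integrableB mOm iSH (iSp k)) (iZ k)).
  rewrite (RintegralZl n%:R mOm (integrableB mOm iphi (ip k))).
  rewrite !RintegralB// test_eq// /I mulrBr opprK; ring.
pose q k x := (phi x - p k x) ^+ 2 + enorm (H x - grad (p k) x) ^+ 2.
have qE k x : q k x = (phi x - p k x) ^+ 2 +
    \sum_i (H x 0 i - partial i (p k) x) ^+ 2.
  by rewrite /q enorm_sqr; congr (_ + _); apply: eq_bigr => i _; rewrite !mxE.
(* What Young's inequality leaves of the coefficients: C^2 for each of the n flux components and n^2
   for the source term. *)
pose Q := n%:R * C ^+ 2 + n%:R ^+ 2 : R.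
have wq e k x : 0 < e -> Om x -> `|w k x| <= e * Q + e^-1 * q k x.
  move=> e0 Ox; rewrite (le_trans (ler_normD _ _))// -sumrB.
  apply: (@le_trans _ _ (\sum_i (e * C ^+ 2 + e^-1 * (H x 0 i - partial i (p k) x) ^+ 2) +
     (e * n%:R ^+ 2 + e^-1 * (phi x - p k x) ^+ 2))).
    apply: lerD.
      rewrite (le_trans (ler_norm_sum _ _ _))//; apply: ler_sum => i _.
      rewrite -mulrBr normrM (le_trans (ler_wpM2r (normr_ge0 _) (SC i x Ox)))//.
      by rewrite (le_trans (AMGM_le C _ e0))// real_normK ?num_real.
    by rewrite normrM normr_nat (le_trans (AMGM_le _ _ e0))// real_normK ?num_real.
  rewrite qE big_split/= sumr_const card_ord -mulr_sumr -[_ *+ n]mulr_natl /Q.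
  by rewrite le_eqVlt; apply/orP; left; apply/eqP; ring.
have mq k : measurable_fun (Om : set 'rV[RM]_n) (q k).
  have mi f : mu.-integrable Om (EFin \o f) -> measurable_fun (Om : set 'rV[RM]_n) f.
    by move=> h; apply/measurable_EFinP; exact: measurable_int h.
  rewrite (funext (qE k)); apply: measurable_funD.
    by apply: measurable_funX; apply: measurable_funB; exact: mi.
  apply: measurable_sum => i; apply: measurable_funX; apply: measurable_funB.
    exact: mi.
  apply: continuous_measurable_Om; exact: test_function_partial_continuous.
have q0 k x : 0 <= q k x by rewrite addr_ge0 ?sqr_ge0.
have muOm : (mu Om < +oo)%E by exact: lebesgue_rV_bounded.
have Q0 : 0 <= Q.
  by apply: addr_ge0; [apply: mulr_ge0; [exact: ler0n|exact: sqr_ge0]|exact: sqr_ge0].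
have muE : mu Om = (fine (mu Om))%:E by rewrite fineK// ge0_fin_numE.
have M0 : 0 <= fine (mu Om) by rewrite fine_ge0.
(* With weight e and an approximation at squared H^1 distance below e^2, both halves of Young's
   bound are of order e. *)
have key e : 0 < e -> `|I| <= e * (Q * fine (mu Om) + 1).
  move=> e0; have e20 : (0 < (e * e)%:E)%E by rewrite lte_fin mulr_gt0.
  have [k qk] : exists k, (\int[mu]_(x in Om) (q k x)%:E < (e * e)%:E)%E.
    have : \forall k \near \oo, (\int[mu]_(x in Om) (q k x)%:E < (e * e)%:E)%E.
      exact: (p0 (fun y => (y < (e * e)%:E)%E) (open_ereal_lt' e20)).
    by move=> [k _ /(_ _ (leqnn k)) h]; exists k.
  rewrite (IE k) -lee_fin EFin_normr_Rintegral//.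
  apply: (le_trans (le_abse_integral mu mOm (measurable_int _ (iw k)))).
  apply: (@le_trans _ _ (\int[mu]_(x in Om) ((e * Q)%:E + e^-1%:E * (q k x)%:E))%E).
    apply: ge0_le_integral => //.
    - by apply: measurableT_comp => //; exact: (measurable_int _ (iw k)).
    - apply: emeasurable_funD => //; apply: measurable_funeM.
      exact/measurable_EFinP.
    - by move=> x Ox; rewrite /= -EFinM -EFinD lee_fin wq.
  rewrite ge0_integralD//; last 3 first.
  - by move=> x _; rewrite lee_fin mulr_ge0// ltW.
  - by move=> x _; rewrite -EFinM lee_fin mulr_ge0// invr_ge0 ltW.
  - by apply: measurable_funeM; exact/measurable_EFinP.
  rewrite integral_cst// ge0_integralZl//; last 3 first.
  - exact/measurable_EFinP.
  - by move=> x _; rewrite lee_fin.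
  - by rewrite lee_fin invr_ge0 ltW.
  have -> : e * (Q * fine (mu Om) + 1) = e * Q * fine (mu Om) + e by ring.
  rewrite EFinD leeD//; first by rewrite [X in (_ <= X)%E]EFinM -muE.
  rewrite -[X in (_ <= X%:E)%E](mulKf (lt0r_neq0 e0)) EFinM.
  by rewrite lee_pmul2l ?lte_fin ?invr_gt0// ltW.
have B0 : 0 < Q * fine (mu Om) + 1 by rewrite ltr_wpDl// mulr_ge0.
apply/eqP; rewrite -normr_eq0; apply/negPn/negP => I0.
have Ip : 0 < `|I| by rewrite normr_gt0 -normr_eq0.
move: key B0; set B := Q * _ + 1 => key B0.
(* This weight turns the bound into [|I| <= |I| / 2]. *)
have := key (`|I| / (2 * B)); rewrite divr_gt0 ?mulr_gt0// => /(_ isT).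
have -> : `|I| / (2 * B) * B = `|I| / 2 by field; rewrite gt_eqF.
lra.
Qed.

End weak.

(** * Analytic implicit functions *)

Section poly_norm.
Context {R : realType} {m : nat}.
Local Notation MP := (mpoly.mpoly m R).
Implicit Types (p q : MP) (r : R).

(* A submultiplicative norm that dominates the values on the polydisc of radius r. *)
Definition pnorm r p : R :=
  \sum_(a <- mpoly.msupp p) `|mpoly.mcoeff a p| * r ^+ mpoly.mdeg a.

(** Polynomials with different supports are compared by writing all their norms over one common list
    of exponents. *)
Lemma pnorm_sub r p (d : seq (mpoly.multinom m)) :
  uniq d -> {subset mpoly.msupp p <= d} ->
  pnorm r p = \sum_(a <- d) `|mpoly.mcoeff a p| * r ^+ mpoly.mdeg a.
Proof.
move=> ud pd; rewrite [RHS](bigID (mem (mpoly.msupp p)))/= [X in _ + X]big1 ?addr0.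
  rewrite -big_filter; apply: perm_big; apply: uniq_perm.
  - exact: mpoly.msupp_uniq.
  - exact: filter_uniq.
  - move=> a; rewrite mem_filter /=; apply/idP/andP => [ap|[]//].
    by split => //; exact: pd.
by move=> a /mpoly.memN_msupp_eq0 ->; rewrite normr0 mul0r.
Qed.

Lemma pnormD r p q : 0 <= r -> pnorm r (p + q) <= pnorm r p + pnorm r q.
Proof.
move=> r0; pose d := undup (mpoly.msupp p ++ mpoly.msupp q ++ mpoly.msupp (p + q)).
rewrite !(@pnorm_sub r _ d) ?undup_uniq//; last 3 first.
- by move=> a h; rewrite mem_undup !mem_cat h ?orbT.
- by move=> a h; rewrite mem_undup !mem_cat h ?orbT.
- by move=> a h; rewrite mem_undup !mem_cat h ?orbT.
rewrite -big_split/=; apply: ler_sum => a _.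
by rewrite mpoly.mcoeffD -mulrDl ler_wpM2r ?exprn_ge0// ler_normD.
Qed.

Lemma pnorm0 r : pnorm r 0 = 0.
Proof. by rewrite /pnorm mpoly.msupp0 big_nil. Qed.

Lemma pnorm_ge0 r p : 0 <= r -> 0 <= pnorm r p.
Proof. by move=> r0; apply: sumr_ge0 => a _; rewrite mulr_ge0// exprn_ge0. Qed.

Lemma pnorm_sum r (I : Type) (s : seq I) (F : I -> MP) : 0 <= r ->
  pnorm r (\sum_(i <- s) F i) <= \sum_(i <- s) pnorm r (F i).
Proof.
move=> r0; elim: s => [|i s ih]; first by rewrite !big_nil pnorm0.
by rewrite !big_cons (le_trans (pnormD _ _ r0))// lerD2l.
Qed.

Lemma pnormZX r (c : R) a :
  pnorm r (c *: mpoly.mpolyX R a) = `|c| * r ^+ mpoly.mdeg a.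
Proof.
rewrite (@pnorm_sub _ _ [:: a])//.
  by rewrite big_seq1 mpoly.mcoeffZ mpoly.mcoeffX eqxx mulr1.
by move=> b /mpoly.msuppZ_le; rewrite mpoly.msuppX.
Qed.

Lemma pnormZ r (c : R) p : pnorm r (c *: p) = `|c| * pnorm r p.
Proof.
rewrite (@pnorm_sub _ _ (mpoly.msupp p)) ?mpoly.msupp_uniq//; last exact: mpoly.msuppZ_le.
by rewrite mulr_sumr; apply: eq_bigr => a _; rewrite mpoly.mcoeffZ normrM mulrA.
Qed.

Lemma pnormM r p q : 0 <= r -> pnorm r (p * q) <= pnorm r p * pnorm r q.
Proof.
move=> r0; rewrite {1}(mpoly.mpolyE p) {1}(mpoly.mpolyE q) big_distrlr/=.
apply: (le_trans (pnorm_sum _ _ r0)); rewrite /pnorm mulr_suml; apply: ler_sum => a _.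
apply: (le_trans (pnorm_sum _ _ r0)); rewrite mulr_sumr; apply: ler_sum => b _.
rewrite -scalerAl -scalerAr -mpoly.mpolyXD scalerA pnormZX mpoly.mdegD normrM exprD.
by rewrite mulrACA.
Qed.

Lemma pnormC r (c : R) : pnorm r (mpoly.mpolyC m c) = `|c|.
Proof.
rewrite (@pnorm_sub _ _ [:: mpoly.mnm0]) ?big_seq1.
- by rewrite mpoly.mcoeffC eqxx mulr1 mpoly.mdeg0 expr0 mulr1.
- by [].
- by move=> a; rewrite mpoly.msuppC; case: ifP.
Qed.

Lemma pnormXU r i : pnorm r (mpoly.mpolyX R (mpoly.mnm1 i)) = r.
Proof. by have := pnormZX r 1 (mpoly.mnm1 i); rewrite scale1r normr1 mul1r mpoly.mdeg1. Qed.

Lemma pnorm_meval r p (v : 'I_m -> R) :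
  (forall i, `|v i| <= r) -> `|mpoly.meval v p| <= pnorm r p.
Proof.
move=> vr; rewrite mpoly.mevalE (le_trans (ler_norm_sum _ _ _))//.
apply: ler_sum => a _; rewrite normrM ler_wpM2l// normr_prod mpoly.mdegE -prodrXr.
apply: ler_prod => i _; rewrite normr_ge0/= normrX lerXn2r ?nnegrE//.
exact: le_trans (vr i).
Qed.

Lemma pnorm_coef r p a : 0 <= r -> `|mpoly.mcoeff a p| * r ^+ mpoly.mdeg a <= pnorm r p.
Proof.
move=> r0; have [ap|/mpoly.memN_msupp_eq0 ->] := boolP (a \in mpoly.msupp p).
  rewrite /pnorm (bigD1_seq a)//= ?mpoly.msupp_uniq// lerDl.
  by apply: sumr_ge0 => b _; rewrite mulr_ge0// exprn_ge0.
by rewrite normr0 mul0r pnorm_ge0.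
Qed.

End poly_norm.

(** * Power series as limits of polynomials in the weighted norm *)

Section poly_limit.
Context {R : realType} {m : nat}.
Local Notation MP := (mpoly.mpoly m R).

Lemma sum_geo_half (k : nat) : \sum_(j < k) 2^-1 ^+ j <= 2 :> R.
Proof.
suff : \sum_(j < k) 2^-1 ^+ j = 2 - 2 * 2^-1 ^+ k :> R.
  by move=> ->; rewrite gerBl// mulr_ge0// exprn_ge0// invr_ge0.
elim: k => [|k ih]; first by rewrite big_ord0 expr0 mulr1 subrr.
by rewrite big_ord_recr/= ih exprS; field.
Qed.

Section lim.
Variables (p : nat -> MP) (r M : R).
Hypotheses (r0 : 0 < r) (pM : forall k, pnorm r (p k.+1 - p k) <= M * 2^-1 ^+ k).

Let M0 : 0 <= M.
Proof.
have := pM 0%N; rewrite expr0 mulr1; apply: le_trans.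
exact/pnorm_ge0/ltW.
Qed.

Lemma pnorm_cauchy k l : (k <= l)%N -> pnorm r (p l - p k) <= M * 2 * 2^-1 ^+ k.
Proof.
move=> kl; have -> : p l - p k = \sum_(0 <= j < l - k) (p (k + j).+1 - p (k + j)%N).
  rewrite (eq_bigr (fun j => p (k + j.+1)%N - p (k + j)%N)).
    by rewrite telescope_sumr// addn0 subnKC.
  by move=> j _; rewrite addnS.
apply: (le_trans (pnorm_sum _ _ (ltW r0))); rewrite big_mkord.
apply: (@le_trans _ _ (\sum_(j < l - k) M * 2^-1 ^+ k * 2^-1 ^+ j)).
  by apply: ler_sum => j _; rewrite (le_trans (pM _))// exprD mulrA.
rewrite -mulr_sumr [leRHS]mulrAC ler_wpM2l//.
  by rewrite mulr_ge0// exprn_ge0// invr_ge0.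
exact: sum_geo_half.
Qed.

Let e_ k := M * 2 * 2^-1 ^+ k.

Let e_small (e : R) : 0 < e -> \forall k \near \oo, e_ k < e.
Proof.
move=> e0; have h : e_ @ \oo --> (0 : R).
  rewrite -[X in _ --> X](mulr0 (M * 2)); apply: cvgM; first exact: cvg_cst.
  by apply: cvg_expr; rewrite ger0_norm ?invr_ge0// invf_lt1// ltr1n.
exact: (cvgr_lt _ h).
Qed.

Let cauchy_half (u : nat -> R) (c : R) : 0 < c ->
  (forall k l, (k <= l)%N -> `|u l - u k| * c <= e_ k) -> cvgn u.
Proof.
move=> c0 h; apply/cauchy_cvgP/cauchy_exP => e e0.
have [k _ /(_ k (leqnn k)) ek] := e_small (mulr_gt0 e0 c0).
exists (u k); exists k => // l kl.
by rewrite /= /ball/= distrC -(ltr_pM2r c0) (le_lt_trans (h _ _ kl)).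
Qed.

Let coef (a : multinom m) : R := limn (fun k => mcoeff a (p k)).

Let cvg_coef a : mcoeff a (p k) @[k --> \oo] --> coef a.
Proof.
apply: (@cauchy_half _ (r ^+ mdeg a)); first exact: exprn_gt0.
move=> k l kl; rewrite -mcoeffB (le_trans (pnorm_coef _ _ (ltW r0)))//.
exact: pnorm_cauchy.
Qed.

Lemma pnorm_subsum (q : MP) (d : seq (multinom m)) : uniq d ->
  \sum_(a <- d) `|mcoeff a q| * r ^+ mdeg a <= pnorm r q.
Proof.
move=> ud; rewrite (@pnorm_sub _ _ _ _ (undup (d ++ msupp q))) ?undup_uniq//; last first.
  by move=> a h; rewrite mem_undup mem_cat h orbT.
rewrite [leRHS](bigID (mem d) xpredT)/= [X in _ <= X + _](_ : _ = \sum_(a <- d) `|mcoeff a q| * r ^+ mdeg a).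
  by rewrite lerDl; apply: sumr_ge0 => a _; rewrite mulr_ge0// exprn_ge0// ltW.
rewrite -big_filter; apply: perm_big; apply: uniq_perm => //.
  exact/filter_uniq/undup_uniq.
move=> a; rewrite mem_filter mem_undup mem_cat /=.
by case: (a \in d).
Qed.

(** The bound is the same for all finite sets of exponents. That uniformity gives both the absolute
    summability of the limit coefficients and the convergence of the box sums. *)
Let coef_dist (d : seq (multinom m)) k : uniq d ->
  \sum_(a <- d) `|coef a - mcoeff a (p k)| * r ^+ mdeg a <= e_ k.
Proof.
move=> ud.
have h : \sum_(a <- d) `|mcoeff a (p l) - mcoeff a (p k)| * r ^+ mdeg a @[l --> \oo]
    --> \sum_(a <- d) `|coef a - mcoeff a (p k)| * r ^+ mdeg a.
  elim: d {ud} => [|a d ih]; last under eq_fun do rewrite big_cons.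
    by under eq_fun do rewrite big_nil; rewrite big_nil; exact: cvg_cst.
  rewrite big_cons; apply: cvgD => //; apply: cvgM; last exact: cvg_cst.
  by apply: cvg_norm; apply: cvgB; [exact: cvg_coef|exact: cvg_cst].
apply: (ler_cvg_to h (cvg_cst (e_ k))).
exists k => // l kl /=; under eq_bigr do rewrite -mcoeffB.
by rewrite (le_trans (pnorm_subsum _ ud))// pnorm_cauchy.
Qed.

Let f (y : 'rV[R]_m) : R := limn (fun k => meval (y 0) (p k)).

Let small (y : 'rV[R]_m) := forall i, `|y 0 i| <= r.

Let cvg_f y : small y -> meval (y 0) (p k) @[k --> \oo] --> f y.
Proof.
move=> yr; apply: (@cauchy_half _ 1) => // k l kl; rewrite mulr1 -mevalB.
by rewrite (le_trans (pnorm_meval _ yr))// pnorm_cauchy.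
Qed.

Let f_dist y k : small y -> `|f y - meval (y 0) (p k)| <= e_ k.
Proof.
move=> yr.
have h : `|meval (y 0) (p l) - meval (y 0) (p k)| @[l --> \oo] --> `|f y - meval (y 0) (p k)|.
  by apply: cvg_norm; apply: cvgB; [exact: cvg_f|exact: cvg_cst].
apply: (ler_cvg_to h (cvg_cst (e_ k))).
exists k => // l kl /=; rewrite -mevalB.
by rewrite (le_trans (pnorm_meval _ yr))// pnorm_cauchy.
Qed.

Let mnm (a : {ffun 'I_m -> nat}) : multinom m := Multinom [tuple a i | i < m].

Let mnm_inj : injective mnm.
Proof. by move=> a b /mnmP h; apply/ffunP => i; have := h i; rewrite !mnmE. Qed.

Let monomial_mnm a (y : 'rV[R]_m) : monomial a y = \prod_i y 0 i ^+ mnm a i.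
Proof. by apply: eq_bigr => i _; rewrite mnmE. Qed.

Let monomial_le a (y : 'rV[R]_m) : small y -> `|monomial a y| <= r ^+ mdeg (mnm a).
Proof.
move=> yr; rewrite monomial_mnm normr_prod mdegE -prodrXr.
apply: ler_prod => i _; rewrite normr_ge0/= normrX lerXn2r ?nnegrE//.
exact: le_trans (yr i).
Qed.

(** Geometric increments in a norm that controls coefficients and values at once: coefficients and
    values both converge, and the limit function is the sum of the series of limit coefficients. The
    expansion is about the origin; the translation by [y0] moves it to an arbitrary point. *)
Lemma poly_limit_analytic :
  exists g : 'rV[R]_m -> R,
    (forall y : 'rV[R]_m, (forall i, `|y 0 i| <= r) ->
       meval (y 0) (p k) @[k --> \oo] --> g y) /\
    (forall y0, real_analytic_at (fun x => g (x - y0)) y0).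
Proof.
exists f; split => [y|y0]; first exact: cvg_f.
exists (coef \o mnm), r; split => // x xr; set y := x - y0.
have yr : small y by move=> i; rewrite !mxE ltW.
split.
  rewrite /summable; apply: (@le_lt_trans _ _ (e_ 0 + pnorm r (p 0%N))%:E); last exact: ltry.
  apply: ub_ereal_sup => _ [A [fA _] <-]; rewrite fsbig_finite//=.
  rewrite sumEFin lee_fin.
  pose d := [seq mnm a | a <- finmap.enum_fset (fset_set A)].
  have ud : uniq d by rewrite (map_inj_uniq mnm_inj); exact: finmap.fset_uniq.
  apply: (@le_trans _ _ (\sum_(a <- d) `|coef a| * r ^+ mdeg a)).
    rewrite big_map; apply: ler_sum => a _.
    by rewrite normrM ler_wpM2l// monomial_le.
  apply: (@le_trans _ _ (\sum_(a <- d) (`|coef a - mcoeff a (p 0%N)| * r ^+ mdeg a +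
      `|mcoeff a (p 0%N)| * r ^+ mdeg a))).
    apply: ler_sum => a _; rewrite -mulrDl ler_wpM2r ?exprn_ge0 ?(ltW r0)//.
    by have := ler_normD (coef a - mcoeff a (p 0%N)) (mcoeff a (p 0%N)); rewrite subrK.
  by rewrite big_split/= lerD ?coef_dist// pnorm_subsum.
apply/cvgrPdist_le => /= e e0.
have e20 : 0 < e / 2 by rewrite divr_gt0.
have [j _ /(_ j (leqnn j)) ej] := e_small e20.
(* From this k on, the box of exponents contains the support of [p j], whose box sum is then exactly
   its value. *)
exists (msize (p j)) => // k /= kj.
pose a_ (b : {ffun 'I_m -> 'I_k}) : {ffun 'I_m -> nat} := [ffun i => val (b i)].
have a_inj : injective a_.
  by move=> b b' /ffunP h; apply/ffunP => i; apply: val_inj; have := h i; rewrite !ffunE.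
pose d := [seq mnm (a_ b) | b <- index_enum {ffun 'I_m -> 'I_k}].
have ud : uniq d.
  by rewrite map_inj_uniq ?index_enum_uniq//; apply: inj_comp.
have pd : {subset msupp (p j) <= d}.
  move=> a ap; have ak i : (a i < k)%N.
    apply: leq_trans kj; apply: leq_ltn_trans (msize_mdeg_lt ap).
    by rewrite mdegE (bigD1 i)//= leq_addr.
  apply/mapP; exists [ffun i => Ordinal (ak i)]; first exact: mem_index_enum.
  by apply/mnmP => i; rewrite mnmE !ffunE.
have pE : meval (y 0) (p j) = \sum_(a <- d) mcoeff a (p j) * \prod_i y 0 i ^+ a i.
  rewrite mevalE [RHS](bigID (mem (msupp (p j))))/= [X in _ + X]big1 ?addr0; last first.
    by move=> a /memN_msupp_eq0 ->; rewrite mul0r.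
  rewrite -[RHS]big_filter; apply: perm_big; apply: uniq_perm.
  - exact: msupp_uniq.
  - exact: filter_uniq.
  - by move=> a; rewrite mem_filter /=; apply/idP/andP => [ap|[]//]; split => //; exact: pd.
rewrite -[X in X - _](subrK (meval (y 0) (p j))) -addrA (le_trans (ler_normD _ _))//.
rewrite [e]splitr lerD//; first exact: le_trans (f_dist j yr) (ltW ej).
rewrite pE /d big_map -sumrB (le_trans (ler_norm_sum _ _ _))//.
apply: le_trans (ltW ej); apply: le_trans (coef_dist j ud); rewrite big_map.
apply: ler_sum => b _; rewrite /= -/(a_ b) -monomial_mnm -mulrBl normrM distrC.
by rewrite ler_wpM2l// monomial_le.
Qed.

End lim.
End poly_limit.

(** * Strictly differentiable operators on polynomials and their zeros *)

Section ift.
Context {R : realType} {m : nat}.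
Local Notation MP := (mpoly m R).
Local Notation C := (mpolyC m).
Implicit Types (A B : MP -> MP -> MP) (a b p q r : R) (v w : MP).

(* A is an operator on pairs of polynomials with value a and strict derivative (p, q)
   at the origin, uniformly in the norms pnorm r for small r. *)
Definition near_map A a := forall k, 0 < k -> exists2 rho, 0 < rho &
  forall r, 0 < r -> r <= rho -> forall v w, pnorm r v <= rho -> pnorm r w <= rho ->
  pnorm r (A v w - C a) <= k.

Definition strict_diff A p q := forall k, 0 < k -> exists2 rho, 0 < rho &
  forall r, 0 < r -> r <= rho -> forall v w v' w',
  pnorm r v <= rho -> pnorm r w <= rho -> pnorm r v' <= rho -> pnorm r w' <= rho ->
  pnorm r (A v w - A v' w' - (p *: (v - v') + q *: (w - w'))) <=
  k * (pnorm r (v - v') + pnorm r (w - w')).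

Definition good A a p q := near_map A a /\ strict_diff A p q.

Lemma good_const a : good (fun _ _ => C a) a 0 0.
Proof.
split => k k0; exists 1 => // r r0 _ v w.
  by move=> _ _; rewrite subrr pnorm0 ltW.
move=> v' w' _ _ _ _; rewrite !scale0r subrr addr0 subr0 pnorm0.
by rewrite mulr_ge0 ?addr_ge0 ?pnorm_ge0 ?(ltW k0) ?(ltW r0).
Qed.

Lemma good_var i : good (fun _ _ => mpolyX R (mnm1 i)) 0 0 0.
Proof.
split => k k0.
  by exists k => // r r0 rk v w _ _; rewrite mpolyC0 subr0 pnormXU.
exists 1 => // r r0 _ v w.
move=> v' w' _ _ _ _; rewrite !scale0r subrr addr0 subr0 pnorm0.
by rewrite mulr_ge0 ?addr_ge0 ?pnorm_ge0 ?(ltW k0) ?(ltW r0).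
Qed.

Lemma good_fst : good (fun v _ => v) 0 1 0.
Proof.
split => k k0.
  by exists k => // r r0 rk v w vk _; rewrite mpolyC0 subr0.
exists 1 => // r r0 _ v w.
move=> v' w' _ _ _ _; rewrite scale0r scale1r addr0 subrr pnorm0.
by rewrite mulr_ge0 ?addr_ge0 ?pnorm_ge0 ?(ltW k0) ?(ltW r0).
Qed.

Lemma good_snd : good (fun _ w => w) 0 0 1.
Proof.
split => k k0.
  by exists k => // r r0 rk v w _ wk; rewrite mpolyC0 subr0.
exists 1 => // r r0 _ v w.
move=> v' w' _ _ _ _; rewrite scale0r scale1r add0r subrr pnorm0.
by rewrite mulr_ge0 ?addr_ge0 ?pnorm_ge0 ?(ltW k0) ?(ltW r0).
Qed.

Lemma goodD A B a b p q p' q' : good A a p q -> good B b p' q' ->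
  good (fun v w => A v w + B v w) (a + b) (p + p') (q + q').
Proof.
move=> [nA sA] [nB sB]; split => k k0; have k20 : 0 < k / 2 by rewrite divr_gt0.
  have [rA rA0 hA] := nA _ k20; have [rB rB0 hB] := nB _ k20.
  exists (Num.min rA rB); first by rewrite lt_min rA0.
  move=> r r0; rewrite le_min => /andP[r1 r2] v w; rewrite !le_min.
  move=> /andP[v1 v2] /andP[w1 w2]; rewrite mpolyCD opprD addrACA.
  rewrite (le_trans (pnormD _ _ (ltW r0)))// [k]splitr lerD//; first exact: hA.
  exact: hB.
have [rA rA0 hA] := sA _ k20; have [rB rB0 hB] := sB _ k20.
exists (Num.min rA rB); first by rewrite lt_min rA0.
move=> r r0; rewrite le_min => /andP[r1 r2] v w v' w'; rewrite !le_min.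
move=> /andP[v1 v2] /andP[w1 w2] /andP[v1' v2'] /andP[w1' w2'].
have -> : A v w + B v w - (A v' w' + B v' w') -
    ((p + p') *: (v - v') + (q + q') *: (w - w')) =
    (A v w - A v' w' - (p *: (v - v') + q *: (w - w'))) +
    (B v w - B v' w' - (p' *: (v - v') + q' *: (w - w'))).
  by rewrite !scalerDl; ring.
rewrite (le_trans (pnormD _ _ (ltW r0)))// [k]splitr mulrDl lerD//; first exact: hA.
exact: hB.
Qed.

Lemma pnorm_lin r p q v w : 0 <= r ->
  pnorm r (p *: v + q *: w) <= (`|p| + `|q|) * (pnorm r v + pnorm r w).
Proof.
move=> r0; rewrite (le_trans (pnormD _ _ r0))// !pnormZ mulrDl lerD//.
  by rewrite ler_wpM2l// lerDl pnorm_ge0.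
by rewrite ler_wpM2l// lerDr pnorm_ge0.
Qed.

Lemma pnorm_near r v a k : 0 <= r -> pnorm r (v - C a) <= k -> pnorm r v <= `|a| + k.
Proof.
move=> r0 vk; rewrite -[v](subrK (C a)) addrC (le_trans (pnormD _ _ r0))//.
by rewrite pnormC lerD.
Qed.

Lemma goodM A B a b p q p' q' : good A a p q -> good B b p' q' ->
  good (fun v w => A v w * B v w) (a * b) (b * p + a * p') (b * q + a * q').
Proof.
move=> [nA sA] [nB sB].
(* [K] bounds the sum of all factors that multiply k' in the error terms of the product; the 2
   covers the two occurrences of k' <= 1 among them. *)
pose K := `|a| + `|b| + (`|p| + `|q|) + (`|p'| + `|q'|) + 2.
have K0 : 0 < K by rewrite ltr_wpDl// !addr_ge0.
split => k k0.
  pose k' := Num.min 1 (k / K).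
  have k'0 : 0 < k' by rewrite lt_min ltr01 divr_gt0.
  have k'1 : k' <= 1 by rewrite ge_min lexx.
  have k'K : k' * K <= k by rewrite -ler_pdivlMr// ge_min lexx orbT.
  have [rA rA0 hA] := nA _ k'0; have [rB rB0 hB] := nB _ k'0.
  exists (Num.min rA rB); first by rewrite lt_min rA0.
  move=> r r0; rewrite le_min => /andP[r1 r2] v w; rewrite !le_min.
  move=> /andP[v1 v2] /andP[w1 w2].
  have {}hA := hA r r0 r1 v w v1 w1; have {}hB := hB r r0 r2 v w v2 w2.
  have r0' := ltW r0.
  have -> : A v w * B v w - C (a * b) = (A v w - C a) * B v w + C a * (B v w - C b).
    by rewrite mpolyCM; ring.
  rewrite (le_trans (pnormD _ _ r0'))//.
  have h1 : pnorm r ((A v w - C a) * B v w) <= k' * (`|b| + 1).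
    rewrite (le_trans (pnormM _ _ r0'))// ler_pM ?pnorm_ge0//.
    by rewrite (le_trans (pnorm_near r0' hB))// lerD2l.
  have h2 : pnorm r (C a * (B v w - C b)) <= `|a| * k'.
    by rewrite (le_trans (pnormM _ _ r0'))// pnormC ler_wpM2l.
  apply: le_trans (lerD h1 h2) _; apply: le_trans k'K.
  rewrite (mulrC `|a|) -mulrDr ler_wpM2l ?(ltW k'0)// /K.
  have := normr_ge0 p; have := normr_ge0 q; have := normr_ge0 p'; have := normr_ge0 q'.
  lra.
pose k' := Num.min 1 (k / K).
have k'0 : 0 < k' by rewrite lt_min ltr01 divr_gt0.
have k'1 : k' <= 1 by rewrite ge_min lexx.
have k'K : k' * K <= k by rewrite -ler_pdivlMr// ge_min lexx orbT.
have [rA rA0 hA] := nA _ k'0; have [rB rB0 hB] := nB _ k'0.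
have [tA tA0 gA] := sA _ k'0; have [tB tB0 gB] := sB _ k'0.
exists (Num.min (Num.min rA rB) (Num.min tA tB)); first by rewrite !lt_min rA0 rB0 tA0.
move=> r r0; rewrite !le_min => /andP[/andP[r1 r2] /andP[r3 r4]] v w v' w'.
rewrite !le_min.
move=> /andP[/andP[v1 v2] /andP[v3 v4]] /andP[/andP[w1 w2] /andP[w3 w4]].
move=> /andP[/andP[v1' v2'] /andP[v3' v4']] /andP[/andP[w1' w2'] /andP[w3' w4']].
have {}hA := hA r r0 r1 v' w' v1' w1'; have {}hB := hB r r0 r2 v w v2 w2.
have {}gA := gA r r0 r3 v w v' w' v3 w3 v3' w3'.
have {}gB := gB r r0 r4 v w v' w' v4 w4 v4' w4'.
have r0' := ltW r0.
set d := pnorm r (v - v') + pnorm r (w - w') in gA gB *; have d0 : 0 <= d by rewrite addr_ge0 ?pnorm_ge0.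
set LA := p *: (v - v') + q *: (w - w') in gA.
set LB := p' *: (v - v') + q' *: (w - w') in gB.
have lA : pnorm r LA <= (`|p| + `|q|) * d by exact: pnorm_lin.
have lB : pnorm r LB <= (`|p'| + `|q'|) * d by exact: pnorm_lin.
have -> : A v w * B v w - A v' w' * B v' w' -
    ((b * p + a * p') *: (v - v') + (b * q + a * q') *: (w - w')) =
    (LA * (B v w - C b) + (A v w - A v' w' - LA) * B v w) +
    ((A v' w' - C a) * LB + A v' w' * (B v w - B v' w' - LB)).
  have -> : (b * p + a * p') *: (v - v') + (b * q + a * q') *: (w - w') =
     C b * LA + C a * LB.
    rewrite /LA /LB !mul_mpolyC !scalerDr !scalerA !scalerDl; ring.
  ring.
have nB' := pnorm_near r0' hB; have nA' := pnorm_near r0' hA.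
have h1 : pnorm r (LA * (B v w - C b)) <= (`|p| + `|q|) * d * k'.
  by rewrite (le_trans (pnormM _ _ r0'))// ler_pM ?pnorm_ge0.
have h2 : pnorm r ((A v w - A v' w' - LA) * B v w) <= k' * d * (`|b| + k').
  by rewrite (le_trans (pnormM _ _ r0'))// ler_pM ?pnorm_ge0.
have h3 : pnorm r ((A v' w' - C a) * LB) <= k' * ((`|p'| + `|q'|) * d).
  by rewrite (le_trans (pnormM _ _ r0'))// ler_pM ?pnorm_ge0.
have h4 : pnorm r (A v' w' * (B v w - B v' w' - LB)) <= (`|a| + k') * (k' * d).
  by rewrite (le_trans (pnormM _ _ r0'))// ler_pM ?pnorm_ge0.
rewrite (le_trans (pnormD _ _ r0'))//.
apply: le_trans (lerD (le_trans (pnormD _ _ r0') (lerD h1 h2))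
  (le_trans (pnormD _ _ r0') (lerD h3 h4))) _.
apply: (@le_trans _ _ (k' * K * d)); last by rewrite ler_wpM2r.
rewrite [X in X <= _](_ : _ = k' * (`|a| + `|b| + (`|p| + `|q|) + (`|p'| + `|q'|) + k' + k') * d); last by ring.
by rewrite ler_wpM2r// ler_wpM2l ?(ltW k'0)// /K; lra.
Qed.

Lemma goodX A a p q n : good A a p q ->
  good (fun v w => A v w ^+ n) (a ^+ n) (n%:R * a ^+ n.-1 * p) (n%:R * a ^+ n.-1 * q).
Proof.
move=> gA; elim: n => [|n ih].
  by rewrite expr0 !mul0r; have := good_const 1; rewrite mpolyC1.
have h := goodM gA ih.
have E (x : R) : a ^+ n * x + a * (n%:R * a ^+ n.-1 * x) = n.+1%:R * a ^+ n.+1.-1 * x.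
  by rewrite -natr1; case: n {ih h} => [|n] /=; rewrite ?exprS; ring.
rewrite !E -exprS in h.
rewrite (_ : (fun v w => A v w ^+ n.+1) = (fun v w => A v w * A v w ^+ n))//.
by apply/funext => v; apply/funext => w; rewrite exprS.
Qed.

Lemma good_sum (I : Type) (s : seq I) (A : I -> MP -> MP -> MP) (a p q : I -> R) :
  (forall i, good (A i) (a i) (p i) (q i)) ->
  good (fun v w => \sum_(i <- s) A i v w) (\sum_(i <- s) a i) (\sum_(i <- s) p i)
    (\sum_(i <- s) q i).
Proof.
move=> gA; elim: s => [|i s ih].
  rewrite !big_nil; have := good_const 0; rewrite mpolyC0.
  suff -> : (fun v w => \sum_(i <- [::]) A i v w) = (fun _ _ => 0) by [].
  by apply/funext => v; apply/funext => w; rewrite big_nil.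
rewrite !big_cons.
suff -> : (fun v w => \sum_(j <- i :: s) A j v w) =
  (fun v w => A i v w + \sum_(j <- s) A j v w) by exact: goodD.
by apply/funext => v; apply/funext => w; rewrite big_cons.
Qed.

(** The derivatives enter through equations so that the preconditioned map can be given exactly (-1,
    0) or (0, -1), which cancels the derivative of the identity in the Picard map. *)
Lemma good_precond A B c d p q p' q' j k : good A 0 p q -> good B 0 p' q' ->
  c = - (j * p + k * p') -> d = - (j * q + k * q') ->
  good (fun v w => - (j *: A v w + k *: B v w)) 0 c d.
Proof.
move=> gA gB -> ->.
have gj := goodM (good_const (- j)) gA; have gk := goodM (good_const (- k)) gB.
have := goodD gj gk; rewrite !(mulr0, mul0r, addr0, add0r).
rewrite !mulNr -!opprD.
suff -> : (fun v w => - (j *: A v w + k *: B v w)) =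
  (fun v w => C (- j) * A v w + C (- k) * B v w) by [].
by apply/funext => v; apply/funext => w; rewrite !mul_mpolyC !scaleNr opprD.
Qed.

(* Picard iteration for the pair of equations preconditioned by the inverse
   Jacobian, carried out on polynomials with the weighted l1 norm. *)
Lemma poly_ift A1 A2 (G1 G2 : 'rV[R]_m -> R -> R -> R) (p1 q1 p2 q2 t0 s0 e : R) :
  good A1 0 p1 q1 -> good A2 0 p2 q2 -> p1 * q2 - p2 * q1 != 0 -> 0 < e ->
  (forall (y : 'rV[R]_m) v w, meval (y 0) (A1 v w) =
     G1 y (t0 + meval (y 0) v) (s0 + meval (y 0) w)) ->
  (forall (y : 'rV[R]_m) v w, meval (y 0) (A2 v w) =
     G2 y (t0 + meval (y 0) v) (s0 + meval (y 0) w)) ->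
  (forall y (t s : nat -> R) (t_ s_ : R), t @ \oo --> t_ -> s @ \oo --> s_ ->
     G1 y (t k) (s k) @[k --> \oo] --> G1 y t_ s_) ->
  (forall y (t s : nat -> R) (t_ s_ : R), t @ \oo --> t_ -> s @ \oo --> s_ ->
     G2 y (t k) (s k) @[k --> \oo] --> G2 y t_ s_) ->
  exists (r : R) (g h : 'rV[R]_m -> R), [/\ 0 < r,
    (forall y0, real_analytic_at (fun x => g (x - y0)) y0) &
    forall y : 'rV[R]_m, (forall i, `|y 0 i| <= r) ->
      [/\ `|g y - t0| <= e, `|h y - s0| <= e, G1 y (g y) (h y) = 0 &
         G2 y (g y) (h y) = 0]].
Proof.
move=> g1 g2; set D := p1 * q2 - p2 * q1 => D0 e0 E1 E2 cG1 cG2.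
(* Identity minus inverse Jacobian times (A1, A2): the strict derivative at the origin is 0, so the
   map contracts near it. *)
pose B1 v w := v - ((q2 / D) *: A1 v w + (- q1 / D) *: A2 v w).
pose B2 v w := w - ((- p2 / D) *: A1 v w + (p1 / D) *: A2 v w).
have gB1 : good B1 0 0 0.
  have := goodD good_fst (@good_precond _ _ (-1) 0 _ _ _ _ (q2 / D) (- q1 / D) g1 g2 _ _).
  by rewrite addr0 subrr; apply; rewrite /D; field.
have gB2 : good B2 0 0 0.
  have := goodD good_snd (@good_precond _ _ 0 (-1) _ _ _ _ (- p2 / D) (p1 / D) g1 g2 _ _).
  by rewrite addr0 subrr; apply; rewrite /D; field.
(* Constant 1/4 for each component makes the pair a contraction with constant 1/2 for the sum of the
   norms. *)
have q40 : 0 < 4^-1 :> R by rewrite invr_gt0.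
have [r1 r10 c1] := gB1.2 _ q40; have [r2 r20 c2] := gB2.2 _ q40.
pose dl := Num.min e (Num.min r1 r2).
have dl0 : 0 < dl by rewrite !lt_min e0 r10.
have dl40 : 0 < dl / 4 by rewrite divr_gt0.
have [r3 r30 n1] := gB1.1 _ dl40; have [r4 r40 n2] := gB2.1 _ dl40.
pose r := Num.min (Num.min r1 r2) (Num.min r3 r4).
have r0 : 0 < r by rewrite !lt_min r10 r20 r30.
have r0' := ltW r0.
have [rr1 rr2 rr3 rr4] : [/\ r <= r1, r <= r2, r <= r3 & r <= r4].
  by split; rewrite /r !ge_min lexx ?orbT.
have [de d1 d2] : [/\ dl <= e, dl <= r1 & dl <= r2].
  by split; rewrite /dl !ge_min lexx ?orbT.
pose dist (x y : MP * MP) := pnorm r (x.1 - y.1) + pnorm r (x.2 - y.2).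
pose Phi (x : MP * MP) := (B1 x.1 x.2, B2 x.1 x.2).
pose X k := iter k Phi (0, 0).
pose nm (x : MP * MP) := pnorm r x.1 + pnorm r x.2.
have nm1 x : pnorm r x.1 <= nm x by rewrite lerDl pnorm_ge0.
have nm2 x : pnorm r x.2 <= nm x by rewrite lerDr pnorm_ge0.
have contr x y : nm x <= dl -> nm y <= dl -> dist (Phi x) (Phi y) <= 2^-1 * dist x y.
  move=> xd yd.
  have h1 := c1 r r0 rr1 x.1 x.2 y.1 y.2 (le_trans (nm1 x) (le_trans xd d1))
    (le_trans (nm2 x) (le_trans xd d1)) (le_trans (nm1 y) (le_trans yd d1))
    (le_trans (nm2 y) (le_trans yd d1)).
  have h2 := c2 r r0 rr2 x.1 x.2 y.1 y.2 (le_trans (nm1 x) (le_trans xd d2))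
    (le_trans (nm2 x) (le_trans xd d2)) (le_trans (nm1 y) (le_trans yd d2))
    (le_trans (nm2 y) (le_trans yd d2)).
  move: h1 h2; rewrite !scale0r addr0 !subr0 => h1 h2.
  rewrite /dist /=; apply: le_trans (lerD h1 h2) _.
  rewrite -/(dist x y) -mulrDl; suff -> : 4^-1 + 4^-1 = 2^-1 :> R by [].
  by field.
have X1 : dist (X 1%N) (X 0%N) <= dl / 2.
  rewrite /dist /= !subr0.
  have h1 := n1 r r0 rr3 0 0; have h2 := n2 r r0 rr4 0 0.
  rewrite !pnorm0 (ltW r30) in h1; rewrite !pnorm0 (ltW r40) in h2.
  have {}h1 := h1 isT isT; have {}h2 := h2 isT isT.
  rewrite mpolyC0 subr0 in h1; rewrite mpolyC0 subr0 in h2.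
  apply: le_trans (lerD h1 h2) _; lra.
(* The iterates remain in the ball of radius [dl], where the contraction holds: steps of size (dl/2)
   2^-k add up to at most dl (1 - 2^-k). *)
have XD k : nm (X k) <= dl * (1 - 2^-1 ^+ k) /\
    dist (X k.+1) (X k) <= dl / 2 * 2^-1 ^+ k.
  elim: k => [|k [ih1 ih2]].
    by rewrite expr0 subrr mulr0 mulr1; split => //; rewrite /nm /= !pnorm0 addr0.
  have h1 : nm (X k.+1) <= dl * (1 - 2^-1 ^+ k.+1).
    have : nm (X k.+1) <= nm (X k) + dist (X k.+1) (X k).
      rewrite /nm /dist addrACA; apply: lerD.
        by rewrite -{1}[(X k.+1).1](subrK (X k).1) addrC pnormD.
      by rewrite -{1}[(X k.+1).2](subrK (X k).2) addrC pnormD.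
    move=> /le_trans; apply; apply: le_trans (lerD ih1 ih2) _.
    by rewrite le_eqVlt; apply/orP; left; apply/eqP; rewrite exprS; field.
  split => //.
  have half j : dl * (1 - 2^-1 ^+ j) <= dl.
    by rewrite ler_piMr ?(ltW dl0)// gerBl exprn_ge0// invr_ge0.
  have := contr _ _ (le_trans h1 (half _)) (le_trans ih1 (half _)).
  move=> /le_trans; apply; rewrite exprS mulrCA ler_wpM2l// invr_ge0//.
have nmX k : nm (X k) <= dl.
  have [h _] := XD k; apply: le_trans h _.
  by rewrite ler_piMr ?(ltW dl0)// gerBl exprn_ge0// invr_ge0.
have X1M k : pnorm r ((C t0 + (X k.+1).1) - (C t0 + (X k).1)) <= dl / 2 * 2^-1 ^+ k.
  have [_ h] := XD k; apply: le_trans h.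
  by rewrite opprD addrACA subrr add0r lerDl pnorm_ge0.
have X2M k : pnorm r ((C s0 + (X k.+1).2) - (C s0 + (X k).2)) <= dl / 2 * 2^-1 ^+ k.
  have [_ h] := XD k; apply: le_trans h.
  by rewrite opprD addrACA subrr add0r lerDr pnorm_ge0.
have [g [cg ag]] := @poly_limit_analytic R m (fun k => C t0 + (X k).1) r (dl / 2) r0 X1M.
have [h [ch _]] := @poly_limit_analytic R m (fun k => C s0 + (X k).2) r (dl / 2) r0 X2M.
exists r, g, h; split => // y yr.
have mE a (v : MP) : meval (y 0) (C a + v) = a + meval (y 0) v.
  by rewrite mevalD mevalC.
have {}cg := cg y yr; have {}ch := ch y yr.
have bnd a (u : nat -> MP) (l : R) : meval (y 0) (C a + u k) @[k --> \oo] --> l ->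
    (forall k, pnorm r (u k) <= dl) -> `|l - a| <= e.
  move=> cu ub; have cu' : `|meval (y 0) (C a + u k) - a| @[k --> \oo] --> `|l - a|.
    by apply: cvg_norm; apply: cvgB => //; exact: cvg_cst.
  apply: (ler_cvg_to cu' (cvg_cst e)); apply: nearW => k.
  by rewrite mE addrAC subrr add0r (le_trans (pnorm_meval _ yr))// (le_trans (ub k)).
(* Along the iteration the preconditioned equations take the values [X k - X k.+1], which tend to
   0. *)
have S1 : q2 / D * G1 y (g y) (h y) + - q1 / D * G2 y (g y) (h y) = 0 /\
          - p2 / D * G1 y (g y) (h y) + p1 / D * G2 y (g y) (h y) = 0.
  have cF (j1 j2 : R) : j1 * G1 y (meval (y 0) (C t0 + (X k).1)) (meval (y 0) (C s0 + (X k).2)) +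
      j2 * G2 y (meval (y 0) (C t0 + (X k).1)) (meval (y 0) (C s0 + (X k).2)) @[k --> \oo] -->
      j1 * G1 y (g y) (h y) + j2 * G2 y (g y) (h y).
    by apply: cvgD; apply: cvgM; [exact: cvg_cst|exact: cG1|exact: cvg_cst|exact: cG2].
  have cd (u : nat -> R) (l : R) : u @ \oo --> l -> u k - u k.+1 @[k --> \oo] --> (0 : R).
    by move=> cu; rewrite -[X in _ --> X](subrr l); apply: cvgB => //; rewrite cvg_shiftS.
  split.
    have := cF (q2 / D) (- q1 / D); move=> /(cvg_unique (@Rhausdorff R)); apply.
    apply: cvg_trans (cd _ _ cg); apply: near_eq_cvg; apply: nearW => k.
    by rewrite /X iterS -/(X k) /= /B1 !mE mevalB mevalD !mevalZ E1 E2; ring.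
  have := cF (- p2 / D) (p1 / D); move=> /(cvg_unique (@Rhausdorff R)); apply.
  apply: cvg_trans (cd _ _ ch); apply: near_eq_cvg; apply: nearW => k.
  by rewrite /X iterS -/(X k) /= /B2 !mE mevalB mevalD !mevalZ E1 E2; ring.
have [e1 e2] := S1; split.
- by apply: (bnd _ _ _ cg) => k; exact: le_trans (nm1 _) (nmX k).
- by apply: (bnd _ _ _ ch) => k; exact: le_trans (nm2 _) (nmX k).
(* Multiplying by the Jacobian matrix undoes the preconditioning. *)
- transitivity (p1 * (q2 / D * G1 y (g y) (h y) + - q1 / D * G2 y (g y) (h y)) +
    q1 * (- p2 / D * G1 y (g y) (h y) + p1 / D * G2 y (g y) (h y))).
    by rewrite /D; field.
  by rewrite e1 e2 !mulr0 addr0.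
- transitivity (p2 * (q2 / D * G1 y (g y) (h y) + - q1 / D * G2 y (g y) (h y)) +
    q2 * (- p2 / D * G1 y (g y) (h y) + p1 / D * G2 y (g y) (h y))).
    by rewrite /D; field.
  by rewrite e1 e2 !mulr0 addr0.
Qed.

End ift.

(** * Euclidean geometry *)

Section euclid.
Context {R : realType} {n : nat}.
Implicit Types (x y z c : 'rV[R]_n) (a t : R).

Lemma dotvC x y : dotv x y = dotv y x.
Proof. by apply: eq_bigr => i _; rewrite mulrC. Qed.

Lemma dotvDl x y z : dotv (x + y) z = dotv x z + dotv y z.
Proof. by rewrite /dotv -big_split/=; apply: eq_bigr => i _; rewrite mxE mulrDl. Qed.

Lemma dotvZl a x z : dotv (a *: x) z = a * dotv x z.
Proof. by rewrite /dotv mulr_sumr; apply: eq_bigr => i _; rewrite mxE mulrA. Qed.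

Lemma dotvDr x y z : dotv z (x + y) = dotv z x + dotv z y.
Proof. by rewrite dotvC dotvDl !(dotvC z). Qed.

Lemma dotvZr a x z : dotv z (a *: x) = a * dotv z x.
Proof. by rewrite dotvC dotvZl (dotvC z). Qed.

Lemma dotvNl x z : dotv (- x) z = - dotv x z.
Proof. by rewrite -scaleN1r dotvZl mulN1r. Qed.

Lemma dotvNr x z : dotv z (- x) = - dotv z x.
Proof. by rewrite -scaleN1r dotvZr mulN1r. Qed.

Lemma dotv_ge0 x : 0 <= dotv x x.
Proof. by apply: sumr_ge0 => i _; rewrite -expr2 sqr_ge0. Qed.

Lemma dotv_eq0 x : (dotv x x == 0) = (x == 0).
Proof.
apply/eqP/eqP => [/eqP|->]; last by apply: big1 => i _; rewrite mxE mul0r.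
rewrite psumr_eq0 => [/allP h|i _]; last by rewrite -expr2 sqr_ge0.
apply/rowP => i; rewrite mxE; have := h i (mem_index_enum i).
by rewrite /= mulf_eq0 => /orP[]/eqP.
Qed.

Lemma sqr_enorm x : enorm x ^+ 2 = dotv x x.
Proof. by rewrite sqr_sqrtr ?dotv_ge0. Qed.

Lemma enorm_ge0 x : 0 <= enorm x. Proof. exact: sqrtr_ge0. Qed.

Lemma enorm_eq0 x : (enorm x == 0) = (x == 0).
Proof. by rewrite -dotv_eq0 -sqr_enorm sqrf_eq0. Qed.

Lemma enorm_gt0 x : (0 < enorm x) = (x != 0).
Proof. by rewrite lt_def enorm_eq0 enorm_ge0 andbT. Qed.

Lemma enorm0 : enorm (0 : 'rV[R]_n) = 0.
Proof. by apply/eqP; rewrite enorm_eq0. Qed.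

Lemma enormZ a x : enorm (a *: x) = `|a| * enorm x.
Proof.
by rewrite /enorm dotvZl dotvZr mulrA -expr2 sqrtrM ?sqr_ge0// sqrtr_sqr.
Qed.

Lemma enormN x : enorm (- x) = enorm x.
Proof. by rewrite -scaleN1r enormZ normrN1 mul1r. Qed.

Lemma enormBC x y : enorm (x - y) = enorm (y - x).
Proof. by rewrite -enormN opprB. Qed.

Lemma dotv_le x y : `|dotv x y| <= enorm x * enorm y.
Proof.
have h : dotv x y ^+ 2 <= dotv x x * dotv y y.
  have [->|y0] := eqVneq y 0.
    by rewrite -(scale0r 0) !dotvZr !mul0r mulr0 expr0n.
  have yy : 0 < dotv y y by rewrite lt_def dotv_eq0 y0 dotv_ge0.
  have := dotv_ge0 (dotv y y *: x - dotv x y *: y).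
  have -> : dotv (dotv y y *: x - dotv x y *: y) (dotv y y *: x - dotv x y *: y) =
     dotv y y * (dotv x x * dotv y y - dotv x y ^+ 2).
    by rewrite !(dotvDl, dotvDr, dotvNl, dotvNr, dotvZl, dotvZr) (dotvC y x); ring.
  by rewrite pmulr_rge0// subr_ge0.
rewrite -(@ler_pXn2r _ 2) ?nnegrE ?mulr_ge0 ?enorm_ge0//.
by rewrite exprMn !sqr_enorm real_normK ?num_real.
Qed.

Lemma enormD x y : enorm (x + y) <= enorm x + enorm y.
Proof.
rewrite -(@ler_pXn2r _ 2) ?nnegrE ?addr_ge0 ?enorm_ge0//.
rewrite sqrrD !sqr_enorm !(dotvDl, dotvDr) (dotvC y x).
have := dotv_le x y; have := ler_norm (dotv x y); lra.
Qed.

Lemma enormB_ge x y : enorm x - enorm y <= enorm (x - y).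
Proof. by rewrite lerBlDr (le_trans _ (enormD _ _))// subrK. Qed.

Lemma enorm_dist x y : `|enorm x - enorm y| <= enorm (x - y).
Proof.
by rewrite ler_norml enormB_ge andbT lerNl opprB enormBC enormB_ge.
Qed.

Lemma coord_le_enorm x i : `|x 0 i| <= enorm x.
Proof.
rewrite -(@ler_pXn2r _ 2) ?nnegrE ?enorm_ge0// sqr_enorm real_normK ?num_real//.
rewrite /dotv (bigD1 i)//= -expr2 lerDl.
by apply: sumr_ge0 => j _; rewrite -expr2 sqr_ge0.
Qed.

Lemma mx_norm_le_enorm x : `|x| <= enorm x.
Proof.
rewrite [leLHS]/Num.norm/= mx_normrE; apply/bigmax_leP; split; first exact: enorm_ge0.
by move=> [i j] _ /=; rewrite (ord1 i) coord_le_enorm.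
Qed.

Lemma dotv_continuous c : continuous (fun x => dotv (x - c) (x - c)).
Proof.
have : Ck 0 setT (fun x => dotv (x - c) (x - c)).
  apply: Ck_sum => [|i]; first exact: openT.
  have h : Ck 0 setT (fun x => (x - c) 0 i).
    rewrite (_ : (fun x => _) = (fun x => x 0 i + cst (- c 0 i) x)).
      by apply: Ck_add; [exact: openT|exact: Ck_coord|exact: Ck_cst].
    by apply/funext => x; rewrite !mxE.
  by apply: Ck_mul => //; exact: openT.
by move=> [h _] x; exact: h.
Qed.

Lemma enorm_continuous c : continuous (fun x => enorm (x - c)).
Proof.
move=> x; apply: (continuous_comp (@dotv_continuous c x)); exact: sqrt_continuous.
Qed.

Lemma open_lt_continuous (f : 'rV[R]_n -> R) a : continuous f -> open [set x | f x < a].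
Proof.
move=> cf; rewrite (_ : [set x | _] = f @^-1` [set t | t < a])//.
by apply: open_comp => [x _|]; [exact: cf|exact: open_lt].
Qed.

Lemma closed_le_continuous (f : 'rV[R]_n -> R) a : continuous f -> closed [set x | f x <= a].
Proof.
move=> cf; rewrite (_ : [set x | _] = f @^-1` [set t | t <= a])//.
by apply: preimage_closed => [x _|]; [exact: cf|exact: closed_le].
Qed.

Lemma open_eball c a : open (eball c a).
Proof. by apply: open_lt_continuous; exact: enorm_continuous. Qed.

Lemma bounded_eball c a : bounded_set (eball c a).
Proof.
exists (enorm c + a); split; first exact: num_real.
move=> M /ltW aM x /= xa; rewrite (le_trans (mx_norm_le_enorm x))//.
apply: le_trans aM; rewrite -[x](subrK c) addrC (le_trans (enormD _ _))//.
by rewrite lerD2l ltW.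
Qed.

Lemma closure_eball c a : 0 < a -> closure (eball c a) = [set x | enorm (x - c) <= a].
Proof.
move=> a0; apply/seteqP; split.
  move=> x cx; apply: (@closed_le_continuous (fun x => enorm (x - c)) a).
    exact: enorm_continuous.
  by apply: closure_subset cx => y; exact: ltW.
move=> x /= xa B /nbhs_ballP[e /= e0 xeB].
pose t : R := Num.min (2^-1) (e / (2 * (a + 1))).
have a10 : 0 < a + 1 by rewrite addr_gt0.
have t0 : 0 < t by rewrite lt_min invr_gt0 ltr0n/= divr_gt0// mulr_gt0.
have t1 : t <= 2^-1 by rewrite ge_min lexx.
have te : t * (a + 1) < e.
  have : t <= e / (2 * (a + 1)) by rewrite ge_min lexx orbT.
  rewrite ler_pdivlMr ?mulr_gt0//; nra.
exists (x - t *: (x - c)); split.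
  rewrite /eball /= (_ : _ - c = (1 - t) *: (x - c)); last first.
    by rewrite scalerBl scale1r addrAC.
  rewrite enormZ ger0_norm; last by lra.
  have := enorm_ge0 (x - c); nra.
apply: xeB; rewrite mx_norm_ball /ball_/= opprB addrC subrK.
rewrite (le_lt_trans (mx_norm_le_enorm _))// enormZ (ger0_norm (ltW t0)).
have := enorm_ge0 (x - c); nra.
Qed.

Lemma bdry_open (A : set 'rV[R]_n) : open A -> bdry A = closure A `\` A.
Proof. by move=> oA; rewrite /bdry (interior_id _).1. Qed.

Lemma bdry_eball c a : 0 < a -> bdry (eball c a) = [set x | enorm (x - c) = a].
Proof.
move=> a0; rewrite bdry_open; last exact: open_eball.
rewrite closure_eball//; apply/seteqP; split => x /=.
  by move=> [xa /negP]; rewrite -leNgt => ax; apply/eqP; rewrite eq_le xa.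
by move=> <-; split => //; rewrite /eball/= ltxx.
Qed.

(** A connected subset replaces a path, so that transitivity is a union of sets and no paths are
    concatenated. *)
Definition joined (A : set 'rV[R]_n) x y : Prop :=
  exists K, [/\ K `<=` A, connected K, K x & K y].

Lemma joined_trans (A : set 'rV[R]_n) y x z : joined A x y -> joined A y z -> joined A x z.
Proof.
move=> [K [KA cK Kx Ky]] [K' [KA' cK' Ky' Kz]]; exists (K `|` K'); split.
- by move=> w [/KA|/KA'].
- by apply: connectedU => //; exists y.
- by left.
- by right.
Qed.

Lemma joined_sym (A : set 'rV[R]_n) x y : joined A x y -> joined A y x.
Proof. by move=> [K [KA cK Kx Ky]]; exists K. Qed.

Lemma joined_connected (A : set 'rV[R]_n) x : (forall y, A y -> joined A x y) -> connected A.
Proof.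
move=> h; pose K y := if pselect (A y) is left Ay then sval (cid (h y Ay)) else set0.
have KP y : A y -> [/\ K y `<=` A, connected (K y), K y x & K y y].
  by move=> Ay; rewrite /K; case: pselect => // Ay'; case: cid.
have -> : A = \bigcup_(y in A) K y.
  apply/seteqP; split => [y Ay|y [z Az]]; first by exists y => //; have [] := KP y Ay.
  by have [KA _ _ _] := KP z Az; exact: KA.
apply: bigcup_connected; last by move=> y Ay; have [] := KP y Ay.
by exists x => y Ay; have [] := KP y Ay.
Qed.

Lemma joined_path (A : set 'rV[R]_n) (f : R -> 'rV[R]_n) :
  (forall t, 0 <= t <= 1 -> {for t, continuous f}) ->
  (forall t, 0 <= t <= 1 -> A (f t)) -> joined A (f 0) (f 1).
Proof.
move=> cf Af; exists (f @` `[0, 1]%classic); split.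
- by move=> _ [t /= + <-]; rewrite in_itv => /Af.
- apply: connected_continuous_connected; first exact: segment_connected.
  by apply: continuous_in_subspaceT => t; rewrite inE /= in_itv => /cf.
- by exists 0 => //=; rewrite in_itv/= lexx ler01.
- by exists 1 => //=; rewrite in_itv/= lexx ler01.
Qed.

Lemma line_continuous x y : continuous (fun t : R => x + t *: y).
Proof.
move=> t; apply: cvgD; first exact: cvg_cst.
by apply: cvgZ; [exact: cvg_id|exact: cvg_cst].
Qed.

Lemma joined_segment (A : set 'rV[R]_n) x y :
  (forall t, 0 <= t <= 1 -> A (x + t *: (y - x))) -> joined A x y.
Proof.
move=> h; have := @joined_path A (fun t => x + t *: (y - x)) _ h.
rewrite scale0r scale1r addr0 [x + _]addrC subrK; apply => t _.
exact: line_continuous.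
Qed.

Lemma connected_eball c a : connected (eball c a).
Proof.
have [a0|a0] := leP a 0.
  rewrite (_ : eball c a = set0); first exact: connected0.
  apply/seteqP; split => // x /=; rewrite /eball/= => /lt_le_trans /(_ a0).
  by rewrite ltNge enorm_ge0.
apply: (@joined_connected _ c) => x xa; apply: joined_segment => t /andP[t0 t1].
rewrite /eball/= addrC addKr enormZ ger0_norm//; move: xa; rewrite /eball/=.
have := enorm_ge0 (x - c); nra.
Qed.

End euclid.

Section sphere.
Context {R : realType} {n : nat}.
Implicit Types (x y z c : 'rV[R]_n.+2) (a t : R).

(** Two points that are not antipodal are joined by the radial projection of their segment, which
    misses the centre. The antipode of the base point is reached through the end of a second
    coordinate axis, antipodal to neither. *)
Lemma connected_sphere c a : 0 < a -> connected [set x | enorm (x - c) = a].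
Proof.
move=> a0; set S := [set x | _].
have near_joined x y : S x -> S y -> y - c != - (x - c) -> joined S x y.
  rewrite /S/= => xa ya xy.
  pose v t := (x - c) + t *: (y - x).
  have vE t : v t = (1 - t) *: (x - c) + t *: (y - c).
    rewrite /v (_ : y - x = (y - c) - (x - c)); last by rewrite opprB addrA subrK.
    by rewrite scalerBr scalerBl scale1r addrA addrAC.
  (* If the segment met the centre, equality of the norms would force t = 1/2, hence antipodal
     points. *)
  have v0 t : 0 <= t <= 1 -> v t != 0.
    move=> /andP[t0 t1]; apply: contra xy => /eqP; rewrite vE => /eqP.
    rewrite addr_eq0 => /eqP h.
    have := congr1 (@enorm R _) h; rewrite enormN !enormZ xa ya !ger0_norm// ?subr_ge0//.
    move=> /(mulIf (lt0r_neq0 a0)) h1; have th : t = 2^-1 by lra.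
    move: h; rewrite h1 th -scalerN => /scalerI h.
    by rewrite h ?opprK// invr_eq0 pnatr_eq0.
  pose f t := c + (a / enorm (v t)) *: v t.
  have := @joined_path R _ S f _ _.
  have -> : f 0 = x.
    by rewrite /f /v scale0r addr0 xa divff ?gt_eqF// scale1r addrC subrK.
  have -> : f 1 = y.
    have -> : f 1 = c + (a / enorm (y - c)) *: (y - c).
      by rewrite /f vE subrr scale0r add0r scale1r.
    by rewrite ya divff ?gt_eqF// scale1r addrC subrK.
  apply => t t01.
    apply: cvgD; first exact: cvg_cst.
    have cv : {for t, continuous v} by exact: line_continuous.
    apply: cvgZ => //; apply: cvgM; first exact: cvg_cst.
    apply: cvgV; first by rewrite enorm_eq0 v0.
    have ce := @enorm_continuous R n.+2 0 (v t).
    have := continuous_comp cv ce.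
    by under [X in {for _, continuous X}]eq_fun do rewrite /= subr0.
  rewrite /S /f /= [c + _]addrC addrK enormZ ger0_norm ?divr_ge0 ?enorm_ge0 ?(ltW a0)//.
  by rewrite divfK// enorm_eq0 v0.
pose b i : 'rV[R]_n.+2 := c + a *: delta_mx 0 i.
have db i j : dotv (delta_mx 0 i : 'rV[R]_n.+2) (delta_mx 0 j) = (i == j)%:R.
  rewrite /dotv (bigD1 i)//= big1 => [|k ki].
    by rewrite !mxE !eqxx mul1r addr0.
  by rewrite mxE (negbTE ki) andbF mul0r.
have Sb i : S (b i).
  by rewrite /S /b /= addrC addKr enormZ (gtr0_norm a0) /enorm db eqxx sqrtr1 mulr1.
apply: (@joined_connected _ _ _ (b ord0)) => y Sy.
have [y0|] := eqVneq (y - c) (- (b ord0 - c)); last exact: near_joined.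
have ab : a *: delta_mx 0 ord0 != a *: delta_mx 0 (lift ord0 ord0) :> 'rV[R]_n.+2.
  apply/eqP => /rowP/(_ ord0); rewrite !mxE/= mulr1 mulr0 => /eqP.
  by rewrite gt_eqF.
have ab' : a *: delta_mx 0 (lift ord0 ord0) != - (a *: delta_mx 0 ord0) :> 'rV[R]_n.+2.
  apply/eqP => /rowP/(_ ord0); rewrite !mxE/= mulr1 mulr0 => /eqP.
  by rewrite eq_sym oppr_eq0 gt_eqF.
apply: (@joined_trans _ _ _ (b (lift ord0 ord0))); apply: near_joined => //.
  by rewrite /b ![c + _]addrC !addrK.
by rewrite y0 /b ![c + _]addrC !addrK eqr_opp.
Qed.

End sphere.

Section frame.
Context {R : realType} {n : nat}.

(* The Householder reflection that exchanges e and e_0. *)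
Lemma reflection_exists (e : 'cV[R]_n.+1) : e^T *m e = 1%:M ->
  exists Q : 'M[R]_n.+1, [/\ Q^T = Q, Q *m Q = 1%:M & col 0 Q = e].
Proof.
move=> ee; pose e0 : 'cV[R]_n.+1 := delta_mx 0 0.
have [->|ene0] := eqVneq e e0.
  exists 1%:M; rewrite trmx1 mulmx1; split => //.
  by apply/colP => i; rewrite !mxE eqxx andbT.
pose v := e - e0; pose q := (v^T *m v) 0 0.
have vv : v^T *m v = q%:M by rewrite /q {1}(mx11_scalar (v^T *m v)).
have e0e0 : e0^T *m e0 = 1%:M.
  by rewrite /e0 trmx_delta mul_delta_mx; apply/matrixP => i j; rewrite !mxE !ord1 !eqxx.
have e0e : e^T *m e0 = (e 0 0)%:M.
  apply/matrixP => i j; rewrite !ord1 !mxE (bigD1 0)//= big1 => [|k k0].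
    by rewrite !mxE !eqxx mulr1 addr0 mulr1n.
  by rewrite !mxE (negbTE k0) mulr0.
have ee0 : e0^T *m e = (e 0 0)%:M.
  by rewrite -[LHS]trmxK trmx_mul trmxK e0e tr_scalar_mx.
have vT : v^T = e^T - e0^T by rewrite /v linearB.
have qE : q = 2 * (1 - e 0 0).
  rewrite /q vT /v mulmxBl !mulmxBr ee e0e0 e0e ee0 !mxE !eqxx !mulr1n; ring.
have q0 : q != 0.
  apply: contra ene0 => /eqP q0; rewrite -subr_eq0 -/v; apply/eqP/colP => i.
  have : q = \sum_i v i 0 ^+ 2.
    by rewrite /q mxE; apply: eq_bigr => j _; rewrite [_^T _ _]mxE expr2.
  rewrite q0 => /esym/eqP; rewrite psumr_eq0 => [/allP/(_ i (mem_index_enum i))|j _].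
    by rewrite /= sqrf_eq0 => /eqP ->; rewrite [RHS]mxE.
  exact: sqr_ge0.
pose Q := 1%:M - (2 / q) *: (v *m v^T); exists Q; split.
- by rewrite /Q linearB/= linearZ/= trmx1 trmx_mul trmxK.
- rewrite /Q mulmxBl mul1mx mulmxBr mulmx1 -scalemxAl -scalemxAr.
  rewrite -!mulmxA (mulmxA v^T) vv mul_scalar_mx -scalemxAr !scalerA.
  rewrite (_ : 2 / q * (2 / q * q) = 2 / q + 2 / q); last by field.
  by rewrite scalerDl [X in _ - (_ + X)]opprD [X in _ - X]addrA subrr add0r opprK subrK.
- rewrite colE -/e0 /Q mulmxBl mul1mx -scalemxAl -mulmxA.
  have -> : v^T *m e0 = (e 0 0 - 1)%:M.
    by rewrite vT mulmxBl e0e e0e0 -raddfB.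
  rewrite mul_mx_scalar scalerA (_ : 2 / q * _ = -1); last first.
    by move: q0; rewrite qE => q0; field; apply: contra q0 => /eqP->; rewrite mulr0.
  by rewrite scaleN1r opprK /v addrC subrK.
Qed.

(** The reflection is an orthogonal matrix with [e] as its column 0; its other columns form [P]. *)
Lemma frame_exists (e : 'cV[R]_n.+1) : e^T *m e = 1%:M ->
  exists P : 'M[R]_(n.+1, n),
    [/\ P *m P^T + e *m e^T = 1%:M, P^T *m P = 1%:M & P^T *m e = 0].
Proof.
move=> /reflection_exists[Q [QT QQ Qe]].
pose P : 'M[R]_(n.+1, n) := \matrix_(i, j) Q i (lift ord0 j); exists P.
have QTQ : Q^T *m Q = 1%:M by rewrite QT.
split.
- rewrite -QQ -{2}QT; apply/matrixP => i k; rewrite !mxE big_ord_recl/= big_ord0 addr0.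
  rewrite [RHS]big_ord_recl addrC -Qe !mxE; congr (_ + _).
  by apply: eq_bigr => j _; rewrite !mxE.
- apply/matrixP => i k; have /matrixP/(_ (lift ord0 i) (lift ord0 k)) := QTQ.
  rewrite !mxE (inj_eq (@lift_inj _ ord0)) => <-.
  by apply: eq_bigr => j _; rewrite !mxE.
- apply/matrixP => i k; have /matrixP/(_ (lift ord0 i) ord0) := QTQ.
  rewrite !mxE/= => h; rewrite -[RHS]h.
  by apply: eq_bigr => j _; rewrite -Qe !mxE.
Qed.

End frame.

(** * The explicit potential *)

Section potential.
Context {R : realType} {n : nat}.
Variables (c : 'rV[R]_n.+2) (r0 sc eps : R).
Local Notation N := n.+2.
Local Notation E x := (enorm (x - c)).

(* Hfun (E x) (x - c)_0 is harmonic for E x > r0, and continues (x - c)_0 / sc with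
   continuous flux across E x = r0. *)
Definition beta : R := (sc^-1 - 1) * r0 ^+ N / N%:R.
Definition alpha : R := sc^-1 - (sc^-1 - 1) / N%:R.
Definition Hfun (rho : R) : R := alpha + beta * rho ^- N.
(* A Lipschitz constant of x |-> Hfun (E x) (x - c)_0 on r0 <= E x <= 4 r0. *)
Definition Lip : R := `|alpha| + (1 + 4 * N%:R) * (`|beta| * r0 ^- N).
Definition sq (x : 'rV[R]_N) : R := dotv (x - c) (x - c).
Definition lfun (x : 'rV[R]_N) : R := eps * (x - c) 0 0.

(* The constants are chosen so that u = (E x ^ 2 - 4 r0 ^ 2) / 2 outside D0 if eps = 0. *)
Definition upot (x : 'rV[R]_N) : R :=
  (sq x - r0 ^+ 2) / (2 * sc) + (Num.max (sq x) (r0 ^+ 2) - r0 ^+ 2) * ((1 - sc^-1) / 2)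
  - 3 / 2 * r0 ^+ 2 - Hfun (Num.sqrt (Num.max (sq x) (r0 ^+ 2))) * lfun x.

Hypotheses (r00 : 0 < r0) (sc0 : 0 < sc) (eps0 : 0 < eps) (epsL : eps * Lip <= r0 / 8).

Let N0 : 0 < N%:R :> R. Proof. by rewrite ltr0n. Qed.
Let rN0 : 0 < r0 ^+ N. Proof. by rewrite exprn_gt0. Qed.
Let B0 : 0 <= `|beta| * r0 ^- N. Proof. by rewrite mulr_ge0// invr_ge0 ltW. Qed.

Lemma Hfun_r0 : Hfun r0 = sc^-1.
Proof.
rewrite /Hfun /alpha /beta.
have -> : (sc^-1 - 1) * r0 ^+ N / N%:R * r0 ^- N = (sc^-1 - 1) / N%:R.
  by field; rewrite !gt_eqF.
by rewrite subrK.
Qed.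

Lemma sqE x : sq x = E x ^+ 2. Proof. by rewrite sqr_enorm. Qed.

Lemma upot_out x : r0 <= E x ->
  upot x = (E x ^+ 2 - 4 * r0 ^+ 2) / 2 - Hfun (E x) * lfun x.
Proof.
move=> rx; rewrite /upot max_l; last first.
  by rewrite sqE ler_pXn2r// nnegrE ?enorm_ge0// ltW.
rewrite -[Num.sqrt _]/(E x) sqE; congr (_ - _); field; rewrite gt_eqF//.
Qed.

Lemma upot_in x : E x <= r0 ->
  upot x = (E x ^+ 2 - r0 ^+ 2) / (2 * sc) - 3 / 2 * r0 ^+ 2 - sc^-1 * lfun x.
Proof.
move=> rx; rewrite /upot max_r; last first.
  by rewrite sqE ler_pXn2r// nnegrE ?enorm_ge0// ltW.
by rewrite sqrtr_sqr (gtr0_norm r00) Hfun_r0 sqE subrr mul0r addr0.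
Qed.

Lemma expr_lip (a b M : R) k : `|a| <= M -> `|b| <= M ->
  `|a ^+ k.+1 - b ^+ k.+1| <= k.+1%:R * M ^+ k * `|a - b|.
Proof.
move=> aM bM; have M0 : 0 <= M by rewrite (le_trans _ aM).
elim: k => [|k ih]; first by rewrite !expr1 expr0 !mul1r.
have -> : a ^+ k.+2 - b ^+ k.+2 = a * (a ^+ k.+1 - b ^+ k.+1) + (a - b) * b ^+ k.+1.
  by rewrite [a ^+ k.+2]exprS [b ^+ k.+2]exprS; ring.
rewrite (le_trans (ler_normD _ _))// !normrM.
have h1 : `|a| * `|a ^+ k.+1 - b ^+ k.+1| <= M * (k.+1%:R * M ^+ k * `|a - b|).
  by rewrite ler_pM.
have h2 : `|a - b| * `|b ^+ k.+1| <= `|a - b| * M ^+ k.+1.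
  by rewrite ler_wpM2l// normrX lerXn2r ?nnegrE.
apply: le_trans (lerD h1 h2) _.
rewrite le_eqVlt; apply/orP; left; apply/eqP.
by rewrite -[k.+2%:R]natr1 exprS; ring.
Qed.

Lemma Hfun_le rho : r0 <= rho -> `|Hfun rho| <= `|alpha| + `|beta| * r0 ^- N.
Proof.
move=> rr; rewrite (le_trans (ler_normD _ _))// lerD2l normrM ler_wpM2l//.
have rho0 : 0 < rho := lt_le_trans r00 rr.
rewrite ger0_norm ?invr_ge0 ?exprn_ge0 ?(ltW rho0)// lef_pV2 ?posrE ?exprn_gt0//.
by rewrite ler_pXn2r// nnegrE ltW.
Qed.

(** In the variable 1/rho this is the Lipschitz bound of the N-th power on [0, 1/r0], combined with
    that of the inversion. *)
Lemma Hfun_lip rho rho' : r0 <= rho -> r0 <= rho' ->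
  `|Hfun rho - Hfun rho'| * r0 <= N%:R * (`|beta| * r0 ^- N) * `|rho - rho'|.
Proof.
move=> r1 r2; have p1 : 0 < rho := lt_le_trans r00 r1.
have p2 : 0 < rho' := lt_le_trans r00 r2.
have -> : Hfun rho - Hfun rho' = beta * (rho^-1 ^+ N - rho'^-1 ^+ N).
  by rewrite /Hfun !exprVn; ring.
have i1 : `|rho^-1| <= r0^-1 by rewrite gtr0_norm ?invr_gt0// lef_pV2.
have i2 : `|rho'^-1| <= r0^-1 by rewrite gtr0_norm ?invr_gt0// lef_pV2.
have h := expr_lip n.+1 i1 i2.
have hV : `|rho^-1 - rho'^-1| <= r0^-1 * r0^-1 * `|rho - rho'|.
  have -> : rho^-1 - rho'^-1 = rho^-1 * rho'^-1 * (rho' - rho).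
    by field; rewrite !gt_eqF.
  rewrite !normrM [`|rho' - _|]distrC ler_wpM2r// ler_pM//.
rewrite normrM.
have -> : N%:R * (`|beta| * r0 ^- N) * `|rho - rho'| =
   `|beta| * (N%:R * r0^-1 ^+ n.+1 * (r0^-1 * r0^-1 * `|rho - rho'|)) * r0.
  by rewrite -exprVn exprS; field; rewrite gt_eqF.
rewrite ler_wpM2r ?(ltW r00)// ler_wpM2l// (le_trans h)// ler_wpM2l//.
by rewrite mulr_ge0// exprn_ge0// invr_ge0 ltW.
Qed.

Let epsH : eps * (`|alpha| + `|beta| * r0 ^- N) <= r0 / 8.
Proof.
apply: le_trans epsL; rewrite ler_wpM2l ?(ltW eps0)// lerD2l ler_peMl// lerDl.
by rewrite mulr_ge0.
Qed.

Let coordB x i : `|(x - c) 0 i| <= E x. Proof. exact: coord_le_enorm. Qed.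

Lemma Hl_le rho x : r0 <= rho -> `|Hfun rho * lfun x| <= r0 / 8 * E x.
Proof.
move=> rr; rewrite /lfun mulrA normrM ler_pM ?coordB//.
rewrite normrM (gtr0_norm eps0) mulrC (le_trans _ epsH)//.
by rewrite ler_wpM2l ?(ltW eps0)// Hfun_le.
Qed.

(** At distance 3/2 r0 the unperturbed potential is -7/8 r0^2, against a perturbation of at most
    3/16 r0^2; inside the ball the comparison is between -3/2 r0^2 and r0^2/8. *)
Lemma upot_neg x : E x <= 3 / 2 * r0 -> upot x < 0.
Proof.
move=> xr; have e0 := enorm_ge0 (x - c); have [rx|/ltW rx] := leP (E x) r0.
  rewrite (upot_in rx); have := Hl_le x (lexx r0); rewrite Hfun_r0.
  rewrite ler_norml => /andP[h _].
  have : (E x ^+ 2 - r0 ^+ 2) / (2 * sc) <= 0.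
    rewrite pmulr_lle0 ?invr_gt0 ?mulr_gt0// subr_le0 ler_pXn2r// nnegrE//.
    exact: ltW.
  have : r0 / 8 * E x <= r0 / 8 * r0 by rewrite ler_wpM2l// divr_ge0// ltW.
  have : 0 < r0 ^+ 2 by rewrite exprn_gt0.
  rewrite !expr2; lra.
rewrite (upot_out rx); have := Hl_le x rx; rewrite ler_norml => /andP[h _].
have h1 : E x * E x <= 3 / 2 * r0 * (3 / 2 * r0) by rewrite ler_pM.
have h2 : r0 * E x <= r0 * (3 / 2 * r0) by rewrite ler_wpM2l// ltW.
have : 0 < r0 * r0 by rewrite mulr_gt0.
rewrite !expr2; lra.
Qed.

(** At distance 3 r0 the unperturbed potential is 5/2 r0^2, against at most 3/8 r0^2. *)
Lemma upot_pos x : 3 * r0 <= E x -> 0 < upot x.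
Proof.
move=> xr; have rx : r0 <= E x by apply: le_trans xr; have := ltW r00; lra.
rewrite (upot_out rx); have := Hl_le x rx; rewrite ler_norml => /andP[_ h].
have h1 : 3 * r0 * E x <= E x * E x by rewrite ler_wpM2r// enorm_ge0.
have h2 : r0 * (3 * r0) <= r0 * E x by rewrite ler_wpM2l// ltW.
have : 0 < r0 * r0 by rewrite mulr_gt0.
rewrite !expr2; lra.
Qed.

(** The two terms of the product rule for differences account for the two terms of [Lip]: [Hfun] is
    bounded, and its own Lipschitz bound is multiplied by a coordinate of size at most 4 r0, whence
    the factor 4 N. *)
Lemma Hl_lip x y : r0 <= E x -> r0 <= E y -> E y <= 4 * r0 ->
  `|Hfun (E x) * lfun x - Hfun (E y) * lfun y| <= r0 / 8 * enorm (x - y).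
Proof.
move=> rx ry yr.
have -> : Hfun (E x) * lfun x - Hfun (E y) * lfun y =
   eps * (Hfun (E x) * (x - y) 0 0 + (Hfun (E x) - Hfun (E y)) * (y - c) 0 0).
  by rewrite /lfun !mxE; ring.
rewrite normrM (gtr0_norm eps0) (le_trans _ (ler_wpM2r (enorm_ge0 _) epsL))//.
rewrite -mulrA ler_wpM2l ?(ltW eps0)// (le_trans (ler_normD _ _))// !normrM.
have h1 : `|Hfun (E x)| * `|(x - y) 0 0| <=
    (`|alpha| + `|beta| * r0 ^- N) * enorm (x - y).
  by rewrite ler_pM// ?Hfun_le// coord_le_enorm.
have h2 : `|Hfun (E x) - Hfun (E y)| * `|(y - c) 0 0| <=
    4 * N%:R * (`|beta| * r0 ^- N) * enorm (x - y).
  apply: (@le_trans _ _ (`|Hfun (E x) - Hfun (E y)| * (4 * r0))).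
    by rewrite ler_wpM2l// (le_trans (coordB _ _)).
  have := Hfun_lip rx ry.
  have : N%:R * (`|beta| * r0 ^- N) * `|E x - E y| <=
         N%:R * (`|beta| * r0 ^- N) * enorm (x - y).
    apply: ler_wpM2l; first exact: mulr_ge0 (ltW N0) B0.
    by have := enorm_dist (x - c) (y - c); rewrite opprB addrA subrK.
  lra.
apply: le_trans (lerD h1 h2) _.
by rewrite le_eqVlt; apply/orP; left; apply/eqP; rewrite /Lip; ring.
Qed.

(** A displacement increases [u] as soon as half the squared distance to [c] grows by more than r0/8
    times its length. Both the radial and the normal monotonicity of [u] are instances. *)
Lemma upot_mono x y : r0 <= E x -> r0 <= E y -> E y <= 4 * r0 ->
  (E y ^+ 2 - E x ^+ 2) / 2 - r0 / 8 * enorm (x - y) <= upot y - upot x.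
Proof.
move=> rx ry yr; have := Hl_lip rx ry yr.
rewrite (upot_out rx) (upot_out ry) ler_norml => /andP[h1 h2]; lra.
Qed.

Lemma upot_continuous : continuous upot.
Proof.
have oT := @openT 'rV[R]_N.
have toC (f : 'rV[R]_N -> R) : continuous f -> Ck 0 setT f by move=> cf; split => // x _; exact: cf.
have ofC (f : 'rV[R]_N -> R) : Ck 0 setT f -> continuous f by move=> [cf _] x; exact: cf.
have cs : Ck 0 setT sq by apply: toC; exact: dotv_continuous.
have cm : Ck 0 setT (fun x => Num.max (sq x) (r0 ^+ 2)).
  have cd : Ck 0 setT (fun x => sq x + cst (- r0 ^+ 2) x).
    by apply: Ck_add => //; exact: Ck_cst.
  have ca : Ck 0 setT (fun x => `|sq x - r0 ^+ 2|).
    apply: toC => x; apply: (@continuous_comp _ _ _ (fun x => sq x - r0 ^+ 2) (fun t : R => `|t|)).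
      exact: (ofC _ cd).
    exact: norm_continuous.
  rewrite (_ : (fun x => _) = (fun x => (sq x + cst (r0 ^+ 2) x + `|sq x - r0 ^+ 2|) * cst (2^-1) x)).
    apply: Ck_mul => //; last exact: Ck_cst.
    by apply: Ck_add => //; apply: Ck_add => //; exact: Ck_cst.
  by apply/funext => x; rewrite maxr_absE.
have cq : continuous (fun x => Num.sqrt (Num.max (sq x) (r0 ^+ 2))).
  by move=> x; apply: (continuous_comp (ofC _ cm x)); exact: sqrt_continuous.
have q0 x : Num.sqrt (Num.max (sq x) (r0 ^+ 2)) ^+ N != 0.
  rewrite expf_neq0// gt_eqF// sqrtr_gt0 lt_max; apply/orP; right.
  exact: exprn_gt0.
have cV : Ck 0 setT (fun x => (Num.sqrt (Num.max (sq x) (r0 ^+ 2))) ^- N).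
  apply: toC => x; apply: (@continuous_comp _ _ _ (fun x => Num.sqrt (Num.max (sq x) (r0 ^+ 2))) (fun t : R => t ^- N)).
    exact: cq.
  by apply: cvgV; [exact: q0|exact: exprn_continuous].
have cH : Ck 0 setT (fun x => Hfun (Num.sqrt (Num.max (sq x) (r0 ^+ 2)))).
  apply: (@Ck_add _ _ 0 setT (cst alpha) (fun x => cst beta x * Num.sqrt (Num.max (sq x) (r0 ^+ 2)) ^- N)) => //.
    exact: Ck_cst.
  by apply: Ck_mul => //; exact: Ck_cst.
have cl : Ck 0 setT lfun.
  rewrite (_ : lfun = fun x => cst eps x * (x 0 0 + cst (- c 0 0) x)).
    apply: Ck_mul => //; first exact: Ck_cst.
    by apply: Ck_add => //; [exact: Ck_coord|exact: Ck_cst].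
  by apply/funext => x; rewrite /lfun !mxE.
apply: ofC; rewrite (_ : upot = fun x => ((sq x + cst (- r0 ^+ 2) x) * cst (2 * sc)^-1 x +
   (Num.max (sq x) (r0 ^+ 2) + cst (- r0 ^+ 2) x) * cst ((1 - sc^-1) / 2) x) +
   (cst (- (3 / 2 * r0 ^+ 2)) x + cst (-1) x * (Hfun (Num.sqrt (Num.max (sq x) (r0 ^+ 2))) * lfun x))).
  have h := Ck_cst 0 [set: 'rV[R]_N].
  apply: Ck_add => //; apply: Ck_add => //; do ?apply: Ck_mul => //; try exact: h.
    by apply: Ck_add => //; exact: h.
  by apply: Ck_add => //; exact: h.
by apply/funext => x; rewrite /upot /=; ring.
Qed.

End potential.

(** * Shape of the domain *)

Section domain_Om.
Context {R : realType} {n : nat}.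
Variables (c : 'rV[R]_n.+2) (r0 sc eps : R).
Local Notation N := n.+2.
Local Notation E x := (enorm (x - c)).
Local Notation u := (upot c r0 sc eps).

Definition Omega : set 'rV[R]_n.+2 := [set x | u x < 0].

Hypotheses (r00 : 0 < r0) (sc0 : 0 < sc) (eps0 : 0 < eps)
  (epsL : eps * Lip (n:=n) r0 sc <= r0 / 8).

Lemma E_ray t (v : 'rV[R]_N) : enorm (c + t *: v - c) = `|t| * enorm v.
Proof. by rewrite [c + _]addrC addrK enormZ. Qed.

Lemma open_Omega : open Omega.
Proof. by apply: open_lt_continuous; exact: upot_continuous. Qed.

Lemma Omega_sub : Omega `<=` eball c (3 * r0).
Proof.
move=> x; rewrite /Omega/= /eball/= ltNge => /negP ux; rewrite ltNge; apply/negP => h.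
by apply: ux; apply/ltW/upot_pos.
Qed.

Lemma bounded_Omega : bounded_set Omega.
Proof.
have [M [Mr h]] := bounded_eball c (3 * r0); exists M; split => // x Mx y /Omega_sub.
exact: h.
Qed.

(** Star-shapedness about [c]: up to distance 3/2 r0 everything is in the domain, and beyond it [u]
    increases along rays. *)
Lemma Omega_ray x t : Omega x -> 0 <= t <= 1 -> Omega (c + t *: (x - c)).
Proof.
move=> Ox /andP[t0 t1]; have Ey := E_ray t (x - c); rewrite (ger0_norm t0) in Ey.
have Ex0 := enorm_ge0 (x - c).
have [h|/ltW h] := leP (t * E x) (3 / 2 * r0); first by apply: upot_neg; rewrite ?Ey.
have tx : t * E x <= E x by rewrite ler_piMl.
have x3 : E x < 3 * r0 by exact: Omega_sub.
have r1 : r0 <= t * E x by apply: le_trans h; have := ltW r00; lra.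
have := @upot_mono _ _ c r0 sc eps r00 sc0 eps0 epsL (c + t *: (x - c)) x.
rewrite Ey => /(_ r1 (le_trans r1 tx)).
have x4 : E x <= 4 * r0 by have := ltW r00; lra.
move=> /(_ x4).
have -> : c + t *: (x - c) - x = - ((1 - t) *: (x - c)).
  by rewrite scalerBl scale1r; apply/rowP => i; rewrite !mxE; ring.
rewrite enormN enormZ ger0_norm ?subr_ge0// => h2.
rewrite /Omega/=; move: Ox; rewrite /Omega/=.
suff : 0 <= (E x ^+ 2 - (t * E x) ^+ 2) / 2 - r0 / 8 * ((1 - t) * E x) by lra.
have -> : (E x ^+ 2 - (t * E x) ^+ 2) / 2 - r0 / 8 * ((1 - t) * E x) =
  (1 - t) * E x * ((E x + t * E x) / 2 - r0 / 8) by field.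
by rewrite !mulr_ge0 ?subr_ge0//; have := ltW r00; lra.
Qed.

Lemma closure_D0 : closure (eball c r0) `<=` Omega.
Proof.
rewrite closure_eball// => x /= xr; apply: upot_neg => //.
by apply: le_trans xr _; have := ltW r00; lra.
Qed.

Lemma domain_Omega : domain Omega.
Proof.
have Oc : Omega c.
  apply: closure_D0; rewrite closure_eball//= subrr enorm0; exact: ltW.
split; [by exists c|exact: open_Omega|].
apply: (@joined_connected _ _ _ c) => x Ox; apply: joined_segment => t t01.
exact: Omega_ray.
Qed.

(** Each point slides radially, inside the annular region, to the sphere of radius 5/4 r0, which is
    connected. Any radius strictly above r0 and at most 3/2 r0 would serve. *)
Lemma connected_annulus : connected (Omega `\` closure (eball c r0)).
Proof.
rewrite closure_eball//; set A := _ `\` _.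
pose q := 5 / 4 * r0; have q0 : 0 < q by rewrite mulr_gt0// divr_gt0.
have qr : r0 < q by rewrite /q; have := r00; lra.
have q2 : q <= 3 / 2 * r0 by rewrite /q; have := r00; lra.
have SA : [set x | E x = q] `<=` A.
  move=> x /= xq; split; first by apply: upot_neg; rewrite ?xq.
  by rewrite /= xq; apply/negP; rewrite -ltNge.
have dq (x : 'rV[R]_N) : E x != 0 -> enorm (c + (q / E x) *: (x - c) - c) = q.
  move=> x0; rewrite E_ray ger0_norm ?divfK// divr_ge0 ?enorm_ge0//.
  exact: ltW.
have jS x : A x -> joined A x (c + (q / E x) *: (x - c)).
  move=> [Ox /negP]; rewrite -ltNge => rx; have Ex0 : 0 < E x := lt_trans r00 rx.
  apply: joined_segment => t /andP[t0 t1].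
  set y := _ + _; pose k := 1 - t + t * (q / E x).
  have -> : y = c + k *: (x - c).
    by rewrite /y /k; apply/rowP => i; rewrite !mxE; ring.
  have kE : k * E x = (1 - t) * E x + t * q.
    by rewrite /k mulrDl -mulrA divfK// gt_eqF.
  have k0 : 0 <= k.
    by rewrite /k addr_ge0 ?subr_ge0// !mulr_ge0// ?invr_ge0 ltW.
  have Ey := E_ray k (x - c); rewrite (ger0_norm k0) in Ey.
  split; last first.
    apply/negP; rewrite -ltNge Ey kE.
    have [->|t1'] := eqVneq t 1; first by rewrite subrr mul0r mul1r add0r.
    have : 0 < 1 - t by rewrite subr_gt0 lt_neqAle t1'.
    nra.
  have [k1|k1] := leP k 1; first by apply: Omega_ray => //; rewrite k0.
  apply: upot_neg => //; rewrite Ey; apply: le_trans q2.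
  rewrite kE; have : E x <= q.
    rewrite leNgt; apply/negP => xq; move: k1; apply/negP; rewrite -leNgt.
    rewrite -(ler_pM2r Ex0) kE mul1r; nra.
  nra.
pose z : 'rV[R]_N := c + q *: delta_mx 0 0.
have zq : E z = q.
  rewrite E_ray (gtr0_norm q0) /enorm /dotv (bigD1 ord0)//= big1.
    by rewrite !mxE !eqxx mulr1 addr0 sqrtr1 mulr1.
  by move=> i i0; rewrite !mxE (negbTE i0) andbF mulr0.
apply: (@joined_connected _ _ _ z) => x Ax.
apply: (@joined_trans _ _ _ (c + (q / E x) *: (x - c))); last exact/joined_sym/jS.
exists [set x | E x = q]; split => //.
  exact: connected_sphere.
case: Ax => _ /negP; rewrite -ltNge => rx.
by apply: dq; rewrite gt_eqF// (lt_trans r00 rx).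
Qed.

Lemma eball_sub_center (a b : 'rV[R]_N) (r s : R) : 0 < r -> a != b ->
  eball a r `<=` eball b s -> enorm (a - b) + r <= s.
Proof.
move=> r1 ab sub; have d0 : 0 < enorm (a - b) by rewrite enorm_gt0 subr_eq0.
rewrite leNgt; apply/negP => h.
(* The point beyond [a] on the ray from [b], at distance t < r from [a], is at distance
   [|a - b| + t >= s] from [b]: in the first ball, not in the second. *)
pose t := Num.max 0 (s - enorm (a - b)).
have tr : t < r by rewrite /t gt_max r1 ltrBlDl.
have t0 : 0 <= t by rewrite le_max lexx.
have : eball a r (a + (t / enorm (a - b)) *: (a - b)).
  rewrite /eball/= [a + _]addrC addrK enormZ ger0_norm ?divfK ?gt_eqF//.
  by rewrite divr_ge0// ltW.
move=> /sub; rewrite /eball/= [_ - b](_ : _ = (1 + t / enorm (a - b)) *: (a - b)).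
  have k0 : 0 <= 1 + t / enorm (a - b) by rewrite addr_ge0// divr_ge0// ltW.
  rewrite enormZ (ger0_norm k0) mulrDl mul1r divfK ?gt_eqF//.
  have : s - enorm (a - b) <= t by rewrite le_max lexx orbT.
  lra.
by rewrite scalerDl scale1r addrAC.
Qed.

(** This value is the convex combination (1 - k)/sc + k, with k = (1 - 2^-N)/N in (0, 1]. *)
Lemma Hfun_gt0 : 0 < Hfun (n:=n) r0 sc (2 * r0).
Proof.
have -> : Hfun (n:=n) r0 sc (2 * r0) = sc^-1 - (sc^-1 - 1) * ((1 - 2^-1 ^+ N) / N%:R).
  rewrite /Hfun /alpha /beta exprMn exprVn; field.
  by rewrite -natrD pnatr_eq0 !expf_neq0 ?gt_eqF ?sc0 ?r00.
have i0 : 0 < sc^-1 by rewrite invr_gt0.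
have k0 : 0 < (1 - 2^-1 ^+ N) / N%:R :> R.
  rewrite divr_gt0 ?ltr0n// subr_gt0 exprVn invf_lt1 ?exprn_gt0// exprn_egt1//.
  by rewrite ltr1n.
have k1 : (1 - 2^-1 ^+ N) / N%:R <= 1 :> R.
  rewrite ler_pdivrMr ?ltr0n// mul1r; apply: (@le_trans _ _ 1); last by rewrite ler1n.
  by rewrite gerBl exprn_ge0// invr_ge0.
move: k0 k1; set k := _ / _ => k0 k1.
have -> : sc^-1 - (sc^-1 - 1) * k = sc^-1 * (1 - k) + k by ring.
by rewrite ltr_wpDl// mulr_ge0 ?subr_ge0// ltW.
Qed.

(** A ball determines its centre, so the common centre would be [c]. The points c + 2 r0 e_0 and c -
    2 r0 e_0 would then be both inside or both outside, yet [u] has opposite nonzero values there: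
    the radial part vanishes and only the odd perturbation is left. *)
Lemma not_concentric_Omega : ~ concentric_balls (eball c r0) Omega.
Proof.
move=> [b [r [s [r1 s1 Db Ob]]]].
have cb : c = b.
  apply/eqP; apply/negPn/negP => cb.
  have h1 : enorm (c - b) + r0 <= r by apply: eball_sub_center => //; rewrite Db.
  have h2 : enorm (b - c) + r <= r0.
    by apply: eball_sub_center => //; rewrite 1?eq_sym// Db.
  have : 0 < enorm (c - b) by rewrite enorm_gt0 subr_eq0.
  by rewrite enormBC in h2; move: h1 h2; rewrite [enorm (c - b)]enormBC; lra.
have e1 : enorm (delta_mx 0 0 : 'rV[R]_N) = 1.
  rewrite /enorm /dotv (bigD1 ord0)//= big1.
    by rewrite !mxE !eqxx mulr1 addr0 sqrtr1.
  by move=> i i0; rewrite !mxE (negbTE i0) andbF mulr0.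
have r20 : 0 < 2 * r0 by rewrite mulr_gt0.
pose xp : 'rV[R]_N := c + (2 * r0) *: delta_mx 0 0.
pose xm : 'rV[R]_N := c + (- (2 * r0)) *: delta_mx 0 0.
have Ep : E xp = 2 * r0 by rewrite E_ray e1 mulr1 gtr0_norm.
have Em : E xm = 2 * r0 by rewrite E_ray e1 mulr1 normrN gtr0_norm.
have rr : r0 <= 2 * r0 by have := r00; lra.
have lp : lfun c eps xp = eps * (2 * r0).
  by rewrite /lfun /xp [c + _]addrC addrK !mxE eqxx mulr1.
have lm : lfun c eps xm = - (eps * (2 * r0)).
  by rewrite /lfun /xm [c + _]addrC addrK !mxE eqxx mulr1 mulrN.
have P0 : 0 < Hfun (n:=n) r0 sc (2 * r0) * (eps * (2 * r0)).
  by rewrite mulr_gt0 ?Hfun_gt0// mulr_gt0.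
have Op : Omega xp.
  rewrite /Omega/= upot_out// ?Ep// lp.
  have -> : ((2 * r0) ^+ 2 - 4 * r0 ^+ 2) / 2 = 0 by field.
  by rewrite sub0r oppr_lt0.
have nOm : ~ Omega xm.
  rewrite /Omega/= upot_out// ?Em// lm.
  have -> : ((2 * r0) ^+ 2 - 4 * r0 ^+ 2) / 2 = 0 by field.
  by rewrite sub0r mulrN opprK => h; have := lt_trans h P0; rewrite ltxx.
by apply: nOm; move: Op; rewrite Ob /eball/= -cb Ep Em.
Qed.

End domain_Om.

(** * Analyticity of the boundary *)

Section good_extra.
Context {R : realType} {m : nat}.
Local Notation MP := (mpoly m R).
Local Notation C := (mpolyC m).

Lemma good_eq (A B : MP -> MP -> MP) (a p q a' p' q' : R) :
  good A a p q -> (forall v w, A v w = B v w) -> a = a' -> p = p' -> q = q' ->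
  good B a' p' q'.
Proof.
move=> gA AB <- <- <-; rewrite (_ : B = A)//.
by apply/funext => v; apply/funext => w; rewrite AB.
Qed.

Lemma good_affine_sum (y b : 'I_m -> R) :
  good (fun _ _ => \sum_j (C (y j) + mpolyX R (mnm1 j)) * C (b j))
    (\sum_j y j * b j) 0 0.
Proof.
have h j := goodM (goodD (good_const (y j)) (good_var j)) (good_const (b j)).
apply: (good_eq (good_sum (index_enum 'I_m) h)) => //.
- by apply: eq_bigr => j _; rewrite addr0.
- by rewrite big1// => j _; rewrite !(addr0, mulr0).
- by rewrite big1// => j _; rewrite !(addr0, mulr0).
Qed.

Lemma good_affine_sqr (y : 'I_m -> R) :
  good (fun _ _ => \sum_j (C (y j) + mpolyX R (mnm1 j)) ^+ 2)
    (\sum_j y j ^+ 2) 0 0.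
Proof.
have h j := goodX 2 (goodD (good_const (y j)) (good_var j)).
apply: (good_eq (good_sum (index_enum 'I_m) h)) => //.
- by apply: eq_bigr => j _; rewrite addr0.
- by rewrite big1// => j _; rewrite !(addr0, mulr0).
- by rewrite big1// => j _; rewrite !(addr0, mulr0).
Qed.

Lemma good_shift_fst (t : R) : good (fun v _ : MP => C t + v) t 1 0.
Proof.
by apply: (good_eq (goodD (good_const t) good_fst)); rewrite ?addr0 ?add0r.
Qed.

Lemma good_shift_snd (t : R) : good (fun _ w : MP => C t + w) t 0 1.
Proof.
by apply: (good_eq (goodD (good_const t) good_snd)); rewrite ?addr0 ?add0r.
Qed.

Lemma real_analytic_at_eq (f g : 'rV[R]_m -> R) (y : 'rV[R]_m) (d : R) : 0 < d ->
  (forall z : 'rV[R]_m, (forall i, `|z 0 i - y 0 i| < d) -> f z = g z) ->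
  real_analytic_at f y -> real_analytic_at g y.
Proof.
move=> d0 fg [a [r [r0 h]]]; exists a, (Num.min r d); split; first by rewrite lt_min r0.
move=> z zy; have [|h1 h2] := h z.
  by move=> i; have := zy i; rewrite lt_min => /andP[].
split => //; rewrite -fg// => i.
by have := zy i; rewrite lt_min => /andP[].
Qed.

End good_extra.

(** * The implicit function theorem for the zero set of the potential *)

Section surface_ift.
Context {R : realType} {m : nat}.
Variables (N : nat) (al be S eps tau k0 : R) (b y : 'I_m -> R).

(* The distance s to c is a second unknown besides the height t, which makes the
   equations polynomial. *)
Definition eqn1 (z : 'rV[R]_m) (t s : R) : R :=
  \sum_j (y j + z 0 j) ^+ 2 + (t - k0) ^+ 2 - s ^+ 2.

Definition eqn2 (z : 'rV[R]_m) (t s : R) : R :=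
  s ^+ N * ((s ^+ 2 - S) / 2) -
  (al * s ^+ N + be) * (eps * (\sum_j (y j + z 0 j) * b j + (t - k0) * tau)).

(** The nonvanishing expression is the Jacobian determinant of [eqn1] and [eqn2] in (t, s) at the
    base point. Here [y] and [t1] are the frame coordinates of the base point relative to [c], [b]
    and [tau] those of e_0, and [k0] is the height of [c]. *)
Lemma surface_ift (t1 s1 e : R) :
  let L := \sum_j y j * b j + t1 * tau in
  \sum_j y j ^+ 2 + t1 ^+ 2 = s1 ^+ 2 ->
  s1 ^+ N * ((s1 ^+ 2 - S) / 2) = (al * s1 ^+ N + be) * (eps * L) ->
  2 * t1 * (N%:R * s1 ^+ N.-1 * ((s1 ^+ 2 - S) / 2) + s1 ^+ N * s1
     - al * (N%:R * s1 ^+ N.-1) * (eps * L))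
  - (al * s1 ^+ N + be) * (eps * tau) * (2 * s1) != 0 -> 0 < e ->
  exists (r : R) (g h : 'rV[R]_m -> R), [/\ 0 < r,
    (forall y0, real_analytic_at (fun x => g (x - y0)) y0) &
    forall z : 'rV[R]_m, (forall i, `|z 0 i| <= r) ->
      [/\ `|g z - (t1 + k0)| <= e, `|h z - s1| <= e, eqn1 z (g z) (h z) = 0 &
         eqn2 z (g z) (h z) = 0]].
Proof.
move=> L b1 b2 D0 e0.
pose T (v w : mpoly m R) := mpolyC m t1 + v.
pose W (v w : mpoly m R) := mpolyC m s1 + w.
pose Lin (v w : mpoly m R) :=
  \sum_j (mpolyC m (y j) + mpolyX R (mnm1 j)) * mpolyC m (b j) + T v w * mpolyC m tau.
pose A1 (v w : mpoly m R) :=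
  (\sum_j (mpolyC m (y j) + mpolyX R (mnm1 j)) ^+ 2 + T v w ^+ 2) +
  mpolyC m (-1) * W v w ^+ 2.
pose A2 (v w : mpoly m R) :=
  W v w ^+ N * ((W v w ^+ 2 + mpolyC m (- S)) * mpolyC m 2^-1) +
  mpolyC m (-1) * ((mpolyC m al * W v w ^+ N + mpolyC m be) * (mpolyC m eps * Lin v w)).
have gT : good T t1 1 0 := good_shift_fst t1.
have gW : good W s1 0 1 := good_shift_snd s1.
have gLin : good Lin L tau 0.
  apply: (good_eq (goodD (good_affine_sum y b) (goodM gT (good_const tau)))) => //; ring.
have gA1 : good A1 0 (2 * t1) (- (2 * s1)).
  apply: (good_eq (goodD (goodD (good_affine_sqr y) (goodX 2 gT))
    (goodM (good_const (-1)) (goodX 2 gW)))) => //=.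
  - by rewrite b1; ring.
  - ring.
  - ring.
have gA2 : good A2 0 (- ((al * s1 ^+ N + be) * (eps * tau)))
    (N%:R * s1 ^+ N.-1 * ((s1 ^+ 2 - S) / 2) + s1 ^+ N * s1
     - al * (N%:R * s1 ^+ N.-1) * (eps * L)).
  have gN := goodX N gW.
  apply: (good_eq (goodD
    (goodM gN (goodM (goodD (goodX 2 gW) (good_const (- S))) (good_const 2^-1)))
    (goodM (good_const (-1)) (goodM (goodD (goodM (good_const al) gN) (good_const be))
      (goodM (good_const eps) gLin))))) => //=.
  - by rewrite b2; ring.
  - ring.
  - by field.
have Dn : 2 * t1 * (N%:R * s1 ^+ N.-1 * ((s1 ^+ 2 - S) / 2) + s1 ^+ N * s1
     - al * (N%:R * s1 ^+ N.-1) * (eps * L))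
  - - ((al * s1 ^+ N + be) * (eps * tau)) * - (2 * s1) != 0 by rewrite mulrNN.
have cvgX k (u : nat -> R) (l : R) : u @ \oo --> l -> u j ^+ k @[j --> \oo] --> l ^+ k.
  move=> ul; elim: k => [|k ih].
    by rewrite expr0 (_ : (fun j => _) = fun=> 1); [exact: cvg_cst|apply/funext => j; rewrite expr0].
  rewrite exprS (_ : (fun j => _) = fun j => u j * u j ^+ k); first exact: cvgM.
  by apply/funext => j; rewrite exprS.
have cst0 (a : R) : (fun=> a) @ \oo --> a by exact: cvg_cst.
have E1 (z : 'rV[R]_m) v w : meval (z 0) (A1 v w) =
    eqn1 z (t1 + k0 + meval (z 0) v) (s1 + meval (z 0) w).
  rewrite /A1 /T /W !mevalD rmorph_sum/= !mevalM ?rmorphXn/= ?(mevalM, mevalD, mevalC) /eqn1.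
  rewrite (eq_bigr (fun j => (y j + z 0 j) ^+ 2)); first by ring.
  by move=> j _; rewrite rmorphXn/= mevalD mevalC mevalXU.
have E2 (z : 'rV[R]_m) v w : meval (z 0) (A2 v w) =
    eqn2 z (t1 + k0 + meval (z 0) v) (s1 + meval (z 0) w).
  rewrite /A2 /Lin /T /W !(mevalD, mevalM, mevalC) ?rmorphXn/= ?(mevalM, mevalD, mevalC) /eqn2.
  rewrite rmorph_sum/= (eq_bigr (fun j => (y j + z 0 j) * b j)); first by ring.
  by move=> j _; rewrite mevalM mevalD !mevalC mevalXU.
have [r [g [h [r0 ag H]]]] := @poly_ift R m A1 A2 eqn1 eqn2 _ _ _ _ (t1 + k0) s1 e
  gA1 gA2 Dn e0 E1 E2
  (fun z t s t_ s_ tc sc => cvgB (cvgD (cst0 _) (cvgX 2 _ _ (cvgB tc (cst0 _)))) (cvgX 2 _ _ sc))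
  (fun z t s t_ s_ tc sc => cvgB
    (cvgM (cvgX N _ _ sc) (cvgM (cvgB (cvgX 2 _ _ sc) (cst0 _)) (cst0 _)))
    (cvgM (cvgD (cvgM (cst0 _) (cvgX N _ _ sc)) (cst0 _))
      (cvgM (cst0 _) (cvgD (cst0 _) (cvgM (cvgB tc (cst0 _)) (cst0 _)))))).
by exists r, g, h.
Qed.

End surface_ift.

Section jacobian.
Context {R : realType} {n : nat}.
Variables (r0 sc eps : R).
Local Notation N := n.+2.
Local Notation al := (alpha (n:=n) sc).
Local Notation be := (beta (n:=n) r0 sc).
Hypotheses (r00 : 0 < r0) (sc0 : 0 < sc) (eps0 : 0 < eps)
  (epsL : eps * Lip (n:=n) r0 sc <= r0 / 8).

(** Eliminating (s^2 - 4 r0^2)/2 by the base equation shows that the determinant is 2 s^(N+1) times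
    the derivative of [u] in the direction of t. That derivative is negative: t <= -5/4 r0 outweighs
    the perturbation. *)
Lemma jacobian_neq0 (t s L0 tau : R) : r0 <= s -> `|L0| <= s -> `|tau| <= 1 ->
  t <= - (5 / 4 * r0) ->
  s ^+ N * ((s ^+ 2 - 4 * r0 ^+ 2) / 2) = (al * s ^+ N + be) * (eps * L0) ->
  2 * t * (N%:R * s ^+ N.-1 * ((s ^+ 2 - 4 * r0 ^+ 2) / 2) + s ^+ N * s
     - al * (N%:R * s ^+ N.-1) * (eps * L0))
  - (al * s ^+ N + be) * (eps * tau) * (2 * s) != 0.
Proof.
move=> rs Ls tau1 tr base; have s0 : 0 < s := lt_le_trans r00 rs.
have a0 : 0 < s ^+ N by rewrite exprn_gt0.
set D := (X in X != 0).
pose X := N%:R * (be / s ^+ N) * (eps * L0).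
pose Y := Hfun (n:=n) r0 sc s * eps * tau.
have DE : s * D = 2 * s ^+ N * (t * (s ^+ 2 + X) - s ^+ 2 * Y).
  have -> : s * D = 2 * t * (N%:R * (s ^+ N * ((s ^+ 2 - 4 * r0 ^+ 2) / 2)) + s ^+ N * s ^+ 2
      - al * (N%:R * s ^+ N) * (eps * L0))
      - (al * s ^+ N + be) * (eps * tau) * (2 * s ^+ 2).
    by rewrite /D -[s ^+ N]/(s ^+ N.-1.+1) [s ^+ N.-1.+1]exprS; ring.
  rewrite base /X /Y /Hfun; field; exact: lt0r_neq0.
have rN0 : 0 < r0 ^+ N by rewrite exprn_gt0.
have be0 : 0 <= `|be| * r0 ^- N by rewrite mulr_ge0// invr_ge0 ltW.
(* The share 4 N |beta| r0^-N of [Lip] is what bounds eps N |beta| r0^-N by r0/32. *)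
have Xle : `|X| <= r0 / 32 * s.
  have -> : `|X| = N%:R * (`|be| / s ^+ N) * eps * `|L0|.
    have gen (b q : R) : 0 < q ->
        `|N%:R * (b / q) * (eps * L0)| = N%:R * (`|b| / q) * eps * `|L0|.
      move=> q0.
      by rewrite !normrM normfV (gtr0_norm eps0) (gtr0_norm q0) (ger0_norm (ler0n _ _)) !mulrA.
    exact: gen.
  rewrite ler_pM ?mulr_ge0 ?invr_ge0 ?(ltW eps0) ?(ltW a0)//.
  apply: (@le_trans _ _ (eps * (N%:R * (`|be| * r0 ^- N)))).
    rewrite mulrC ler_wpM2l ?(ltW eps0)// ler_wpM2l// ler_wpM2l//.
    by rewrite lef_pV2 ?posrE// ler_pXn2r// nnegrE ltW.
  have : eps * (4 * (N%:R * (`|be| * r0 ^- N))) <= r0 / 8.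
    apply: le_trans epsL; rewrite ler_wpM2l ?(ltW eps0)// /Lip.
    have := normr_ge0 al; lra.
  lra.
have Yle : `|Y| <= r0 / 8.
  rewrite /Y !normrM (gtr0_norm eps0) -[r0 / 8]mulr1 ler_pM ?mulr_ge0 ?(ltW eps0)//.
  apply: le_trans epsL; rewrite mulrC ler_wpM2l ?(ltW eps0)//.
  apply: le_trans (Hfun_le sc r00 rs) _; rewrite lerD2l ler_peMl// lerDl.
  by rewrite mulr_ge0.
move: Xle Yle; rewrite !ler_norml => /andP[X1 X2] /andP[Y1 Y2].
suff : t * (s ^+ 2 + X) - s ^+ 2 * Y < 0.
  move=> h; apply/eqP => D0; move: DE; rewrite D0 mulr0 => /esym/eqP.
  by rewrite mulf_eq0 (lt_eqF h) orbF mulf_eq0 pnatr_eq0/= gt_eqF.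
have s2 : r0 * s <= s ^+ 2 by rewrite expr2 ler_wpM2r// ltW.
have s20 : 0 < s ^+ 2 by rewrite exprn_gt0.
have h1 : s ^+ 2 * (31 / 32) <= s ^+ 2 + X by lra.
have h2 : t * (s ^+ 2 + X) <= - (5 / 4 * r0) * (s ^+ 2 * (31 / 32)).
  have tn : t <= 0 by apply: le_trans tr _; have := ltW r00; lra.
  apply: (@le_trans _ _ (t * (s ^+ 2 * (31 / 32)))); first by rewrite ler_wnM2l.
  by rewrite ler_wpM2r// mulr_ge0// ltW.
have h3 : s ^+ 2 * - Y <= s ^+ 2 * (r0 / 8) by rewrite ler_wpM2l ?(ltW s20)//; lra.
have : 0 < s ^+ 2 * r0 by rewrite mulr_gt0.
lra.
Qed.

End jacobian.

Section frame_coords.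
Context {R : realType} {n : nat}.
Variables (P : 'M[R]_(n.+1, n)) (e : 'cV[R]_n.+1).
Hypotheses (PPee : P *m P^T + e *m e^T = 1%:M) (PP : P^T *m P = 1%:M)
  (Pe : P^T *m e = 0) (ee : e^T *m e = 1%:M).
Implicit Types (x : 'rV[R]_n.+1) (y : 'rV[R]_n) (t : R).

Lemma dotvE m (x y : 'rV[R]_m) : dotv x y = (x *m y^T) 0 0.
Proof. by rewrite mxE; apply: eq_bigr => i _; rewrite mxE. Qed.

Lemma frame_decomp x : x = x *m P *m P^T + (x *m e) 0 0 *: e^T.
Proof.
rewrite -{1}[x]mulmx1 -PPee mulmxDr !mulmxA; congr (_ + _).
by rewrite {1}[x *m e]mx11_scalar mul_scalar_mx.
Qed.

Lemma frame_sqr y t : dotv (y *m P^T + t *: e^T) (y *m P^T + t *: e^T) =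
  dotv y y + t ^+ 2.
Proof.
have eP : e^T *m P = 0 by rewrite -[LHS]trmxK trmx_mul trmxK Pe trmx0.
rewrite !dotvE linearD linearZ/= trmx_mul !trmxK mulmxDl !mulmxDr.
rewrite -!scalemxAl -!scalemxAr -!mulmxA (mulmxA P^T) PP mul1mx Pe.
rewrite (mulmxA e^T) eP mul0mx ee !mulmx0 !scaler0 addr0 add0r scalerA.
by rewrite !mxE eqxx mulr1n mulr1 expr2.
Qed.

Lemma frame_coordP y t : (y *m P^T + t *: e^T) *m P = y.
Proof.
have eP : e^T *m P = 0 by rewrite -[LHS]trmxK trmx_mul trmxK Pe trmx0.
by rewrite mulmxDl -mulmxA PP mulmx1 -scalemxAl eP scaler0 addr0.
Qed.

Lemma frame_enorm x : enorm x ^+ 2 = dotv (x *m P) (x *m P) + ((x *m e) 0 0) ^+ 2.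
Proof. by rewrite sqr_enorm {1 2}(frame_decomp x) frame_sqr. Qed.

Lemma frame_coorde_le x : `|(x *m e) 0 0| <= enorm x.
Proof.
rewrite -(@ler_pXn2r _ 2) ?nnegrE ?enorm_ge0// frame_enorm real_normK ?num_real//.
by rewrite lerDr dotv_ge0.
Qed.

Lemma frame_coordP_le x : enorm (x *m P) <= enorm x.
Proof.
rewrite -(@ler_pXn2r _ 2) ?nnegrE ?enorm_ge0// frame_enorm sqr_enorm.
by rewrite lerDl sqr_ge0.
Qed.

Lemma frame_enorm_le y t : enorm (y *m P^T + t *: e^T) <= enorm y + `|t|.
Proof.
rewrite -(@ler_pXn2r _ 2) ?nnegrE ?addr_ge0 ?enorm_ge0//.
rewrite sqr_enorm frame_sqr sqrrD sqr_enorm real_normK ?num_real//.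
by rewrite lerD2r lerDl mulrn_wge0// mulr_ge0// enorm_ge0.
Qed.

Lemma enorm_coord_le y (d : R) : 0 <= d -> (forall i, `|y 0 i| <= d) ->
  enorm y <= n.+1%:R * d.
Proof.
move=> d0 yd; rewrite -(@ler_pXn2r _ 2) ?nnegrE ?mulr_ge0 ?enorm_ge0//.
rewrite sqr_enorm; apply: (@le_trans _ _ (\sum_(i < n) d ^+ 2)).
  by apply: ler_sum => i _; rewrite -expr2 -real_normK ?num_real// lerXn2r ?nnegrE.
rewrite sumr_const card_ord -[_ *+ n]mulr_natl exprMn; apply: ler_wpM2r; first exact: sqr_ge0.
rewrite -natrX ler_nat (leq_trans (leqnSn n))// -{1}[n.+1]muln1 -mulnn leq_mul//.
Qed.

End frame_coords.

(** * The boundary as an analytic graph *)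

Section boundary.
Context {R : realType} {n : nat}.
Variables (c : 'rV[R]_n.+2) (r0 sc eps : R).
Local Notation N := n.+2.
Local Notation E x := (enorm (x - c)).
Local Notation u := (upot c r0 sc eps).
Local Notation Om := (Omega c r0 sc eps).
Local Notation al := (alpha (n:=n) sc).
Local Notation be := (beta (n:=n) r0 sc).
Hypotheses (r00 : 0 < r0) (sc0 : 0 < sc) (eps0 : 0 < eps)
  (epsL : eps * Lip (n:=n) r0 sc <= r0 / 8).

Lemma bdry_Omega p : bdry Om p -> [/\ u p = 0, 3 / 2 * r0 < E p & E p < 3 * r0].
Proof.
rewrite bdry_open; last exact: open_Omega.
move=> [cp nOp]; have up : u p = 0.
  apply/eqP; rewrite eq_le; apply/andP; split; last by rewrite leNgt; apply/negP.
  have cl : closed [set x | u x <= 0].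
    by apply: closed_le_continuous; exact: upot_continuous.
  by apply: cl; apply: closure_subset cp => x; rewrite /Omega/=; exact: ltW.
split => //.
  rewrite ltNge; apply/negP => h.
  by have := upot_neg r00 sc0 eps0 epsL h; rewrite up ltxx.
rewrite ltNge; apply/negP => h.
by have := upot_pos r00 sc0 eps0 epsL h; rewrite up ltxx.
Qed.

Variables (p : 'rV[R]_N) (P : 'M[R]_(N, n.+1)) (e : 'cV[R]_N).
Hypotheses (up : u p = 0) (Ep1 : 3 / 2 * r0 < E p) (Ep2 : E p < 3 * r0).
Hypotheses (PPee : P *m P^T + e *m e^T = 1%:M) (PP : P^T *m P = 1%:M)
  (Pe : P^T *m e = 0) (ee : e^T *m e = 1%:M) (pe : ((p - c) *m e) 0 0 = - E p).

(** Within r0/4 of [p] the height above [c] is at most -(3/2 - 1/4) r0 = -5/4 r0, and the distance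
    to [c] stays in [r0, 4 r0], where the Lipschitz estimate holds. *)
Let r1 := r0 / 4.
Let r10 : 0 < r1. Proof. by rewrite divr_gt0. Qed.
Let tc (x : 'rV[R]_N) := ((x - c) *m e) 0 0.
Let pt (Y : 'rV[R]_n.+1) (t : R) : 'rV[R]_N := Y *m P^T + t *: e^T.

Let tc_le x : enorm (x - p) < r1 -> tc x <= - (5 / 4 * r0).
Proof.
move=> xp; have := frame_coorde_le PPee PP Pe ee (x - p).
have -> : ((x - p) *m e) 0 0 = tc x + E p.
  have -> : x - p = (x - c) - (p - c) by rewrite opprB addrA subrK.
  by rewrite mulmxBl mxE [X in _ + X]mxE pe opprK.
rewrite ler_norml => /andP[_ h]; move: xp; rewrite /r1; have := Ep1; lra.
Qed.

Let E_near x : enorm (x - p) < r1 -> r0 <= E x /\ E x <= 4 * r0.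
Proof.
move=> xp; have := enorm_dist (x - c) (p - c).
rewrite opprB addrA subrK ler_norml => /andP[h1 h2].
move: xp; rewrite /r1; have := Ep1; have := Ep2; have := r00.
by split; lra.
Qed.

(** [e] is the inward radial vector at [p]. A move along it changes the distance to [c] only through
    the height, which is at most -5/4 r0, so the decrease of [E x ^ 2 / 2] beats the rate r0/8. *)
Let mono_e x k : enorm (x - p) < r1 -> enorm (x + k *: e^T - p) < r1 -> 0 < k ->
  u (x + k *: e^T) < u x.
Proof.
move=> xp; set x' := x + _ => xp' k0.
have [[rx1 rx2] [rx1' rx2']] := (E_near xp, E_near xp').
have := upot_mono r00 sc0 eps0 epsL rx1' rx1 rx2.
have xx' : x' - c = (x - c) + k *: e^T by rewrite /x' addrAC.
have tx' : tc x' = tc x + k.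
  rewrite /tc xx' mulmxDl mxE; congr (_ + _).
  by rewrite -scalemxAl ee !mxE eqxx mulr1.
have -> : E x' ^+ 2 = E x ^+ 2 - tc x ^+ 2 + tc x' ^+ 2.
  have PeT : e^T *m P = 0 by rewrite -[LHS]trmxK trmx_mul trmxK Pe trmx0.
  rewrite !(frame_enorm PPee PP Pe ee) -!/(tc _) -/(tc x') addrK.
  by rewrite xx' mulmxDl -scalemxAl PeT scaler0 addr0.
have -> : x' - x = k *: e^T by rewrite /x' [x + _]addrC addrK.
have -> : enorm (k *: e^T) = k.
  rewrite enormZ (gtr0_norm k0) [enorm _](_ : _ = 1) ?mulr1//.
  by rewrite /enorm dotvE trmxK ee mxE eqxx sqrtr1.
rewrite tx'; have h1 := tc_le xp; have h2 := tc_le xp'; rewrite tx' in h2.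
suff : 0 < (E x ^+ 2 - (E x ^+ 2 - tc x ^+ 2 + (tc x + k) ^+ 2)) / 2 - r0 / 8 * k by lra.
have -> : (E x ^+ 2 - (E x ^+ 2 - tc x ^+ 2 + (tc x + k) ^+ 2)) / 2 - r0 / 8 * k =
  k * (- (tc x + (tc x + k)) / 2 - r0 / 8) by field.
by rewrite mulr_gt0//; have := r00; lra.
Qed.

(** The base point is any zero near [p], not [p] alone: the implicit function theorem expands the
    graph only about its base point, while analyticity is required at every point of a
    neighbourhood. *)
Let local_graph x1 : enorm (x1 - p) < r1 -> u x1 = 0 ->
  exists (d : R) (g : 'rV[R]_n.+1 -> R), [/\ 0 < d,
    real_analytic_at g (x1 *m P) &
    forall Y : 'rV[R]_n.+1, (forall i, `|Y 0 i - (x1 *m P) 0 i| <= d) ->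
      enorm (pt Y (g Y) - p) < r1 /\ u (pt Y (g Y)) = 0].
Proof.
move=> xp ux; have [rx1 rx2] := E_near xp.
pose y j := ((x1 - c) *m P) 0 j; pose t1 := tc x1; pose s1 := E x1.
pose k0 := (c *m e) 0 0; pose b j := P 0 j; pose tau := e 0 0.
have s10 : 0 < s1 := lt_le_trans r00 rx1.
have b1 : \sum_j y j ^+ 2 + t1 ^+ 2 = s1 ^+ 2.
  by rewrite /s1 (frame_enorm PPee PP Pe ee) -/(tc x1) /dotv; congr (_ + _);
     apply: eq_bigr => j _; rewrite expr2.
have coord0 (Y : 'rV[R]_n.+1) t : (pt Y t) 0 0 = \sum_j Y 0 j * b j + t * tau.
  by rewrite !mxE; congr (_ + _); apply: eq_bigr => j _; rewrite mxE.
have L0E : (x1 - c) 0 0 = \sum_j y j * b j + t1 * tau.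
  by rewrite {1}(frame_decomp PPee (x1 - c)) coord0.
have aN : 0 < s1 ^+ N by rewrite exprn_gt0.
have b2 : s1 ^+ N * ((s1 ^+ 2 - 4 * r0 ^+ 2) / 2) =
    (al * s1 ^+ N + be) * (eps * (\sum_j y j * b j + t1 * tau)).
  move: ux; rewrite (upot_out eps r00 sc0 rx1) -/s1 /lfun L0E => /eqP.
  rewrite subr_eq0 => /eqP ->; rewrite /Hfun; field; exact: lt0r_neq0.
have tau1 : `|tau| <= 1.
  have -> : tau = e^T 0 0 by rewrite mxE.
  apply: le_trans (coord_le_enorm _ _) _.
  by rewrite /enorm dotvE trmxK ee mxE eqxx sqrtr1.
have L0s : `|\sum_j y j * b j + t1 * tau| <= s1 by rewrite -L0E coord_le_enorm.
have D0 := jacobian_neq0 r00 eps0 epsL rx1 L0s tau1 (tc_le xp) b2.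
pose gap := r1 - enorm (x1 - p); have gap0 : 0 < gap by rewrite subr_gt0.
(* The bound r0/8 keeps the unknown s positive; gap/4 is half of what keeps the solution within r1
   of [p]. *)
pose ee0 := Num.min (r0 / 8) (gap / 4).
have ee00 : 0 < ee0 by rewrite lt_min !divr_gt0.
have [ee01 ee02] : ee0 <= r0 / 8 /\ ee0 <= gap / 4.
  by rewrite /ee0 !ge_min !lexx orbT.
have [r [g [h [rr ag H]]]] := surface_ift k0 b1 b2 D0 ee00.
(* Coordinates of size d give a Euclidean norm of at most (n+2) d <= gap/4, the other half of that
   budget. *)
pose d := Num.min r (gap / (4 * n.+2%:R)).
have d0 : 0 < d by rewrite lt_min rr divr_gt0// mulr_gt0.
have d2 : n.+2%:R * d <= gap / 4.
  have h' : d <= gap / (4 * n.+2%:R) by rewrite ge_min lexx orbT.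
  apply: le_trans (ler_wpM2l (ler0n R n.+2) h') _.
  rewrite le_eqVlt; apply/orP; left; apply/eqP; field.
  by rewrite -natrD pnatr_eq0.
exists d, (fun Y => g (Y - x1 *m P)); split => // Y Yd.
pose z := Y - x1 *m P.
have zd i : `|z 0 i| <= d by have := Yd i; rewrite !mxE.
have zr i : `|z 0 i| <= r by apply: le_trans (zd i) _; rewrite ge_min lexx.
have [H1 H2 H3 H4] := H z zr; rewrite -/z.
set t := g z in H1 H3 H4 *; set s := h z in H2 H3 H4.
have tk : t1 + k0 = (x1 *m e) 0 0.
  by rewrite /t1 /tc /k0 mulmxBl mxE [X in _ + X + _]mxE subrK.
have Xx1 : pt Y t - x1 = pt z (t - (t1 + k0)).
  rewrite {1}(frame_decomp PPee x1) tk /pt /z mulmxBl scalerBl.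
  by apply/rowP => i; rewrite !mxE; ring.
have Xp : enorm (pt Y t - p) < r1.
  have -> : pt Y t - p = (pt Y t - x1) + (x1 - p) by rewrite addrA subrK.
  apply: le_lt_trans (enormD _ _) _; rewrite Xx1.
  have := frame_enorm_le PP Pe ee z (t - (t1 + k0)).
  have := enorm_coord_le (ltW d0) zd.
  move=> h1 h2; have h3 := le_trans h1 d2; rewrite /pt.
  have : enorm (x1 - p) = r1 - gap by rewrite /gap subKr.
  move: gap0; lra.
split => //.
have Xc : pt Y t - c = pt (\row_j (y j + z 0 j)) (t - k0).
  rewrite {1}(frame_decomp PPee c) /pt -/k0.
  have -> : \row_j (y j + z 0 j) = Y - c *m P.
    by apply/rowP => j; rewrite mxE /y /z mulmxBl !mxE; ring.
  by rewrite mulmxBl scalerBl; apply/rowP => i; rewrite !mxE; ring.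
have s0 : 0 < s.
  move: H2; rewrite ler_norml => /andP[h1 _]; have := rx1; rewrite -/s1; have := r00; lra.
(* [eqn1] determines the square of the distance only; positivity of s selects the root. *)
have Es : E (pt Y t) = s.
  apply/eqP; rewrite -(@eqrXn2 _ 2) ?enorm_ge0 ?ltW//; apply/eqP.
  rewrite sqr_enorm Xc frame_sqr//; move: H3; rewrite /eqn1 => /eqP.
  rewrite subr_eq0 => /eqP <-; congr (_ + _).
  by apply: eq_bigr => j _; rewrite mxE expr2.
have [rX _] := E_near Xp.
rewrite (upot_out eps r00 sc0 rX) Es /lfun Xc coord0.
rewrite (eq_bigr (fun j => (y j + z 0 j) * b j)); last by move=> j _; rewrite mxE.
move: H4; rewrite /eqn2 => H4.
have aN' : 0 < s ^+ N by rewrite exprn_gt0.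
apply: (mulfI (lt0r_neq0 aN')); rewrite mulr0 -[RHS]H4 /Hfun; field.
exact: lt0r_neq0.
Qed.

(** On each line parallel to [e] near [p] the potential is strictly decreasing. Hence it has at most
    one zero there, which identifies [g] with the local graphs based at nearby zeros, and its sign
    tells on which side of the graph a point lies. *)
Lemma graph_at_boundary : exists (r : R) (g : 'rV[R]_n.+1 -> R), [/\ 0 < r,
  forall Y, enorm (Y - p *m P) < r -> real_analytic_at g Y &
  forall x, enorm (x - p) < r -> (Om x <-> g (x *m P) < (x *m e) 0 0)].
Proof.
have pp : enorm (p - p) < r1 by rewrite subrr enorm0.
have [d [g [d0 ag Hg]]] := local_graph pp up.
(* Half of d leaves a neighbourhood of size d/2 about each [Y] in which [g] still parametrises
   zeros. *)
pose r := Num.min (d / 2) r1; have r2 : 0 < r by rewrite lt_min divr_gt0.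
have rd : r <= d / 2 by rewrite ge_min lexx.
have rr1 : r <= r1 by rewrite ge_min lexx orbT.
have uniq_zero (Y : 'rV[R]_n.+1) t t' : enorm (pt Y t - p) < r1 ->
    enorm (pt Y t' - p) < r1 -> t < t' -> u (pt Y t') < u (pt Y t).
  move=> h h' tt'; have E' : pt Y t' = pt Y t + (t' - t) *: e^T.
    by rewrite /pt -addrA -scalerDl [t + _]addrC subrK.
  by rewrite E'; apply: mono_e; rewrite -?E' ?subr_gt0.
exists r, g; split => //.
  move=> Y Yr; have Yd i : `|Y 0 i - (p *m P) 0 i| <= d / 2.
    by have := coord_le_enorm (Y - p *m P) i; rewrite !mxE => /le_trans; apply; lra.
  have [|X1 X2] := Hg Y; first by move=> i; apply: le_trans (Yd i) _; lra.
  have XP : pt Y (g Y) *m P = Y by exact: frame_coordP.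
  (* A second application at the zero above [Y] yields an expansion about [Y]; uniqueness of the
     zero shows that it is an expansion of [g]. *)
  have [d' [g' [d'0]]] := local_graph X1 X2; rewrite XP => ag' Hg'.
  apply: (@real_analytic_at_eq _ _ g' g Y (Num.min d' (d / 2))) => //.
    by rewrite lt_min d'0 divr_gt0.
  move=> Z ZY; have [|Z1 Z2] := Hg' Z.
    by move=> i; have := ZY i; rewrite lt_min => /andP[/ltW].
  have [|W1 W2] := Hg Z.
    move=> i; have := ZY i; rewrite lt_min => /andP[_ h].
    have := Yd i; have := ler_normD (Z 0 i - Y 0 i) (Y 0 i - (p *m P) 0 i).
    rewrite addrA subrK; lra.
  have [h|h|//] := ltgtP (g' Z) (g Z).
    by have := uniq_zero Z _ _ Z1 W1 h; rewrite Z2 W2 ltxx.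
  by have := uniq_zero Z _ _ W1 Z1 h; rewrite Z2 W2 ltxx.
move=> x xr; have xp : enorm (x - p) < r1 := lt_le_trans xr rr1.
have [|X1 X2] := Hg (x *m P).
  move=> i; have := coord_le_enorm ((x - p) *m P) i.
  rewrite mulmxBl !mxE => /le_trans; apply.
  have := frame_coordP_le PPee PP Pe ee (x - p); rewrite mulmxBl; lra.
have xE : x = pt (x *m P) ((x *m e) 0 0) by exact: frame_decomp.
have xp' : enorm (pt (x *m P) ((x *m e) 0 0) - p) < r1 by rewrite -xE.
split => [Ox|gx]; last first.
  by rewrite /Omega/= xE -X2; exact: uniq_zero.
rewrite ltNge; apply/negP; rewrite le_eqVlt => /orP[/eqP h|h].
  by move: Ox; rewrite /Omega/= {1}xE h X2 ltxx.
have := uniq_zero _ _ _ xp' X1 h; rewrite X2 -xE.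
by move: Ox; rewrite /Omega/= => /ltW; rewrite leNgt => /negP.
Qed.

End boundary.

Lemma analytic_boundary_Omega {R : realType} {n : nat} (c : 'rV[R]_n.+2) (r0 sc eps : R) :
  0 < r0 -> 0 < sc -> 0 < eps -> eps * Lip (n:=n) r0 sc <= r0 / 8 ->
  analytic_boundary (Omega c r0 sc eps).
Proof.
move=> r00 sc0 eps0 epsL p /(bdry_Omega r00 sc0 eps0 epsL)[up Ep1 Ep2].
have Ep0 : 0 < enorm (p - c) by apply: lt_trans Ep1; rewrite mulr_gt0// divr_gt0.
(* The unit vector from [p] towards [c], so that the domain is the epigraph side. *)
pose e : 'cV[R]_n.+2 := (- (enorm (p - c))^-1) *: (p - c)^T.
have ee : e^T *m e = 1%:M.
  have eT : e^T = (- (enorm (p - c))^-1) *: (p - c).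
    by apply/matrixP => i j; rewrite !mxE.
  rewrite eT /e -scalemxAl -scalemxAr scalerA mulrNN.
  rewrite [_ *m _]mx11_scalar -dotvE -sqr_enorm scale_scalar_mx; congr (_%:M).
  by field; exact: lt0r_neq0.
have pe : ((p - c) *m e) 0 0 = - enorm (p - c).
  rewrite /e -scalemxAr mxE -dotvE -sqr_enorm; field; exact: lt0r_neq0.
have [P [PPee PP Pe]] := frame_exists ee.
have [r [g [r2 ag Hg]]] := graph_at_boundary r00 sc0 eps0 epsL up Ep1 Ep2 PPee PP Pe ee pe.
by exists P, e, r, g.
Qed.

(** * The transmission problem *)

Section smoothing.
Context {R : realType} {n : nat}.
Variables (r0 sc : R).
Local Notation N := n.+2.
Local Notation al := (alpha (n:=n) sc).
Local Notation be := (beta (n:=n) r0 sc).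
Local Notation H := (Hfun (n:=n) r0 sc).

(* mk k s is a smooth substitute for max (s, r0 ^ 2): both agree for s >= r0 ^ 2, and
   at each other s for all large k. *)
Definition mscale (k : nat) : R := k%:R + 2 / r0 ^+ 2.
Definition mk (k : nat) (s : R) : R := r0 ^+ 2 + scut 1 (mscale k) (s - r0 ^+ 2).
Definition dmk (k : nat) (s : R) : R := dscut 1 (mscale k) (s - r0 ^+ 2).
Definition hk (k : nat) (s : R) : R := H (Num.sqrt (mk k s)).
(** The derivative of [H (sqrt t)] with respect to t, at t = rho^2. *)
Definition dH (rho : R) : R := - (N%:R / 2) * be * rho ^- N.+2.
Definition dhk (k : nat) (s : R) : R := dH (Num.sqrt (mk k s)) * dmk k s.

Hypotheses (r00 : 0 < r0).
Let s00 : 0 < r0 ^+ 2. Proof. by rewrite exprn_gt0. Qed.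

Lemma mscale_gt0 k : 0 < mscale k.
Proof. by rewrite ltr_wpDl// divr_gt0. Qed.

Lemma mk_out k s : r0 ^+ 2 <= s -> mk k s = s.
Proof.
move=> h; rewrite /mk scut_eq; first by rewrite addrC subrK.
by rewrite lerDr mulr_ge0 ?subr_ge0// ltW// mscale_gt0.
Qed.

Lemma dmk_out k s : r0 ^+ 2 <= s -> dmk k s = 1.
Proof.
move=> h; rewrite /dmk dscut_eq1//.
by rewrite lerDr mulr_ge0 ?subr_ge0// ltW// mscale_gt0.
Qed.

(** The summand 2 / r0^2 of [mscale] serves this bound: where the cutoff is positive, r0^2 - s is
    below r0^2/2. Square roots and negative powers of [mk] are therefore smooth, and bounded
    uniformly in k. *)
Lemma mk_ge k s : r0 ^+ 2 / 2 <= mk k s.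
Proof.
have [h|/ltW h] := leP (r0 ^+ 2) s.
  by rewrite mk_out// (le_trans _ h)//; have := s00; lra.
rewrite /mk; have [h1|/ltW h1] := leP (mscale k * (s - r0 ^+ 2) + 1) 0.
  by rewrite scut_eq0// addr0; have := s00; lra.
suff : - (r0 ^+ 2 / 2) <= scut 1 (mscale k) (s - r0 ^+ 2) by lra.
apply: (@le_trans _ _ (s - r0 ^+ 2)); last first.
  by rewrite /scut ler_niMr ?step_le1// subr_le0.
have kr : 2 / r0 ^+ 2 <= mscale k by rewrite lerDr.
have : 2 / r0 ^+ 2 * (r0 ^+ 2 - s) <= 1.
  apply: (@le_trans _ _ (mscale k * (r0 ^+ 2 - s))); first by rewrite ler_wpM2r// subr_ge0.
  lra.
rewrite mulrAC ler_pdivrMr// mul1r; lra.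
Qed.

Lemma mk_gt0 k s : 0 < mk k s.
Proof. by rewrite (lt_le_trans _ (mk_ge k s))// divr_gt0. Qed.

Lemma mk_eventually s : \forall k \near \oo,
  mk k s = Num.max s (r0 ^+ 2) /\ dmk k s = (r0 ^+ 2 <= s)%R%:R.
Proof.
have [h|h] := leP (r0 ^+ 2) s.
  by apply: nearW => k; rewrite mk_out// dmk_out//.
have d0 : 0 < r0 ^+ 2 - s by rewrite subr_gt0.
have : \forall k \near \oo, (r0 ^+ 2 - s)^-1 <= k%:R by exact: nbhs_infty_ger.
apply: filterS => k kge; have c0 : (mscale k : R) * (s - r0 ^+ 2) + 1 <= 0.
  have : 1 <= mscale k * (r0 ^+ 2 - s); last lra.
  rewrite -ler_pdivrMr// div1r (le_trans kge)// lerDl.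
  by rewrite divr_ge0// ltW.
by rewrite /mk /dmk scut_eq0// dscut_eq0// addr0.
Qed.

Lemma is_derive_mk k (s : R) : is_derive s 1 (mk k) (dmk k s).
Proof.
have da : is_derive s 1 (fun s : R => s - r0 ^+ 2) 1.
  by apply: is_derive_eq; rewrite subr0.
have := @is_derive1_comp _ (scut 1 (mscale k)) _ s _ _ (is_derive_scut _ _ _) da.
move=> h; have := @is_deriveD _ _ _ (cst (r0 ^+ 2)) _ s 1 _ _ (is_derive_cst _ _ _) h.
by rewrite mulr1 add0r.
Qed.

Lemma smooth1_mk k : smooth1 (mk k).
Proof.
move=> j; apply: (@Ck1_add _ _ (cst (r0 ^+ 2))); first exact: Ck1_cst.
apply: (@Ck1_comp _ _ (scut 1 (mscale k)) (fun s => s - r0 ^+ 2)).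
  exact: smooth1_scut.
by apply: (@Ck1_add _ _ id (cst (- r0 ^+ 2))); [exact: Ck1_id|exact: Ck1_cst].
Qed.

Lemma smooth1_hk k : smooth1 (hk k).
Proof.
move=> j; apply: (@Ck1_add _ _ (cst al)); first exact: Ck1_cst.
apply: (@Ck1_mul _ _ (cst be)); first exact: Ck1_cst.
apply: (@Ck1_inv _ _ (fun s => Num.sqrt (mk k s) ^+ N)) => [s|].
  by rewrite expf_neq0// gt_eqF// sqrtr_gt0 mk_gt0.
by apply: Ck1_exp; apply: Ck1_sqrt => [s|]; [exact: mk_gt0|exact: smooth1_mk].
Qed.

Lemma derive1_hk k : derive1 (hk k) = dhk k.
Proof.
apply/funext => s; have m0 := mk_gt0 k s.
set q := Num.sqrt (mk k s); have q0 : 0 < q by rewrite sqrtr_gt0.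
have d1 : is_derive s 1 (fun s => Num.sqrt (mk k s)) ((2 * q)^-1 * dmk k s).
  apply: (@is_derive1_comp _ Num.sqrt (mk k)); first exact: is_derive1_sqrt.
  exact: is_derive_mk.
have d2 : is_derive q 1 (fun r : R => r ^- N) (- (N%:R * q ^- N.+1)).
  have qN : q ^+ N != 0 by rewrite expf_neq0// gt_eqF.
  have dX : is_derive q 1 (fun r : R => r ^+ N) (N%:R * q ^+ N.-1).
    by apply: DeriveDef; [exact: exprn_derivable|rewrite exp_derive [LHS]mulr1 /GRing.scale].
  apply: DeriveDef; first by apply: (@derivableV _ _ (fun r : R => r ^+ N)) => //; case: dX.
  rewrite (@deriveV _ _ (fun r : R => r ^+ N))//.
  have [_ ->] := dX; rewrite /GRing.scale/=.
  have E1 : q ^+ N = q * q ^+ n.+1 by rewrite exprS.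
  have E2 : q ^+ n.+3 = q * (q * q ^+ n.+1) by rewrite !exprS.
  rewrite E2 E1; field.
  by rewrite expf_neq0 ?gt_eqF.
have d3 := @is_derive1_comp _ (fun r : R => r ^- N) (fun s => Num.sqrt (mk k s)) s _ _ d2 d1.
have d4 : is_derive s 1 (hk k) (be * (- (N%:R * q ^- N.+1) * ((2 * q)^-1 * dmk k s))).
  have dZ := @is_deriveM _ _ (cst be) _ s 1 _ _ (is_derive_cst _ _ _) d3.
  have := @is_deriveD _ _ _ (cst al) _ s 1 _ _ (is_derive_cst _ _ _) dZ.
  by rewrite /GRing.scale/= mulr0 addr0 add0r.
rewrite derive1E; have [_ ->] := d4; rewrite /dhk /dH -/q.
rewrite [q ^+ N.+2]exprS; field.
by rewrite expf_neq0 ?gt_eqF.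
Qed.

Lemma inv_sqrt_mk_le k s j : `|Num.sqrt (mk k s) ^- j| <= Num.sqrt (r0 ^+ 2 / 2) ^- j.
Proof.
have h0 : 0 < Num.sqrt (r0 ^+ 2 / 2) by rewrite sqrtr_gt0 divr_gt0.
have h : Num.sqrt (r0 ^+ 2 / 2) <= Num.sqrt (mk k s) by rewrite ler_wsqrtr// mk_ge.
have h1 := lt_le_trans h0 h.
rewrite ger0_norm ?invr_ge0 ?exprn_ge0 ?(ltW h1)// lef_pV2 ?posrE ?exprn_gt0//.
by rewrite lerXn2r ?nnegrE ?(ltW h0) ?(ltW h1).
Qed.

Lemma hk_bounded : exists C, forall k s, `|hk k s| <= C.
Proof.
exists (`|al| + `|be| * Num.sqrt (r0 ^+ 2 / 2) ^- N) => k s.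
by rewrite (le_trans (ler_normD _ _))// lerD2l normrM ler_wpM2l// inv_sqrt_mk_le.
Qed.

Lemma dhk_bounded : exists C, forall k s, `|dhk k s| <= C.
Proof.
have [C C0 hC] := @dscut_bounded R 1.
exists (`|- (N%:R / 2) * be| * Num.sqrt (r0 ^+ 2 / 2) ^- N.+2 * C) => k s.
rewrite /dhk normrM ler_pM ?hC// /dH normrM ler_wpM2l//.
exact: inv_sqrt_mk_le.
Qed.

Lemma dmk_bounded : exists C, forall k s, `|dmk k s| <= C.
Proof. by have [C C0 hC] := @dscut_bounded R 1; exists C => k s; exact: hC. Qed.

End smoothing.

Section derive_aux.
Context {R : realType} {n : nat}.
Implicit Types (f g : 'rV[R]_n -> R) (x v : 'rV[R]_n).

Lemma is_derive_addf f g x v (a b : R) : is_derive x v f a -> is_derive x v g b ->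
  is_derive x v (fun y => f y + g y) (a + b).
Proof. by move=> fa gb; exact: is_deriveD. Qed.

Lemma is_derive_mulf f g x v (a b : R) : is_derive x v f a -> is_derive x v g b ->
  is_derive x v (fun y => f y * g y) (f x * b + g x * a).
Proof. by move=> fa gb; exact: is_deriveM. Qed.

Lemma is_derive_cstf x v (a : R) : is_derive x v (fun=> a) 0.
Proof. exact: is_derive_cst. Qed.

Lemma is_derive_congr f g x v (a b : R) : is_derive x v f a ->
  (forall y, f y = g y) -> a = b -> is_derive x v g b.
Proof. by move=> fa fg <-; rewrite (_ : g = f)//; apply/funext => y; rewrite fg. Qed.

Lemma is_derive_sumf (I : Type) (r : seq I) (F : I -> 'rV[R]_n -> R) (a : I -> R) x v :
  (forall i, is_derive x v (F i) (a i)) ->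
  is_derive x v (fun y => \sum_(i <- r) F i y) (\sum_(i <- r) a i).
Proof.
move=> Fa; elim: r => [|i r ih].
  by rewrite big_nil; apply: (is_derive_congr (is_derive_cstf x v 0)) => // y; rewrite big_nil.
rewrite big_cons; apply: (is_derive_congr (is_derive_addf (Fa i) ih)) => // y.
by rewrite big_cons.
Qed.

Lemma is_derive_centered c x v i : is_derive x v (fun y => (y - c) 0 i) (v 0 i).
Proof.
apply: (is_derive_congr (is_derive_addf (is_derive_coord i x v)
  (is_derive_cstf x v (- c 0 i)))) => [y|]; first by rewrite !mxE.
by rewrite addr0.
Qed.

Lemma Ck_centered k c i : Ck k setT (fun y : 'rV[R]_n => (y - c) 0 i).
Proof.
rewrite (_ : (fun y => _) = fun y : 'rV[R]_n => y 0 i + cst (- c 0 i) y).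
  by apply: Ck_add; [exact: openT|exact: Ck_coord|exact: Ck_cst].
by apply/funext => y; rewrite !mxE.
Qed.

Lemma Ck_dist_sqr k c : Ck k setT (fun y : 'rV[R]_n => dotv (y - c) (y - c)).
Proof.
apply: Ck_sum => [|i]; first exact: openT.
by apply: Ck_mul; [exact: openT|exact: Ck_centered|exact: Ck_centered].
Qed.

Lemma is_derive_dist_sqr c x i :
  is_derive x (delta_mx 0 i) (fun y => dotv (y - c) (y - c)) (2 * (x - c) 0 i).
Proof.
have d := is_derive_sumf (index_enum 'I_n) (fun j =>
  is_derive_mulf (is_derive_centered c x (delta_mx 0 i) j) (is_derive_centered c x (delta_mx 0 i) j)).
apply: (is_derive_congr d) => //; rewrite (bigD1 i)//= big1 => [|j ji].
  by rewrite [delta_mx _ _ _ _]mxE !eqxx addr0 /= mulr1n; ring.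
by rewrite [delta_mx _ _ _ _]mxE (negbTE ji) andbF mulr0 addr0.
Qed.

Lemma partial_is_derive f i x (a : R) : is_derive x (delta_mx 0 i) f a -> partial i f x = a.
Proof. by case. Qed.

Definition bounded_on (A : set 'rV[R]_n) (f : nat -> 'rV[R]_n -> R) :=
  exists2 C, 0 <= C & forall k x, A x -> `|f k x| <= C.

Lemma bounded_onD A p q : bounded_on A p -> bounded_on A q ->
  bounded_on A (fun k x => p k x + q k x).
Proof.
move=> [C C0 fC] [D D0 gD]; exists (C + D); first exact: addr_ge0.
by move=> k x Ax; rewrite (le_trans (ler_normD _ _))// lerD ?fC ?gD.
Qed.

Lemma bounded_onM A p q : bounded_on A p -> bounded_on A q ->
  bounded_on A (fun k x => p k x * q k x).
Proof.
move=> [C C0 fC] [D D0 gD]; exists (C * D); first exact: mulr_ge0.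
by move=> k x Ax; rewrite normrM ler_pM ?fC ?gD.
Qed.

Lemma bounded_onN A p : bounded_on A p -> bounded_on A (fun k x => - p k x).
Proof. by move=> [C C0 fC]; exists C => // k x Ax; rewrite normrN fC. Qed.

Lemma bounded_on_cst A (a : R) : bounded_on A (fun _ _ => a).
Proof. by exists `|a|. Qed.

Lemma bounded_on_cont A f : bounded_set A -> continuous f -> bounded_on A (fun _ => f).
Proof.
move=> bA cf; have [C fC] := continuous_bounded_rV bA cf.
by exists `|C| => // k x Ax; rewrite (le_trans (fC x Ax))// ler_norm.
Qed.

Lemma bounded_on_comp A (h : nat -> R -> R) f : (exists C, forall k s, `|h k s| <= C) ->
  bounded_on A (fun k x => h k (f x)).
Proof.
by move=> [C hC]; exists `|C| => // k x _; rewrite (le_trans (hC _ _))// ler_norm.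
Qed.

Lemma bounded_on_all A (f : 'I_n -> nat -> 'rV[R]_n -> R) :
  (forall i, bounded_on A (f i)) ->
  exists2 C, 0 <= C & forall k i x, A x -> `|f i k x| <= C.
Proof.
move=> fb; have B i : {C | 0 <= C /\ forall k x, A x -> `|f i k x| <= C}.
  by apply: cid; have [C C0 fC] := fb i; exists C.
have B0 i : 0 <= sval (B i) by case: (B i) => C [].
exists (\sum_i sval (B i)); first by apply: sumr_ge0.
move=> k i x Ax; rewrite (bigD1 i)//=; apply: ler_wpDr; first by apply: sumr_ge0.
by case: (B i) => C /= [_]; apply.
Qed.

End derive_aux.

(** * The smoothed potential and its flux *)

Section two_phase_pde.
Context {R : realType} {n : nat}.
Variables (c : 'rV[R]_n.+2) (r0 sc eps : R).
Local Notation N := n.+2.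
Local Notation E x := (enorm (x - c)).
Local Notation u := (upot c r0 sc eps).
Local Notation Om := (Omega c r0 sc eps).
Local Notation D := (eball c r0).
Local Notation s := (sq c).
Local Notation l := (lfun c eps).
Local Notation kap := ((1 - sc^-1) / 2).
Local Notation hk := (hk (n:=n) r0 sc).
Local Notation dhk := (dhk (n:=n) r0 sc).
Local Notation mk := (mk r0).
Local Notation dmk := (dmk r0).
Local Notation dl i := (eps * (i == 0)%:R).
Hypotheses (r00 : 0 < r0) (sc0 : 0 < sc) (eps0 : 0 < eps)
  (epsL : eps * Lip (n:=n) r0 sc <= r0 / 8).

Definition upot_smooth (k : nat) (x : 'rV[R]_N) : R :=
  (s x - r0 ^+ 2) / (2 * sc) + (mk k (s x) - r0 ^+ 2) * kap
  - 3 / 2 * r0 ^+ 2 - hk k (s x) * l x.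

Definition dupot_smooth (k : nat) (i : 'I_N) (x : 'rV[R]_N) : R :=
  2 * (x - c) 0 i * ((2 * sc)^-1 + dmk k (s x) * kap - dhk k (s x) * l x)
  - hk k (s x) * dl i.

Definition sq_max (x : 'rV[R]_N) : R := Num.max (s x) (r0 ^+ 2).
Definition outer_ind (x : 'rV[R]_N) : R := (r0 ^+ 2 <= s x)%R%:R.

(** On the interface it takes the outer value, the one that the smoothed gradients attain there; the
    approximation is thus valid at every point, not only almost everywhere. *)
Definition weak_grad_upot (x : 'rV[R]_N) : 'rV[R]_N := \row_i
  (2 * (x - c) 0 i * ((2 * sc)^-1 + outer_ind x * kap
     - dH (n:=n) r0 sc (Num.sqrt (sq_max x)) * outer_ind x * l x)
  - Hfun (n:=n) r0 sc (Num.sqrt (sq_max x)) * dl i).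

(* The coefficient of dl i makes the divergence equal to N; in the limit k --> oo it
   is that of sigma grad u, because Hfun solves an Euler equation outside D. *)
Definition flux (k : nat) (i : 'I_N) (x : 'rV[R]_N) : R :=
  (x - c) 0 i - dl i - 2 * (dhk k (s x) * ((x - c) 0 i * l x))
  + (2 * (dhk k (s x) * s x) + n.+1%:R * (hk k (s x) - sc^-1)) * dl i.

Lemma is_derive_lfun (x : 'rV[R]_N) (i : 'I_N) : is_derive x (delta_mx 0 i) l (dl i).
Proof.
apply: (is_derive_congr (is_derive_mulf (is_derive_cstf x _ eps)
  (is_derive_centered c x (delta_mx 0 i) 0))) => //.
by rewrite mxE eqxx/= mulr0 addr0 eq_sym.
Qed.

Lemma Ck_lfun k : Ck k setT l.
Proof. by apply: Ck_mul; [exact: openT|exact: (Ck_cst k _ eps)|exact: Ck_centered]. Qed.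

Lemma is_derive_radial (h : R -> R) (dh : R) (x : 'rV[R]_N) (i : 'I_N) :
  is_derive (s x) 1 h dh ->
  is_derive x (delta_mx 0 i) (fun y => h (s y)) (dh * (2 * (x - c) 0 i)).
Proof. by move=> hd; apply: is_derive_comp1 hd (is_derive_dist_sqr c x i). Qed.

Lemma is_derive_hk k (t : R) : is_derive t 1 (hk k) (dhk k t).
Proof.
have := Ck1_is_derive (smooth1_hk (n:=n) sc r00 k 1%N) t.
by rewrite (derive1_hk (n:=n) sc r00 k).
Qed.

Lemma smooth1_dhk k : smooth1 (dhk k).
Proof.
move=> j; have [_ [_]] := smooth1_hk (n:=n) sc r00 k j.+1.
by rewrite (derive1_hk (n:=n) sc r00 k).
Qed.

Lemma is_derive_upot_smooth k i x : is_derive x (delta_mx 0 i) (upot_smooth k) (dupot_smooth k i x).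
Proof.
have ds := is_derive_dist_sqr c x i.
have dm := is_derive_radial i (is_derive_mk r0 k (s x)).
have dh := is_derive_radial i (is_derive_hk k (s x)).
have cD a := is_derive_cstf x (delta_mx 0 i) a.
apply: (is_derive_congr (is_derive_addf (is_derive_addf (is_derive_addf
   (is_derive_mulf (is_derive_addf ds (cD (- r0 ^+ 2))) (cD (2 * sc)^-1))
   (is_derive_mulf (is_derive_addf dm (cD (- r0 ^+ 2))) (cD kap)))
   (cD (- (3 / 2 * r0 ^+ 2))))
   (is_derive_mulf (cD (-1)) (is_derive_mulf dh (is_derive_lfun x i))))).
  by move=> y; rewrite /upot_smooth /sq; ring.
by rewrite /dupot_smooth /sq; ring.
Qed.

Lemma Ck_radial k (h : R -> R) : smooth1 h -> Ck k setT (fun x => h (s x)).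
Proof. by move=> sh; apply: Ck_comp1 => //; [exact: openT|exact: Ck_dist_sqr]. Qed.

Lemma Ck_upot_smooth j k : Ck j setT (upot_smooth k).
Proof.
have oT := @openT 'rV[R]_N; have C0 := Ck_cst j [set: 'rV[R]_N].
rewrite (_ : upot_smooth k = fun x => (((s x + cst (- r0 ^+ 2) x) * cst (2 * sc)^-1 x +
  (mk k (s x) + cst (- r0 ^+ 2) x) * cst kap x) + cst (- (3 / 2 * r0 ^+ 2)) x) +
  cst (-1) x * (hk k (s x) * l x)).
  apply: Ck_add => //; last first.
    apply: Ck_mul => //; apply: Ck_mul => //; last exact: Ck_lfun.
    by apply: Ck_radial; exact: smooth1_hk.
  apply: Ck_add => //; apply: Ck_add => //; apply: Ck_mul => //; apply: Ck_add => //.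
    exact: Ck_dist_sqr.
  by apply: Ck_radial; exact: smooth1_mk.
by apply/funext => x; rewrite /upot_smooth /=; ring.
Qed.

Lemma upot_smooth_out k x : r0 <= E x -> upot_smooth k x = u x.
Proof.
move=> rx; have h : r0 ^+ 2 <= s x.
  by rewrite sqE ler_pXn2r// nnegrE ?enorm_ge0// ltW.
by rewrite /upot_smooth /upot /hk max_l// mk_out.
Qed.

Lemma upot_smooth_eventually x : \forall k \near \oo,
  upot_smooth k x = u x /\ forall i, dupot_smooth k i x = weak_grad_upot x 0 i.
Proof.
have := mk_eventually r00 (s x); apply: filterS => k [h1 h2].
split; first by rewrite /upot_smooth /upot /hk h1.
by move=> i; rewrite mxE /dupot_smooth /dhk /hk h1 h2.
Qed.

(** Truncation near the outer boundary: 0 where the smoothed potential is at least -1/(k+1), and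
    equal to it where it is at most -2/(k+1). *)
Definition upot_test (k : nat) (x : 'rV[R]_N) : R := - scut (-1) k.+1%:R (- upot_smooth k x).

Lemma is_derive_upot_test k i x : is_derive x (delta_mx 0 i) (upot_test k)
  (dscut (-1) k.+1%:R (- upot_smooth k x) * dupot_smooth k i x).
Proof.
have cD a := is_derive_cstf x (delta_mx 0 i) a.
have d1 : is_derive x (delta_mx 0 i) (fun y => - upot_smooth k y) (- dupot_smooth k i x).
  apply: (is_derive_congr (is_derive_mulf (cD (-1)) (is_derive_upot_smooth k i x))) => [y|].
    by rewrite mulN1r.
  by rewrite mulr0 addr0 mulN1r.
have d2 := is_derive_comp1 (is_derive_scut (-1) k.+1%:R (- upot_smooth k x)) d1.
apply: (is_derive_congr (is_derive_mulf (cD (-1)) d2)) => [y|].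
  by rewrite mulN1r.
by rewrite mulr0 addr0; ring.
Qed.

Lemma test_upot_test k : test_function Om (upot_test k).
Proof.
have oT := @openT 'rV[R]_N.
split => [j|].
  rewrite (_ : upot_test k = fun x => cst (-1) x * scut (-1) k.+1%:R (cst (-1) x * upot_smooth k x)).
    apply: Ck_mul => //; first exact: Ck_cst.
    apply: Ck_comp1 => //; first exact: smooth1_scut.
    by apply: Ck_mul => //; [exact: Ck_cst|exact: Ck_upot_smooth].
  by apply/funext => x; rewrite /upot_test /= !mulN1r.
have k0 : 0 < k.+1%:R :> R by rewrite ltr0n.
have cu : continuous (upot_smooth k) by move=> x; apply: (Ck_upot_smooth 0 k).1.
(* Smoothing changes the potential only inside the inner ball, which lies in the domain anyway. *)
have sub : [set x | upot_smooth k x <= - k.+1%:R^-1] `<=` Om.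
  move=> x /= xk; have xn : upot_smooth k x < 0.
    by apply: le_lt_trans xk _; rewrite oppr_lt0 invr_gt0.
  have [rx|/ltW rx] := leP r0 (E x); first by rewrite /Omega/= -(upot_smooth_out k).
  by apply: upot_neg => //; apply: le_trans rx _; have := ltW r00; lra.
exists [set x | upot_smooth k x <= - k.+1%:R^-1]; split => //.
  apply: bounded_closed_compact; last exact: closed_le_continuous.
  have bO : bounded_set Om by exact: bounded_Omega.
  have [M [Mr h]] := bO.
  by exists M; split => // a /h ha x /sub; exact: ha.
move=> x /= /negP; rewrite -ltNge => xk; rewrite /upot_test scut_eq0 ?oppr0//.
rewrite mulrN -[leRHS](subrr 1) lerD2r lerNl -ler_pdivrMl//.
by rewrite mulrN1 ltW.
Qed.

Lemma bounded_on_dupot_smooth i : bounded_on Om (dupot_smooth ^~ i).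
Proof.
have bO : bounded_set Om by exact: bounded_Omega.
have bc : bounded_on Om (fun _ x => (x - c) 0 i).
  by apply: bounded_on_cont => // x; apply: (Ck_centered 0 c i).1.
have bl : bounded_on Om (fun _ => l).
  by apply: bounded_on_cont => // x; apply: (Ck_lfun 0).1.
have bh := bounded_on_comp Om s (hk_bounded (n:=n) sc r00).
have bdh := bounded_on_comp Om s (dhk_bounded (n:=n) sc r00).
have bdm := bounded_on_comp Om s (dmk_bounded r0).
have bC a := bounded_on_cst Om a.
apply: bounded_onD; last by apply: bounded_onN; exact: bounded_onM.
apply: bounded_onM; first exact: bounded_onM.
apply: bounded_onD; last by apply: bounded_onN; exact: bounded_onM.
by apply: bounded_onD => //; exact: bounded_onM.
Qed.

Lemma H10_upot : H10 Om u weak_grad_upot.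
Proof.
have bO : bounded_set Om by exact: bounded_Omega.
have oO : open Om by exact: open_Omega.
have bu : bounded_on Om upot_smooth.
  have bl : bounded_on Om (fun _ => l).
    by apply: bounded_on_cont => // x; apply: (Ck_lfun 0).1.
  have bs : bounded_on Om (fun _ => s).
    by apply: bounded_on_cont => // x; exact: dotv_continuous.
  have bh := bounded_on_comp Om s (hk_bounded (n:=n) sc r00).
  have bC a := bounded_on_cst Om a.
  have bm : bounded_on Om (fun k x => mk k (s x)).
    apply: bounded_onD => //; have [C C0 h] := bounded_onD bs (bC (- r0 ^+ 2)).
    exists C => // k x Ox; exact: le_trans (scut_le _ _ _) (h k x Ox).
  apply: bounded_onD; last by apply: bounded_onN; exact: bounded_onM.
  apply: bounded_onD; last by apply: bounded_onN.
  by apply: bounded_onD; apply: bounded_onM => //; apply: bounded_onD => //; apply: bounded_onN.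
have [C1 C10 h1] := bu.
have bdphi i : bounded_on Om (fun k => partial i (upot_test k)).
  have [C C0 hC] := @dscut_bounded R (-1); have [B B0 hB] := bounded_on_dupot_smooth i.
  exists (C * B); first exact: mulr_ge0.
  move=> k x Ox; rewrite (partial_is_derive (is_derive_upot_test k i x)) normrM.
  by rewrite ler_pM ?hC ?hB.
have [C2 C20 h2] := bounded_on_all bdphi.
have near_scale x : Om x -> \forall k \near \oo, 1 <= k.+1%:R * - u x + -1.
  move=> Ox; have ux : 0 < - u x by rewrite oppr_gt0.
  have : \forall k \near \oo, 2 / - u x <= k%:R :> R by exact: nbhs_infty_ger.
  apply: filterS => k h; suff : 2 <= k.+1%:R * - u x by lra.
  by rewrite -ler_pdivrMr// (le_trans h)// ler_nat.
apply: (@H10_approx _ _ _ oO bO u weak_grad_upot upot_test (C1 + C2)).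
- exact: test_upot_test.
- move=> k x Ox; rewrite /upot_test normrN (le_trans (scut_le _ _ _))// normrN.
  by rewrite (le_trans (h1 k x Ox))// lerDl.
- by move=> k i x Ox; rewrite (le_trans (h2 k i x Ox))// lerDr.
- move=> x Ox; have := near_scale x Ox; have := upot_smooth_eventually x.
  apply: filterS2 => k [h _] hk2.
  by rewrite /upot_test h scut_eq ?opprK.
- move=> i x Ox; have := near_scale x Ox; have := upot_smooth_eventually x.
  apply: filterS2 => k [h hd] hk2.
  by rewrite (partial_is_derive (is_derive_upot_test k i x)) h hd dscut_eq1 ?mul1r.
Qed.

Let ddh k x : R := derive1 (dhk k) (s x).

Lemma is_derive_flux k i x : is_derive x (delta_mx 0 i) (flux k i)
  (1 + - 2 * (dhk k (s x) * l x) + - 4 * (l x * ddh k x) * ((x - c) 0 i * (x - c) 0 i) +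
   (2 * dhk k (s x) + 4 * (s x * ddh k x) + 2 * n.+1%:R * dhk k (s x)) * ((x - c) 0 i * dl i)).
Proof.
have cD a := is_derive_cstf x (delta_mx 0 i) a.
have dX : is_derive x (delta_mx 0 i) (fun y => (y - c) 0 i) 1.
  by have := is_derive_centered c x (delta_mx 0 i) i; rewrite mxE !eqxx.
have dL := is_derive_lfun x i.
have dS : is_derive x (delta_mx 0 i) s _ := is_derive_dist_sqr c x i.
have dh := is_derive_radial i (is_derive_hk k (s x)).
have ddh' := is_derive_radial i (Ck1_is_derive (smooth1_dhk k 1%N) (s x)).
apply: (is_derive_congr (is_derive_addf (is_derive_addf
   (is_derive_addf dX (cD (- dl i)))
   (is_derive_mulf (cD (- 2)) (is_derive_mulf ddh' (is_derive_mulf dX dL))))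
   (is_derive_mulf (is_derive_addf
      (is_derive_mulf (cD 2) (is_derive_mulf ddh' dS))
      (is_derive_mulf (cD n.+1%:R) (is_derive_addf dh (cD (- sc^-1)))))
     (cD (dl i))))).
  by move=> y; rewrite /flux; ring.
rewrite /ddh; ring.
Qed.

(** In the sum over i the terms with the second derivative of [hk] cancel, and those with the first
    derivative have total coefficient -2N + 2 + 2(N - 1) = 0. This holds for any radial profile,
    hence at each stage of the smoothing. *)
Lemma div_flux k x : \sum_i partial i (flux k i) x = N%:R.
Proof.
under eq_bigr => i _ do rewrite (partial_is_derive (is_derive_flux k i x)).
rewrite !big_split/= -!mulr_sumr !sumr_const card_ord.
have -> : \sum_i (x - c) 0 i * (x - c) 0 i = s x by [].
have -> : \sum_i (x - c) 0 i * dl i = l x.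
  rewrite (bigD1 ord0)//= big1 ?addr0 => [|i /negbTE ->]; last by rewrite !mulr0.
  by rewrite mulr1 mulrC.
rewrite -[(x - c) 0 0 *+ N]mulr_natr -[N%:R]natr1 /lfun; ring.
Qed.

Lemma Ck_flux j k i : Ck j setT (flux k i).
Proof.
have oT := @openT 'rV[R]_N; have C0 := Ck_cst j [set: 'rV[R]_N].
have CX := Ck_centered j c i; have CL := Ck_lfun j.
have CS : Ck j setT s := Ck_dist_sqr j c.
have Ch := Ck_radial j (smooth1_hk (n:=n) sc r00 k).
have Cd := Ck_radial j (smooth1_dhk k).
rewrite (_ : flux k i = fun x => (((x - c) 0 i + cst (- dl i) x) +
    cst (-2) x * (dhk k (s x) * ((x - c) 0 i * l x))) +
  (cst 2 x * (dhk k (s x) * s x) + cst n.+1%:R x * (hk k (s x) + cst (- sc^-1) x)) * cst (dl i) x).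
  apply: Ck_add => //.
    apply: Ck_add => //; first exact: Ck_add.
    by do 3?apply: Ck_mul => //.
  apply: Ck_mul => //; apply: Ck_add => //; apply: Ck_mul => //; first exact: Ck_mul.
  exact: Ck_add.
by apply/funext => x; rewrite /flux /=; ring.
Qed.

Lemma bounded_on_flux i : bounded_on Om (flux ^~ i).
Proof.
have bO : bounded_set Om by exact: bounded_Omega.
have bc : bounded_on Om (fun _ x => (x - c) 0 i).
  by apply: bounded_on_cont => // x; apply: (Ck_centered 0 c i).1.
have bl : bounded_on Om (fun _ => l).
  by apply: bounded_on_cont => // x; apply: (Ck_lfun 0).1.
have bs : bounded_on Om (fun _ => s).
  by apply: bounded_on_cont => // x; exact: dotv_continuous.
have bh := bounded_on_comp Om s (hk_bounded (n:=n) sc r00).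
have bdh := bounded_on_comp Om s (dhk_bounded (n:=n) sc r00).
have bC a := bounded_on_cst Om a.
apply: bounded_onD; last first.
  apply: bounded_onM => //; apply: bounded_onD; apply: bounded_onM => //.
    exact: bounded_onM.
  by apply: bounded_onD => //; exact: bounded_onN.
apply: bounded_onD; first by apply: bounded_onD => //; exact: bounded_onN.
by apply: bounded_onN; do 3?apply: bounded_onM => //.
Qed.

Lemma sc_alpha : N%:R * alpha (n:=n) sc = N%:R / sc + 1 - sc^-1.
Proof. by rewrite /alpha mulrBr [N%:R * (_ / _)]mulrC divfK ?pnatr_eq0// opprB addrA. Qed.

(** Inside the ball the profile is the constant 1/sc, and the flux reduces to that of a quadratic
    polynomial. Outside, the coefficient of the linear term becomes [1 - Hfun (E x)], which is what
    the gradient of [u] requires. *)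
Lemma flux_eventually i x : Om x ->
  \forall k \near \oo, flux k i x = conductivity sc D Om x * weak_grad_upot x 0 i.
Proof.
move=> Ox; have := mk_eventually r00 (s x); apply: filterS => k [h1 h2].
have Es : r0 ^+ 2 <= s x = (r0 <= E x).
  by rewrite sqE ler_pXn2r// nnegrE ?enorm_ge0// ltW.
have b1 : (nat_of_bool true)%:R = 1 :> R by [].
have b0 : (nat_of_bool false)%:R = 0 :> R by [].
rewrite mxE /outer_ind /sq_max /flux /dhk /hk h1 h2 Es /conductivity.
have [rx|rx] := leP r0 (E x).
  have nD : ~ D x by rewrite /eball/= => /(le_lt_trans rx); rewrite ltxx.
  rewrite !indicE memNset// [x \in _]mem_set//.
  rewrite max_l ?Es// -[Num.sqrt _]/(E x).
  have E0 : 0 < E x := lt_le_trans r00 rx.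
  (* Euler's identity: [Hfun - alpha] is homogeneous of degree -N in the radius, hence of degree
     -N/2 in its square. *)
  have q : dH (n:=n) r0 sc (E x) * s x = - (N%:R / 2) * (Hfun (n:=n) r0 sc (E x) - alpha (n:=n) sc).
    rewrite /dH /Hfun [alpha _ + _]addrC addrK sqE [E x ^+ N.+2]exprS [E x ^+ N.+1]exprS.
    by field; rewrite expf_neq0 gt_eqF.
  rewrite !b1 !b0 mulr0 add0r mul1r !mulr1.
  have -> : 2 * (dH (n:=n) r0 sc (E x) * s x) + n.+1%:R * (Hfun (n:=n) r0 sc (E x) - sc^-1)
     = - Hfun (n:=n) r0 sc (E x) + 1.
    rewrite q; have := sc_alpha; rewrite -[N%:R]natr1; lra.
  by field; rewrite gt_eqF.
have xD : D x by [].
have nO : ~ (Om `\` D) x by case.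
rewrite !indicE mem_set// memNset//.
rewrite max_r; last by rewrite ltW// ltNge Es -ltNge.
rewrite sqrtr_sqr (gtr0_norm r00) Hfun_r0//.
rewrite !b1 !b0.
by field; rewrite gt_eqF.
Qed.

Lemma weak_solution_upot : weak_solution sc D Om u.
Proof.
have [C C0 h] := bounded_on_all bounded_on_flux.
have oO : open Om by exact: open_Omega.
have bO : bounded_set Om by exact: bounded_Omega.
have Hu : H10 Om u weak_grad_upot by exact: H10_upot.
apply: (@weak_solution_approx _ _ _ oO bO sc D u weak_grad_upot flux C) => //.
- by move=> k i; exact: Ck_flux.
- exact: div_flux.
- exact: flux_eventually.
Qed.

Lemma Ck_upot_in : Ck 1 D (fun x => u x).
Proof.
have oT := @openT 'rV[R]_N.
have oD : open D by exact: open_eball.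
have C0 := Ck_cst 1 [set: 'rV[R]_N].
pose p x := (s x + cst (- r0 ^+ 2) x) * cst (2 * sc)^-1 x + cst (- (3 / 2 * r0 ^+ 2)) x
   + cst (- sc^-1) x * l x.
apply: (@Ck_eq _ _ _ _ p) => //.
  move=> x xD; rewrite (upot_in eps r00 sc0 (ltW xD)) /p /= sqE; ring.
apply: (@Ck_subset _ _ _ _ setT) => //; apply: Ck_add => //.
  apply: Ck_add => //; apply: Ck_mul => //; apply: Ck_add => //.
  exact: Ck_dist_sqr.
by apply: Ck_mul => //; exact: Ck_lfun.
Qed.

Lemma two_phase_upot : two_phase_solution sc D Om u.
Proof.
split; first exact: weak_solution_upot.
apply: (@Ck_subset _ _ _ _ (D `|` [set x | r0 < E x])).
  move=> x [_]; rewrite bdry_eball// => /= h.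
  have [e|e|e] := ltgtP (E x) r0; [by left|by right|by case: h].
apply: Ck_setU; first exact: Ck_upot_in.
apply: (@Ck_eq _ _ _ _ (upot_smooth 0)).
- rewrite (_ : [set x | _] = ~` [set x | E x <= r0]).
    by apply: closed_openC; apply: closed_le_continuous; exact: enorm_continuous.
  by apply/seteqP; split => x /=; rewrite ltNge => /negP.
- by move=> x /ltW; exact: upot_smooth_out.
- by apply: (@Ck_subset _ _ _ _ setT) => //; exact: Ck_upot_smooth.
Qed.

End two_phase_pde.

(** * Overdetermined level sets *)

Section level_sets.
Context {R : realType} {n : nat}.
Variables (c : 'rV[R]_n.+2) (r0 sc eps : R).
Local Notation N := n.+2.
Local Notation E x := (enorm (x - c)).
Local Notation u := (upot c r0 sc eps).
Local Notation Om := (Omega c r0 sc eps).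
Local Notation D := (eball c r0).
Hypotheses (r00 : 0 < r0) (sc0 : 0 < sc) (eps0 : 0 < eps)
  (epsr : eps <= r0 / 4) (epsL : eps * Lip (n:=n) r0 sc <= r0 / 8).

(* The center about which u is radial inside D. *)
Definition shifted_center : 'rV[R]_N := c + eps *: delta_mx 0 0.
Local Notation c1 := shifted_center.

Lemma dotv_delta (x : 'rV[R]_N) i : dotv x (delta_mx 0 i) = x 0 i.
Proof.
rewrite /dotv (bigD1 i)//= big1 ?addr0; first by rewrite mxE !eqxx mulr1.
by move=> j ji; rewrite mxE (negbTE ji) andbF mulr0.
Qed.

Lemma enorm_center : enorm (c1 - c) = eps.
Proof.
rewrite /shifted_center addrC addrA addNr add0r enormZ gtr0_norm//.
by rewrite /enorm dotv_delta mxE !eqxx sqrtr1 mulr1.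
Qed.

(** Completing the square absorbs the linear term -(eps/sc) (x - c)_0 into a shift of the centre by
    eps e_0. *)
Lemma upot_shifted x : D x -> u x =
  dotv (x - c1) (x - c1) / (2 * sc) + (- (eps ^+ 2 + r0 ^+ 2) / (2 * sc) - 3 / 2 * r0 ^+ 2).
Proof.
move=> Dx; rewrite (upot_in eps r00 sc0 (ltW Dx)) sqr_enorm /lfun.
have -> : x - c1 = (x - c) - eps *: delta_mx 0 0 by rewrite /shifted_center opprD addrA.
move: (x - c) => y; rewrite dotvDl !dotvDr !dotvNl !dotvNr !dotvZl !dotvZr !dotv_delta.
rewrite [dotv (delta_mx _ _) _]dotvC dotv_delta [delta_mx _ _ _ _]mxE !eqxx.
by rewrite /=; field; rewrite gt_eqF.
Qed.

Lemma grad_upot x : D x -> grad u x = sc^-1 *: (x - c1).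
Proof.
move=> Dx; apply/rowP => i; rewrite mxE [RHS]mxE.
pose p (y : 'rV[R]_N) := dotv (y - c1) (y - c1) / (2 * sc) +
  (- (eps ^+ 2 + r0 ^+ 2) / (2 * sc) - 3 / 2 * r0 ^+ 2).
have -> : partial i u x = partial i p x.
  apply: near_eq_derive; have := open_nbhs_nbhs (conj (@open_eball _ _ c r0) Dx).
  by apply: (@filterS _ (nbhs x)) => y; exact: upot_shifted.
have cD a := is_derive_cstf x (delta_mx 0 i) a.
rewrite (partial_is_derive (is_derive_addf
  (is_derive_mulf (is_derive_dist_sqr c1 x i) (cD (2 * sc)^-1)) (cD _))).
by rewrite mulr0 add0r addr0; field; rewrite gt_eqF.
Qed.

Lemma closure_inner rho x : 0 < rho -> rho <= r0 / 2 ->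
  closure (eball c1 rho) x -> E x <= rho + eps.
Proof.
move=> rho0 rhor; rewrite closure_eball//= => h.
have := enormD (x - c1) (c1 - c); rewrite addrA subrK enorm_center; lra.
Qed.

Lemma overdetermined_inner rho : 0 < rho -> rho <= r0 / 2 ->
  overdetermined_level_set D Om u (eball c1 rho).
Proof.
move=> rho0 rhor.
have sub x : closure (eball c1 rho) x -> D x.
  move=> /(closure_inner rho0 rhor) h; apply: le_lt_trans h _.
  by have := r00; have := epsr; lra.
have bD x : bdry (eball c1 rho) x -> D x by move=> [/sub].
split.
- split; [exists c1|exact: open_eball|exact: connected_eball].
  by rewrite /eball/= subrr enorm0.
- by move=> x /sub xD; apply: (closure_D0 r00 sc0 eps0 epsL); exact: subset_closure.
- apply/seteqP; split => // x [/bD xD]; rewrite bdry_eball//= => xE.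
  by move: xD; rewrite /eball/= xE ltxx.
- split; eexists => x xb.
    rewrite upot_shifted; last exact: bD.
    move: xb; rewrite bdry_eball//= -sqr_enorm => ->; reflexivity.
  rewrite grad_upot; last exact: bD.
  by move: xb; rewrite bdry_eball//= enormZ => ->; reflexivity.
Qed.

Lemma overdetermination_upot (a : nat) : (0 < a)%N ->
  overdetermination_type sc D Om a 0.
Proof.
move=> a0; exists u; split; first exact: two_phase_upot.
(* The radii increase with i and stay below [rho a = r0 / 2]; with eps <= r0/4 the closed balls
   about the shifted centre then lie in [D]. *)
pose rho i : R := r0 / 2 * (i.+1%:R / a.+1%:R).
have rho0 i : 0 < rho i by rewrite /rho !mulr_gt0 ?divr_gt0 ?ltr0n.
have rho_lt i j : (i < j)%N -> rho i < rho j.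
  by move=> ij; rewrite /rho ltr_pM2l ?divr_gt0// ltr_pM2r ?invr_gt0 ?ltr0n// ltr_nat ltnS.
have rho_a : rho a = r0 / 2 by rewrite /rho divff ?mulr1.
pose W i := if (i < a)%N then eball c1 (rho i) else if i == a then D else Om.
have Wlt i : (i < a)%N -> W i = eball c1 (rho i) by rewrite /W => ->.
have Wa : W a = D by rewrite /W ltnn eqxx.
have WS : W a.+1 = Om by rewrite /W ltnNge leqnSn/= gtn_eqF.
exists W; rewrite addn0; split => // i.
- rewrite leq_eqVlt => /predU1P[->|ia].
    by rewrite /compactly_contained Wa WS; exact: closure_D0.
  rewrite /compactly_contained (Wlt i ia).
  have [ja|] := ltnP i.+1 a.
    rewrite (Wlt _ ja) closure_eball// => x /= xi.
    exact: le_lt_trans xi (rho_lt _ _ (ltnSn i)).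
  move=> ai; have <- : a = i.+1 by apply/eqP; rewrite eqn_leq ai ia.
  rewrite Wa => x; have ri : rho i <= r0 / 2 by rewrite -rho_a ltW// rho_lt.
  move=> /(closure_inner (rho0 i) ri) h; apply: le_lt_trans h _.
  by have := r00; have := epsr; lra.
- move=> ia /eqP na; have ia' : (i < a)%N by rewrite ltn_neqAle na.
  rewrite (Wlt i ia'); split; first by rewrite bdry_eball//; exact: connected_sphere.
  by apply: overdetermined_inner => //; rewrite -rho_a ltW// rho_lt.
Qed.

End level_sets.

Theorem theorem4 (R : realType) (N : nat) (hN : (2 <= N)%N) (sc : R)
    (hsc : 0 < sc) (a : nat) (ha : (0 < a)%N)
    (D0 : set 'rV[R]_N) (hD0 : is_eball D0) :
  exists Om : set 'rV[R]_N,
    [/\ domain Om, bounded_set Om, compactly_contained D0 Om,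
        connected (Om `\` closure D0) & analytic_boundary Om] /\
    ~ concentric_balls D0 Om /\
    overdetermination_type sc D0 Om a 0.
Proof.
case: N hN D0 hD0 => [|[|n]]// _ D0 [c [r0 [r00 ->]]].
pose L := Lip (n:=n) r0 sc.
have L0 : 0 <= L.
  rewrite addr_ge0// mulr_ge0 ?addr_ge0 ?mulr_ge0 ?ler0n//.
  by rewrite invr_ge0 exprn_ge0// ltW.
have L1 : 0 < 8 * (L + 1) by rewrite mulr_gt0// ltr_wpDl.
(* The first bound gives [eps * L <= r0 / 8], where L + 1 is positive as soon as L >= 0. The second
   keeps the level spheres inside the ball. *)
pose eps := Num.min (r0 / (8 * (L + 1))) (r0 / 4).
have eps0 : 0 < eps by rewrite lt_min !divr_gt0.
have epsr : eps <= r0 / 4 by rewrite ge_min lexx orbT.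
have epsL : eps * L <= r0 / 8.
  have : eps * (8 * (L + 1)) <= r0 by rewrite -ler_pdivlMr// ge_min lexx.
  have := ltW eps0; lra.
exists (Omega c r0 sc eps); split; [split|split].
- exact: domain_Omega.
- exact: bounded_Omega.
- exact: closure_D0.
- exact: connected_annulus.
- exact: analytic_boundary_Omega.
- exact: not_concentric_Omega.
- exact: overdetermination_upot.
Qed.
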